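(* Let $G$ be a finite group, $k$ a field of characteristic $p>0$, and let $\zeta\in H^n(G,k)$ be a nonzero cohomology class of degree $n\ge1$. Let $\psi:\mathbf{P}(\zeta)\to\mathbf{P}(\zeta\oplus\zeta)$ be the chain map, and $\pi:\mathbf{P}(\zeta)\otimes\mathbf{P}(\zeta)\to\mathbf{P}(\zeta\oplus\zeta)$ the surjection, described in the context. If $p>2$ and $n$ is even, then $\psi$ lifts to a chain map $\tilde\psi:\mathbf{P}(\zeta)\to\mathbf{P}(\zeta)\otimes\mathbf{P}(\zeta)$ satisfying $\pi\tilde\psi=\psi$. For $p=2$, such a lifting exists if and only if $\widetilde{Sq}^{n-1}\zeta$ is a multiple of $\zeta$ in $H^*(G,k)$.
   Context: All modules are finitely generated; chain complexes are complexes of $kG$-modules bounded below. Tensor products are over $k$ with diagonal $G$-action and differential $\partial(x\otimes y)=\partial x\otimes y+(-1)^{\deg x}x\otimes\partial y$. $(\Sigma^m\mathbf{C})_i=\mathbf{C}_{i-m}$ with differential $(-1)^m\partial$. $[\mathbf{C},\mathbf{D}]$ is the group of homotopy classes of chain maps. For homogeneous maps, $(f\times g)(x\otimes y)=(-1)^{\deg x\,\deg g}f(x)\otimes g(y)$. Let $\mathbf{P}$ be a projective resolution of $k$ as a $kG$-module (positive chain complex, augmentation $\epsilon$), $\mathbf{Q}=\Sigma^{n-1}\mathbf{P}$, and let $\alpha:\mathbf{P}\to\Sigma\mathbf{Q}$ be a chain map representing $\zeta$ under $[\mathbf{P},\Sigma^n\mathbf{P}]=H^n(G,k)$; $\alpha$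 is also regarded as a map $\mathbf{P}\to\mathbf{Q}$ of degree $-1$ with $\partial\alpha=-\alpha\partial$. $\mathbf{P}(\zeta)$ is the complex $\mathbf{Q}_i\oplus\mathbf{P}_i$ with differential $\begin{pmatrix}\partial&\alpha\\0&\partial\end{pmatrix}$. $\mathbf{P}(\zeta\oplus\zeta)$ is the complex with $\mathbf{P}(\zeta\oplus\zeta)_i=(\mathbf{Q}\otimes\mathbf{P})_i\oplus(\mathbf{P}\otimes\mathbf{Q})_i\oplus(\mathbf{P}\otimes\mathbf{P})_i$ and differential $\begin{pmatrix}\partial&0&\alpha\times\mathrm{id}\\0&\partial&\mathrm{id}\times\alpha\\0&0&\partial\end{pmatrix}$. The map $\pi:\mathbf{P}(\zeta)\otimes\mathbf{P}(\zeta)\to\mathbf{P}(\zeta\oplus\zeta)$ is the quotient map by the subcomplex $\mathbf{Q}\otimes\mathbf{Q}$. Let $\Delta:\mathbf{P}\to\mathbf{P}\otimes\mathbf{P}$, $\Delta_1:\mathbf{Q}\to\mathbf{Q}\otimes\mathbf{P}$, $\Delta_2:\mathbf{Q}\to\mathbf{P}\otimes\mathbf{Q}$ be chain maps covering $k\to k\otimes k$, $\lambda\mapsto\lambda\otimes1$ (on the unique nonzero homology groups). The map $\psi:\mathbf{P}(\zeta)\to\mathbf{P}(\zeta\oplus\zeta)$ is a chain map which restricts to $(\Delta_1,\Delta_2):\mathbf{Q}\to(\mathbf{Q}\otimes\mathbf{P})\oplus(\mathbf{P}\otimes\mathbf{Q})$ on the subcomplexes and induces $\Delta:\mathbf{P}\to\mathbf{P}\otimes\mathbf{P}$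 on the quotients of the extensions $0\to\mathbf{Q}\to\mathbf{P}(\zeta)\to\mathbf{P}\to0$ and $0\to(\mathbf{Q}\otimes\mathbf{P})\oplus(\mathbf{P}\otimes\mathbf{Q})\to\mathbf{P}(\zeta\oplus\zeta)\to\mathbf{P}\otimes\mathbf{P}\to0$. Such a $\psi$ always exists; it is not unique, but whether it lifts along $\pi$ does not depend on the choice. For $p=2$: $H^*(G,k)\cong k\otimes_{\mathbb{F}_2}H^*(G,\mathbb{F}_2)$ has a $k$-basis $\{u_i\}$ lying in $H^*(G,\mathbb{F}_2)$, and $\widetilde{Sq}^{n-1}$ is the semilinear extension of the Steenrod square: $\widetilde{Sq}^{n-1}(\sum_i\lambda_iu_i)=\sum_i\lambda_i^2Sq^{n-1}u_i$. *)

(* Defs.v *)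
From HB Require Import structures.
From mathcomp Require Import all_boot all_order all_algebra all_fingroup.
From mathcomp Require Import mxrepresentation mxtens.

Set Implicit Arguments.
Unset Strict Implicit.
Unset Printing Implicit Defensive.

Import GRing.Theory.
Local Open Scope ring_scope.

(* A finitely generated kG-module is a matrix representation
   (mx_repr) of G on k^m; as everywhere in MathComp, vectors are rows, matrices
   act on the right and A *m B means "A, then B".

   Graded maps of arbitrary degree are families f i j of blocks, one for every
   pair (source degree, target degree); the blocks outside the diagonal
   j = deg f + i vanish.  This avoids all casts between degrees: for instance
   the composite of f with a differential d is f i j.+1 *m d j.+1 j, and the
   composite of d with f is d i i.-1 *m f i.-1 j (d 0 0 being 0). *)

Section Graded.

Variable k : fieldType.

Definition gmap (p q : nat -> nat) := forall i j : nat, 'M[k]_(p i, q j).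

(* Homogeneous of degree r >= 0 *)
Definition homog (p q : nat -> nat) (r : nat) (f : gmap p q) :=
  forall i j, j != (r + i)%N -> f i j = 0.

(* pid_mx is the identity matrix when i = j. *)
Definition gid (p : nat -> nat) : gmap p p :=
  fun i j => if i == j then pid_mx (p i) else 0.

(* Linear forms on a graded module: c i is the restriction to degree i. *)
Definition gform (p : nat -> nat) := forall i : nat, 'cV[k]_(p i).

Definition pullback (p q : nat -> nat) (r : nat) (f : gmap p q)
    (c : gform q) : gform p :=
  fun i => f i (r + i)%N *m c (r + i)%N.

(* Degree n of the tensor product is the direct sum over i <= n of the
   (degree i) ⊗ (degree n - i), where ⊗ is the Kronecker product of mxtens. *)
Definition tdim (p q : nat -> nat) (n : nat) : nat :=
  (\sum_(i < n.+1) p i * q (n - i))%N.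

(* f × g; on the block with source degrees (a, n - a) and target degrees
   (b, m - b), deg g = (m - b) - (n - a), whence the Koszul sign. *)
Definition gtens (p q p' q' : nat -> nat) (f : gmap p p') (g : gmap q q') :
    gmap (tdim p q) (tdim p' q') :=
  fun n m => \mxblock_(a < n.+1, b < m.+1)
    ((-1) ^+ (a * ((n - a) + (m - b))) *: (f a b *t g (n - a)%N (m - b)%N)).

(* b × c followed by k ⊗ k = k; the part of c nonzero in degree j is a
   homogeneous map of degree -j. *)
Definition ftens (p q : nat -> nat) (b : gform p) (c : gform q) :
    gform (tdim p q) :=
  fun n => \mxcol_(a < n.+1)
    ((-1) ^+ (a * (n - a)) *: (b a *t c (n - a)%N : 'cV[k]_(p a * q (n - a)%N))).

(* The linear map k^(a*b) -> k^(c*d), x ⊗ y |-> y ⊗ x, when a = d and b = c *)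
Definition swap_mx (a b c d : nat) : 'M[k]_(a * b, c * d) :=
  \matrix_(u, v)
    (((mxtens_unindex u).1 == (mxtens_unindex v).2 :> nat)
     && ((mxtens_unindex u).2 == (mxtens_unindex v).1 :> nat))%:R.

(* x ⊗ y |-> (-1)^(deg x * deg y) y ⊗ x *)
Definition gswap (p : nat -> nat) : gmap (tdim p p) (tdim p p) :=
  fun n m => \mxblock_(a < n.+1, b < m.+1)
    (if (m == n) && (a + b == n)%N
     then (-1) ^+ (a * b) *: swap_mx (p a) (p (n - a)%N) (p b) (p (m - b)%N)
     else 0).

End Graded.

Arguments gid {k} p.
Arguments gswap {k} p.

(* The data of a chain complex of kG-modules concentrated in degrees >= 0; the
   axioms are in is_complex. *)
Record gcomplex (k : fieldType) (gT : finGroupType) := GComplex {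
  cdim :> nat -> nat;
  cact : forall i : nat, gT -> 'M[k]_(cdim i);
  cdiff : gmap k cdim cdim
}.

Section Complexes.

Variables (k : fieldType) (gT : finGroupType) (G : {group gT}).
Implicit Types C D : gcomplex k gT.

Record is_complex C : Prop := IsComplex {
  complex_repr : forall i, mx_repr G (cact C i);
  complex_deg : forall i j, i != j.+1 -> cdiff C i j = 0;
  complex_equi : forall g i j, g \in G ->
    cact C i g *m cdiff C i j = cdiff C i j *m cact C j g;
  complex_dd : forall i j l, cdiff C i j *m cdiff C j l = 0
}.

Definition equivariant C D (f : gmap k C D) :=
  forall g i j, g \in G -> cact C i g *m f i j = f i j *m cact D j g.

Definition chain_map C D (f : gmap k C D) :=
  [/\ homog 0 f, equivariant f &
      forall i, cdiff C i.+1 i *m f i i = f i.+1 i.+1 *m cdiff D i.+1 i].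

Definition susp C : gcomplex k gT :=
  @GComplex k gT
    (fun i => if i is i'.+1 then C i' else 0%N)
    (fun i => match i with 0%N => fun _ => 0 | i'.+1 => cact C i' end)
    (fun i j => match i, j with
                | i'.+1, j'.+1 => - cdiff C i' j'
                | _, _ => 0
                end).

Definition susp_form C (c : gform k C) : gform k (susp C) :=
  fun i => match i with 0%N => 0 | i'.+1 => c i' end.

(* Σ^m C *)
Fixpoint shift (m : nat) C : gcomplex k gT :=
  if m is m'.+1 then susp (shift m' C) else C.

Fixpoint shift_form (m : nat) C (c : gform k C) : gform k (shift m C) :=
  match m with 0%N => c | m'.+1 => susp_form (shift_form m' c) end.

(* A map C -> ΣD of degree 0, regarded as a map C -> D of degree -1 *)
Definition desusp C D (f : gmap k C (susp D)) : gmap k C D :=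
  fun i j => f i j.+1.

Definition dsum C D : gcomplex k gT :=
  @GComplex k gT (fun i => (C i + D i)%N)
    (fun i g => block_mx (cact C i g) 0 0 (cact D i g))
    (fun i j => block_mx (cdiff C i j) 0 0 (cdiff D i j)).

Definition tens C D : gcomplex k gT :=
  @GComplex k gT (tdim C D)
    (fun n g => \mxdiag_(a < n.+1) (cact C a g *t cact D (n - a)%N g))
    (fun n m => gtens (cdiff C) (gid D) n m + gtens (gid C) (cdiff D) n m).

(* Extension of C by D along f : C -> D of degree -1: the complex D ⊕ C with
   differential (y, x) |-> (∂y + f x, ∂x) *)
Definition ext C D (f : gmap k C D) : gcomplex k gT :=
  @GComplex k gT (fun i => (D i + C i)%N)
    (fun i g => block_mx (cact D i g) 0 0 (cact C i g))
    (fun i j => block_mx (cdiff D i j) 0 (f i j) (cdiff C i j)).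

(* The graded projections of ext f *)
Definition ext_sub C D (f : gmap k C D) : gmap k (ext f) D :=
  fun i j => col_mx (gid D i j) 0.
Definition ext_quo C D (f : gmap k C D) : gmap k (ext f) C :=
  fun i j => col_mx 0 (gid C i j).

(* P(ζ ⊕ ζ) *)
Definition ext2 (P Q : gcomplex k gT) (a : gmap k P Q) : gcomplex k gT :=
  @ext (tens P P) (dsum (tens Q P) (tens P Q))
    (fun i j => row_mx (gtens a (gid P) i j) (gtens (gid P) a i j)).

(* π : P(ζ) ⊗ P(ζ) -> P(ζ ⊕ ζ) *)
Definition ext_pi (P Q : gcomplex k gT) (a : gmap k P Q) :
    gmap k (tens (ext a) (ext a)) (ext2 a) :=
  fun i j =>
    row_mx (row_mx (gtens (ext_sub a) (ext_quo a) i j)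
                   (gtens (ext_quo a) (ext_sub a) i j))
           (gtens (ext_quo a) (ext_quo a) i j).

(* Projectivity among finitely generated modules *)
Definition projective_repr (n : nat) (r : gT -> 'M[k]_n) :=
  forall (a b : nat) (ra : gT -> 'M[k]_a) (rb : gT -> 'M[k]_b)
         (f : 'M[k]_(a, b)) (h : 'M[k]_(n, b)),
    mx_repr G ra -> mx_repr G rb ->
    {in G, forall g, ra g *m f = f *m rb g} -> row_full f ->
    {in G, forall g, r g *m h = h *m rb g} ->
  exists h' : 'M[k]_(n, a),
    {in G, forall g, r g *m h' = h' *m ra g} /\ h' *m f = h.

Definition concentrated C (n : nat) (c : gform k C) :=
  forall i, i != n -> c i = 0.

(* Elements of Hom_kG(C, k) *)
Definition cochain C (c : gform k C) :=
  forall g i, g \in G -> cact C i g *m c i = c i.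

Record resolution (P : gcomplex k gT) (eps : gform k P) : Prop := Resolution {
  res_complex : is_complex P;
  res_proj : forall i, projective_repr (cact P i);
  res_aug_conc : concentrated 0 eps;
  res_aug_equi : cochain eps;
  res_aug_onto : row_full (eps 0%N);
  res_exact0 : (cdiff P 1%N 0%N == kermx (eps 0%N))%MS;
  res_exact : forall i, (cdiff P i.+2 i.+1 == kermx (cdiff P i.+1 i))%MS
}.

Definition cocycle C (c : gform k C) :=
  cochain c /\ forall i, cdiff C i.+1 i *m c i = 0.

Definition coboundary C (c : gform k C) :=
  exists2 b : gform k C, cochain b & forall i, c i = cdiff C i i.-1 *m b i.-1.

Definition cohomologous C (c c' : gform k C) :=
  coboundary (fun i => c i - c' i).

(* f covers the identity of k with respect to the augmentations e and e'. *)
Definition covers C D (f : gmap k C D) (e : gform k C) (e' : gform k D) :=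
  chain_map f /\ forall i, pullback 0 f e' i = e i.

Definition cup (P : gcomplex k gT) (Delta : gmap k P (tens P P))
    (b c : gform k P) : gform k P :=
  pullback 0 Delta (ftens b c).

(* The class of c is a multiple x c of the class of z in H^*(G, k), where
   H^*(G, k) is computed by the resolution P with diagonal Delta; x is a
   finite sum of homogeneous cocycles. *)
Definition multiple_of (P : gcomplex k gT) (Delta : gmap k P (tens P P))
    (c z : gform k P) :=
  exists x : gform k P,
    [/\ cocycle x, exists N, forall i, (N <= i)%N -> x i = 0
      & cohomologous c (cup Delta x z)].

Definition cohomology_basis (P : gcomplex k gT) (n N : nat)
    (v : 'I_N -> gform k P) :=
  [/\ forall a, cocycle (v a) /\ concentrated n (v a),
      forall c, cocycle c -> concentrated n c ->
        exists l : 'I_N -> k, cohomologous c (fun i => \sum_a l a *: v a i)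
    & forall l : 'I_N -> k, coboundary (fun i => \sum_a l a *: v a i) ->
        forall a, l a = 0].

(* ψ restricts to (Δ1, Δ2) on Q and induces Δ on P. *)
Definition extends_diagonals (P Q : gcomplex k gT) (a : gmap k P Q)
    (Delta : gmap k P (tens P P)) (Delta1 : gmap k Q (tens Q P))
    (Delta2 : gmap k Q (tens P Q)) (psi : gmap k (ext a) (ext2 a)) :=
  forall i, [/\ ulsubmx (psi i i) = row_mx (Delta1 i i) (Delta2 i i),
                ursubmx (psi i i) = 0
              & drsubmx (psi i i) = Delta i i].

End Complexes.

(* Steenrod's cup-i construction: D 0 is a diagonal and D r.+1 is a homotopy
   of degree r + 1 from D r to its composite with the swap (no sign is needed
   over 'F_2). *)
Definition cup_i_system (gT : finGroupType) (G : {group gT})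
    (P : gcomplex 'F_2 gT) (eps : gform 'F_2 P)
    (D : nat -> gmap 'F_2 P (tens P P)) :=
  [/\ covers G (D 0%N) eps (ftens eps eps),
      forall r, homog r (D r) /\ equivariant G (D r)
    & forall r i j,
        D r.+1 i j.+1 *m cdiff (tens P P) j.+1 j
          + cdiff P i i.-1 *m D r.+1 i.-1 j
        = D r i j + D r i j *m gswap P j j].

(* Sq^r u = u ∪_(n - r) u for u of degree n *)
Definition steenrod_sq (gT : finGroupType) (P : gcomplex 'F_2 gT)
    (D : nat -> gmap 'F_2 P (tens P P)) (n r : nat) (u : gform 'F_2 P) :
    gform 'F_2 P :=
  if (r <= n)%N then pullback (n - r) (D (n - r)%N) (ftens u u)
  else fun i => 0.

Section BaseChange.

Variables (F k : fieldType) (iota : {rmorphism F -> k}) (gT : finGroupType).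

(* k ⊗_F C *)
Definition base_change (C : gcomplex F gT) : gcomplex k gT :=
  @GComplex k gT C (fun i g => map_mx iota (cact C i g))
    (fun i j => map_mx iota (cdiff C i j)).

Definition base_change_form (C : gcomplex F gT) (c : gform F C) :
    gform k (base_change C) :=
  fun i => map_mx iota (c i).

(* The map H^*(G, F) -> H^*(G, k) on cocycles: theta is a comparison map from
   a resolution over k to the base change of one over F. *)
Definition extend_form (P : gcomplex k gT) (P0 : gcomplex F gT)
    (theta : gmap k P (base_change P0)) (c : gform F P0) : gform k P :=
  pullback 0 theta (base_change_form c).

End BaseChange.

(* Main.v *)
Require Import Defs.
From HB Require Import structures.
From mathcomp Require Import all_boot all_order all_algebra all_fingroup.
From mathcomp Require Import mxrepresentation mxtens.
From mathcomp Require Import zify ring.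
From Stdlib Require Import ClassicalEpsilon.

Set Implicit Arguments.
Unset Strict Implicit.
Unset Printing Implicit Defensive.

Import GRing.Theory.
Local Open Scope ring_scope.

(** Write d for all differentials, N = n - 1, T for the signed exchange of two
tensor factors, F = e × z where e is the augmentation of Q in degree N and
z = e α the cocycle that represents ζ.  In the comments maps compose from right
to left; in the code matrices act on row vectors, so the factors stand in the
opposite order.

The kernel of π is Q ⊗ Q, a complex whose only homology is k in degree 2N, and
P(ζ) is projective in every degree.  Hence ψ lifts along π exactly when a
single class vanishes: the composite of ψ with the connecting map κ from
P(ζ ⊕ ζ) to Q ⊗ Q (of degree -1) and with e × e, a class of degree 2N + 1 on
P(ζ) ([lifts_iff]).  All maps and homotopies are built degree by degree from
projectivity ([homotopy_extension]); Q ⊗ Q is exact above its lowest degree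
because over k alone both factors contract ([contraction], [tens_augmented]).

Suppose (-1)^n = 1 in k, which holds in both cases of the theorem.  On the
subcomplex Q the obstruction is F (Δ1 - T Δ2), and it is killed by a homotopy
Y from Δ1 to T Δ2.  What is left is a class on P, known up to the image of
H^2N(Q) under α, that is, up to multiples of ζ.  Let Y0 be a homotopy from Δ
to T Δ, and let ψ_QP, ψ_PQ be the two components of ψ that go from P to
Q ⊗ P and to P ⊗ Q.  Then

   X = ψ_QP - T ψ_PQ - Y α - (α × 1) Y0

is a chain map P -> Q ⊗ P ([swap_defect_chain]), so it is homotopic to the
cup product with some class of degree N, and F X is again a multiple of ζ.
The remaining class is therefore that of (z × z) Y0, the cup-one square of ζ,
modulo multiples of ζ ([lifts_iff_cup_one]).

If 2 is invertible in k, then T fixes z × z, so that twice (z × z) Y0 is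
(z × z)(1 + T) Y0.  The map (1 + T) Y0 anticommutes with d, since
(1 + T)(1 - T) = 0, and has degree 1, so it is null-homotopic and the class
vanishes ([cup_one_sym], [lifts_of_two_neq0]).

If k has characteristic 2, the cup-one square is additive and semilinear up to
coboundaries, kills coboundaries, and is natural for comparison maps of
resolutions, so it is the semilinear extension of Sq^(n-1)
([cup_one_natural], [cup_one_sq_steenrod], [lifts_iff_multiple]). *)

(** * Lifting through projectives, degree by degree *)
Section Lifting.

Variables (k : fieldType) (gT : finGroupType) (G : {group gT}).
Implicit Types C D : gcomplex k gT.

(** Projectivity lifts along surjections only; an image contained in that of d
is enough, because d is onto once its target is cut down to its image. *)
Lemma projective_lift (r m l : nat) (R : gT -> 'M[k]_r) (B : gT -> 'M[k]_m)
    (A : gT -> 'M[k]_l) (d : 'M_(m, l)) (h : 'M_(r, l)) :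
  projective_repr G R -> mx_repr G B -> mx_repr G A ->
  (forall g, g \in G -> B g *m d = d *m A g) ->
  (forall g, g \in G -> R g *m h = h *m A g) -> (h <= d)%MS ->
  exists h' : 'M_(r, m),
    (forall g, g \in G -> R g *m h' = h' *m B g) /\ h' *m d = h.
Proof.
move=> projR reprB reprA eqd eqh le_hd.
pose rA := MxRepresentation reprA.
have modd : mxmodule rA <<d>>%MS.
  rewrite (eqmx_module _ (genmxE d)).
  by apply/mxmoduleP=> g Gg; rewrite /= -eqd // submxMl.
have sdd : (d <= <<d>>)%MS by rewrite genmxE.
have shd : (h <= <<d>>)%MS by rewrite genmxE.
have [] := projR m _ B (submod_mx modd) (in_submod <<d>>%MS d)
  (in_submod <<d>>%MS h) reprB (submod_mx_repr modd).
- move=> g Gg; rewrite -in_submodJ // -[rA g]/(A g) -eqd //.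
  by rewrite [RHS]in_submodE -mulmxA -in_submodE.
- by rewrite /row_full mxrank_in_submod // genmxE.
- move=> g Gg; rewrite -in_submodJ // -[rA g]/(A g) -eqh //.
  by rewrite [RHS]in_submodE -mulmxA -in_submodE.
move=> h' [eqh' h'd]; exists h'; split=> //.
rewrite -(in_submodK shd) -h'd -[in LHS](in_submodK sdd).
by rewrite val_submodE [in RHS]val_submodE mulmxA.
Qed.

(** Homotopies are built one degree at a time, and the type of each component
depends on the degree. *)
Lemma dependent_choice (T : nat -> Type) (good : forall i, T i -> Prop)
    (R : forall i, T i -> T i.+1 -> Prop) (x0 : T 0%N) :
  good 0%N x0 ->
  (forall i x, good i x -> exists y, good i.+1 y /\ R i x y) ->
  exists2 s : forall i, T i,
    s 0%N = x0 & forall i, good i (s i) /\ R i (s i) (s i.+1).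
Proof.
move=> g0 exS.
pose U i := {x : T i | good i x}.
have next i (x : U i) : {y : U i.+1 | R i (sval x) (sval y)}.
  have /constructive_indefinite_description[y [gy Ry]] := exS i _ (svalP x).
  by exists (exist _ y gy).
pose s := nat_rect U (exist _ x0 g0) (fun i x => sval (next i x)).
exists (fun i => sval (s i)) => // i; split; first exact: svalP.
exact: (svalP (next i (s i))).
Qed.

Lemma conform_at (p q : nat -> nat) (t : forall i, 'M[k]_(p i, q i)) i i'
    (B : 'M_(p i', q i')) :
  i = i' -> conform_mx B (t i) = t i'.
Proof. by move=> e; case: _ / e B => B; rewrite conform_mx_id. Qed.

(** Degree u - v.  Two naturals allow negative degrees without integers. *)
Definition homd (p q : nat -> nat) (u v : nat) (f : gmap k p q) :=
  forall a b, (a + u != b + v)%N -> f a b = 0.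

Definition degreewise_projective C := forall i, projective_repr G (cact C i).

(** The comparison theorem in the form that serves all later uses.  The
components of H are found by induction upwards from the lowest one, h0: where f
commutes with d up to the sign s, the difference between f and the part of the
homotopy formula that is already known is a cycle in D, hence a boundary, and
projectivity of C lifts it.  With f = 0 the conclusion says that H itself is a
chain map up to sign, so the same statement constructs chain maps, homotopies
and maps of any degree. *)
Lemma homotopy_extension C D (j m : nat) (s : k) (f : gmap k C D)
    (h0 : 'M[k]_(C j.-1, D m)) :
  s * s = 1 -> is_complex G C -> is_complex G D -> degreewise_projective C ->
  equivariant G f ->
  (forall g, g \in G -> cact C j.-1 g *m h0 = h0 *m cact D m g) ->
  (forall i, cdiff C (i + j)%N.+1 (i + j)%N *m f (i + j)%N (i + m)%N
     = s *: (f (i + j)%N.+1 (i + m)%N.+1 *m cdiff D (i + m)%N.+1 (i + m)%N)) ->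
  (forall i, kermx (cdiff D (i + m)%N.+1 (i + m)%N)
     <= cdiff D (i + m)%N.+2 (i + m)%N.+1)%MS ->
  (f j m - s *: (cdiff C j j.-1 *m h0) <= cdiff D m.+1 m)%MS ->
  exists H : gmap k C D,
    [/\ homd m.+1 j H, equivariant G H, (0 < j)%N -> H j.-1 m = h0
      & forall i, f (i + j)%N (i + m)%N
          = H (i + j)%N (i + m)%N.+1 *m cdiff D (i + m)%N.+1 (i + m)%N
            + s *: (cdiff C (i + j)%N (i + j)%N.-1 *m H (i + j)%N.-1 (i + m)%N)].
Proof.
move=> ss cC cD pC eqf eqh0 chf exD base.
(* Step i is the block from degree i + j - 1 to degree i + m; step 0 is h0,
   and it is a genuine block of H only when j is positive. *)
pose T i := 'M[k]_(C (i + j)%N.-1, D (i + m)%N).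
pose good i (x : T i) :=
  (forall g, g \in G -> cact C (i + j)%N.-1 g *m x = x *m cact D (i + m)%N g)
  /\ (f (i + j)%N (i + m)%N - s *: (cdiff C (i + j)%N (i + j)%N.-1 *m x)
       <= cdiff D (i + m)%N.+1 (i + m)%N)%MS.
pose R i (x : T i) (y : T i.+1) := f (i + j)%N (i + m)%N
  = y *m cdiff D (i + m)%N.+1 (i + m)%N
    + s *: (cdiff C (i + j)%N (i + j)%N.-1 *m x).
have [||t t0 tP] := @dependent_choice T good R h0.
- by [].
- move=> i x [eqx lex].
  have [] := projective_lift (pC (i + j)%N) (complex_repr cD (i + m)%N.+1)
    (complex_repr cD (i + m)%N) _ _ lex.
  + by move=> g Gg; exact: complex_equi cD _ _ _ Gg.
  + move=> g Gg; rewrite mulmxBr mulmxBl eqf //; congr (_ - _).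
    rewrite -scalemxAl -scalemxAr; congr (_ *: _).
    by rewrite mulmxA (complex_equi cC) // -!mulmxA eqx.
  move=> y [eqy yd]; exists y; split; last by rewrite /R yd subrK.
  split=> //; apply: submx_trans (exD i); apply/sub_kermxP.
  rewrite -[LHS]/((f (i + j)%N.+1 (i + m)%N.+1
    - s *: (cdiff C (i + j)%N.+1 (i + j)%N *m y))
    *m cdiff D (i + m)%N.+1 (i + m)%N) mulmxBl -scalemxAl -mulmxA yd.
  rewrite mulmxBr chf -scalemxAr mulmxA (complex_dd cC) mul0mx scaler0 subr0.
  by rewrite scalerA ss scale1r subrr.
pose H : gmap k C D := fun a b =>
  if (a.+1 + m == b + j)%N && (m <= b)%N then conform_mx 0 (t (b - m)%N) else 0.
have HP i : (0 < i + j)%N -> H (i + j)%N.-1 (i + m)%N = t i.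
  move=> ij; rewrite /H prednK // addnAC eqxx leq_addl /=.
  by apply: (@conform_at (fun i => C (i + j)%N.-1) (fun i => D (i + m)%N));
    rewrite addnK.
have H0 a b : (a.+1 + m == b + j)%N && (m <= b)%N = false -> H a b = 0.
  by rewrite /H => ->.
exists H; split.
- by move=> a b; rewrite addnS -addSn => /negPf ne; rewrite H0 // ne.
- move=> g a b Gg; case E: ((a.+1 + m == b + j)%N && (m <= b)%N); last first.
    by rewrite H0 // mulmx0 mul0mx.
  have [/eqP e le_mb] := andP E; have eb := subnK le_mb.
  have ea : a = (b - m + j).-1 by lia.
  by rewrite -eb ea HP ?(tP _).1.1 //; lia.
- by move=> j_gt0; rewrite -t0; exact: (HP 0%N).
move=> i; have [_ ->] := tP i; congr (_ + _).
  by rewrite -(HP i.+1).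
case: (posnP (i + j)%N) => [e|ij]; last by rewrite HP.
by rewrite !(complex_deg cC) ?mul0mx ?e.
Qed.

End Lifting.

(** * Complexes with homology k in a single degree *)
Section Augmented.

Variables (k : fieldType) (gT : finGroupType) (G : {group gT}).
Implicit Types C D P Q : gcomplex k gT.

Definition invariant C i (c : 'cV[k]_(C i)) :=
  forall g, g \in G -> cact C i g *m c = c.

(** Coboundaries among the invariant cochains of a single degree.  A cochain
of one degree is a column vector, which avoids families supported in one
place. *)
Definition exact_cochain C i (c : 'cV[k]_(C i)) :=
  exists2 b : 'cV[k]_(C i.-1), invariant b & c = cdiff C i i.-1 *m b.

(** The form e is a quasi-isomorphism from D to k placed in degree M, the
lowest degree of D.  This covers projective resolutions of k, their shifts and
tensor products of such complexes at once. *)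
Record augmented (M : nat) D (e : gform k D) : Prop := Augmented {
  aug_complex : is_complex G D;
  aug_low : forall i, (i < M)%N -> D i = 0%N;
  aug_conc : concentrated M e;
  aug_inv : cochain G e;
  aug_onto : row_full (e M);
  aug_exact0 : (cdiff D M.+1 M == kermx (e M))%MS;
  aug_exact : forall i, (cdiff D (i + M)%N.+2 (i + M)%N.+1
                         == kermx (cdiff D (i + M)%N.+1 (i + M)%N))%MS
}.

Lemma mx_cols0 (m n : nat) (A B : 'M[k]_(m, n)) : n = 0%N -> A = B.
Proof.
by move=> n0; move: A B; rewrite n0 => A B; rewrite [A]thinmx0 [B]thinmx0.
Qed.

Lemma mx_rows0 (m n : nat) (A B : 'M[k]_(m, n)) : m = 0%N -> A = B.
Proof.
by move=> n0; move: A B; rewrite n0 => A B; rewrite [A]flatmx0 [B]flatmx0.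
Qed.

Lemma aug_closed M D (e : gform k D) : augmented M e ->
  forall i, cdiff D i.+1 i *m e i = 0.
Proof.
move=> aD i; have [->|ne] := eqVneq i M; last by rewrite (aug_conc aD) ?mulmx0.
by apply/sub_kermxP; case/andP: (aug_exact0 aD).
Qed.

Lemma projective_lift_form C D i M (e : gform k D) (c : 'cV[k]_(C i)) :
  projective_repr G (cact C i) -> augmented M e -> invariant c ->
  exists h : 'M_(C i, D M),
    (forall g, g \in G -> cact C i g *m h = h *m cact D M g) /\ h *m e M = c.
Proof.
move=> pC aD ic.
apply: (projective_lift (A := fun _ => 1%:M) pC
  (complex_repr (aug_complex aD) M)).
- by split=> // x y _ _; rewrite mulmx1.
- by move=> g Gg; rewrite (aug_inv aD) // mulmx1.
- by move=> g Gg; rewrite ic // mulmx1.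
- by apply: submx_full; exact: aug_onto aD.
Qed.

(** A map from a projective complex to one with homology k in degree M is
null-homotopic as soon as the class that it induces in the lowest degree
vanishes: a cochain bounding that class, lifted to D, starts the homotopy. *)
Lemma homotopy_of_exact C D (j M : nat) (e : gform k D) (s : k)
    (f : gmap k C D) :
  s * s = 1 -> is_complex G C -> degreewise_projective G C -> augmented M e ->
  equivariant G f ->
  (forall i, cdiff C (i + j)%N.+1 (i + j)%N *m f (i + j)%N (i + M)%N
     = s *: (f (i + j)%N.+1 (i + M)%N.+1 *m cdiff D (i + M)%N.+1 (i + M)%N)) ->
  exact_cochain (f j M *m e M) ->
  exists H : gmap k C D,
    [/\ homd M.+1 j H, equivariant G H
      & forall i, f (i + j)%N (i + M)%N
          = H (i + j)%N (i + M)%N.+1 *m cdiff D (i + M)%N.+1 (i + M)%N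
            + s *: (cdiff C (i + j)%N (i + j)%N.-1
                    *m H (i + j)%N.-1 (i + M)%N)].
Proof.
move=> ss cC pC aD eqf chf [b ib fb].
have [h [eqh he]] := projective_lift_form (pC j.-1) aD ib.
have [|||H [H1 H2 _ H3]] := homotopy_extension (h0 := s *: h) ss cC
  (aug_complex aD) pC eqf _ chf.
- by move=> g Gg; rewrite -scalemxAl -scalemxAr eqh.
- by move=> i; case/andP: (aug_exact aD i).
- apply: submx_trans (proj2 (andP (aug_exact0 aD))); apply/sub_kermxP.
  rewrite mulmxBl fb -scalemxAr scalerA ss scale1r -mulmxA he subrr //.
by exists H.
Qed.

(** Maps that satisfy the hypothesis of [homotopy_of_exact] induce zero on all
cohomology classes. *)
Lemma exact_pullback C D (j M : nat) (e : gform k D) (s : k) (f : gmap k C D)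
    (i : nat) (c : 'cV[k]_(D (i + M)%N)) :
  s * s = 1 -> is_complex G C -> degreewise_projective G C -> augmented M e ->
  equivariant G f ->
  (forall i, cdiff C (i + j)%N.+1 (i + j)%N *m f (i + j)%N (i + M)%N
     = s *: (f (i + j)%N.+1 (i + M)%N.+1 *m cdiff D (i + M)%N.+1 (i + M)%N)) ->
  exact_cochain (f j M *m e M) ->
  invariant c -> cdiff D (i + M)%N.+1 (i + M)%N *m c = 0 ->
  exact_cochain (f (i + j)%N (i + M)%N *m c).
Proof.
move=> ss cC pC aD eqf chf fe ic dc.
have [H [_ eqH HE]] := homotopy_of_exact ss cC pC aD eqf chf fe.
exists (s *: (H (i + j)%N.-1 (i + M)%N *m c)).
  by move=> g Gg; rewrite -scalemxAr mulmxA eqH // -mulmxA ic.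
by rewrite HE mulmxDl -mulmxA dc mulmx0 add0r -scalemxAl -scalemxAr mulmxA.
Qed.

(** A map of degree 1 out of degree 0 lands where D is exact, so here there is
no class in the lowest degree to obstruct the homotopy. *)
Lemma exact_pullback1 C D (e : gform k D) (s : k) (f : gmap k C D) (i : nat)
    (c : 'cV[k]_(D i.+1)) :
  s * s = 1 -> is_complex G C -> degreewise_projective G C -> augmented 0 e ->
  equivariant G f ->
  (forall i, cdiff C i.+1 i *m f i i.+1
     = s *: (f i.+1 i.+2 *m cdiff D i.+2 i.+1)) ->
  f 0%N 1%N *m cdiff D 1%N 0%N = 0 ->
  invariant c -> cdiff D i.+2 i.+1 *m c = 0 ->
  exact_cochain (f i i.+1 *m c).
Proof.
move=> ss cC pC aD eqf chf f0 ic dc.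
have [|||| H [_ eqH _ HE]] := homotopy_extension (j := 0) (m := 1) (h0 := 0)
  ss cC (aug_complex aD) pC eqf.
- by move=> g _; rewrite mulmx0 mul0mx.
- by move=> i'; rewrite addn0 addn1.
- move=> i'; rewrite addn1.
  by have /andP[_] := aug_exact aD i'.+1; rewrite addn0.
- rewrite mulmx0 scaler0 subr0.
  have /andP[_] := aug_exact aD 0%N; apply: submx_trans; exact/sub_kermxP.
have {}HE := HE i; rewrite addn0 addn1 in HE.
exists (s *: (H i.-1 i.+1 *m c)).
  by move=> g Gg; rewrite -scalemxAr mulmxA eqH // -mulmxA ic.
by rewrite HE mulmxDl -mulmxA dc mulmx0 add0r -scalemxAl -scalemxAr mulmxA.
Qed.

(** Applied to differences of chain maps that agree on homology. *)
Lemma null_homotopy C D (M : nat) (e : gform k D) (f : gmap k C D) :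
  is_complex G C -> degreewise_projective G C -> augmented M e ->
  chain_map G f -> f M M *m e M = 0 ->
  exists H : gmap k C D,
    [/\ homd 1 0 H, equivariant G H
      & forall i, f i i = H i i.+1 *m cdiff D i.+1 i
                          + cdiff C i i.-1 *m H i.-1 i].
Proof.
move=> cC pC aD [_ eqf chf] f0.
have [|i|| H [H1 H2 H3]] := @homotopy_of_exact C D M M e 1 f _ cC pC aD eqf.
- by rewrite mulr1.
- by rewrite scale1r chf.
- by exists 0; rewrite ?f0 ?mulmx0 // => g _; rewrite mulmx0.
exists H; split=> // [a b ne|i].
  by apply: H1; rewrite addnS -addSn eqn_add2r -(addn0 b) -addn1.
have [le_Mi|lt_iM] := leqP M i; last by apply: mx_cols0; exact: aug_low aD _ _.
by have := H3 (i - M)%N; rewrite subnK // scale1r.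
Qed.

(** Classes on C come from chain maps to complexes with homology k.  This is
[homotopy_extension] for the zero map one degree higher, where the homotopy
formula reads as commutation with d. *)
Lemma lift_cocycle C D (j M : nat) (e : gform k D) (s : k) (c : 'cV[k]_(C j)) :
  s * s = 1 -> is_complex G C -> degreewise_projective G C -> augmented M e ->
  invariant c -> cdiff C j.+1 j *m c = 0 ->
  exists f : gmap k C D,
    [/\ homd M j f, equivariant G f, f j M *m e M = c
      & forall i, cdiff C (i + j)%N.+1 (i + j)%N *m f (i + j)%N (i + M)%N
     = s *: (f (i + j)%N.+1 (i + M)%N.+1 *m cdiff D (i + M)%N.+1 (i + M)%N)].
Proof.
move=> ss cC pC aD ic dc.
have [h [eqh he]] := projective_lift_form (pC j) aD ic.
have eq0 : equivariant G ((fun a b => 0) : gmap k C D).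
  by move=> g a b _; rewrite mulmx0 mul0mx.
have [|||| H [H1 H2 H3 H4]] := homotopy_extension (j := j.+1) (h0 := h)
  (s := - s) _ cC (aug_complex aD) pC eq0 eqh.
- by rewrite mulrNN.
- by move=> i; rewrite mulmx0 mul0mx scaler0.
- by move=> i; case/andP: (aug_exact aD i).
- apply: submx_trans (proj2 (andP (aug_exact0 aD))); apply/sub_kermxP.
  rewrite sub0r scaleNr opprK -scalemxAl -mulmxA he.
  by rewrite -[j.+1.-1]/j dc scaler0.
exists H; split=> //.
- by move=> a b ne; apply: H1; rewrite !addnS eqSS.
- by rewrite H3.
move=> i; have /eqP := H4 i; rewrite addnS /= scaleNr eq_sym subr_eq0 => /eqP->.
by rewrite scalerA ss scale1r.
Qed.

Lemma augmented_resolution P (eps : gform k P) :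
  resolution G eps -> augmented 0 eps.
Proof.
case=> cP _ c0 ce on ex0 ex; split=> // i; by rewrite addn0.
Qed.

Lemma susp_complex C : is_complex G C -> is_complex G (susp C).
Proof.
case=> rC degC eqC dd; split.
- case=> [|i] //=; split=> [|x y _ _]; exact: mx_rows0.
- by case=> [|i] [|j] //= ij; rewrite degC ?oppr0.
- move=> g [|i] [|j] Gg; rewrite ?mulmx0 ?mul0mx //.
  by rewrite /= mulmxN mulNmx eqC.
- by case=> [|i] [|j] [|l]; rewrite /= ?mulmx0 ?mul0mx //
    mulmxN mulNmx dd ?oppr0.
Qed.

Lemma susp_projective C :
  degreewise_projective G C -> degreewise_projective G (susp C).
Proof.
move=> pC [|i] //= a b ra rb f h _ _ _ _ _.
by exists 0; split=> [g _|]; exact: mx_rows0.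
Qed.

Lemma eqmx_oppl (m1 m2 n : nat) (A : 'M[k]_(m1, n)) (B : 'M[k]_(m2, n)) :
  (- A == B)%MS = (A == B)%MS.
Proof. by rewrite !(eqmx_opp A). Qed.

Lemma susp_augmented C M (e : gform k C) :
  augmented M e -> augmented M.+1 (susp_form e : gform k (susp C)).
Proof.
case=> cC low conc inv onto ex0 ex; split=> //.
- exact: susp_complex.
- by case=> [|i] //= /low.
- by case=> [|i] //= ne; exact: conc.
- by move=> g [|i] Gg //=; [rewrite mulmx0|rewrite inv].
- by rewrite eqmx_oppl.
- move=> i; rewrite addnS /= eqmx_oppl.
  have /andP[a b] := ex i; apply/andP; split.
    by apply/sub_kermxP; rewrite mulmxN; apply/eqP; rewrite oppr_eq0;
       apply/eqP; exact/sub_kermxP.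
  apply: submx_trans b; apply/sub_kermxP/eqP; rewrite -oppr_eq0 -mulmxN.
  exact/eqP/mulmx_ker.
Qed.

Lemma shift_augmented C M m (e : gform k C) :
  augmented M e -> degreewise_projective G C ->
  augmented (m + M) (shift_form m e) /\ degreewise_projective G (shift m C).
Proof.
move=> aC pC; elim: m => [|m [IH1 IH2]] //=.
by split; [exact: susp_augmented|exact: susp_projective].
Qed.

Lemma ext_projective P Q (a : gmap k P Q) :
  degreewise_projective G P -> degreewise_projective G Q ->
  degreewise_projective G (ext a).
Proof.
move=> pP pQ i r s ra rb f h rra rrb eqf onf eqh.
rewrite -[h]vsubmxK in eqh *.
have eqh2 g : g \in G -> cact Q i g *m usubmx h = usubmx h *m rb g
    /\ cact P i g *m dsubmx h = dsubmx h *m rb g.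
  move=> /eqh /=; rewrite mul_block_col !mul0mx add0r addr0 mul_col_mx.
  by move/eq_col_mx.
have [h1 [eq1 <-]] := pQ i _ _ _ _ f _ rra rrb eqf onf
  (fun g Gg => (eqh2 g Gg).1).
have [h2 [eq2 <-]] := pP i _ _ _ _ f _ rra rrb eqf onf
  (fun g Gg => (eqh2 g Gg).2).
exists (col_mx h1 h2); rewrite !mul_col_mx; split=> // g Gg.
by rewrite /= mul_block_col !mul0mx add0r addr0 mul_col_mx eq1 ?eq2.
Qed.

Lemma ext_complex P Q (a : gmap k P Q) :
  is_complex G P -> is_complex G Q -> homd 0 1 a -> equivariant G a ->
  (forall i j l, cdiff P i j *m a j l + a i j *m cdiff Q j l = 0) ->
  is_complex G (ext a).
Proof.
move=> cP cQ dega eqa ada; split.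
- move=> i; have [rP1 rPM] := complex_repr cP i.
  have [rQ1 rQM] := complex_repr cQ i.
  split=> [|x y Gx Gy] /=; first by rewrite rP1 rQ1 -scalar_mx_block.
  by rewrite rPM // rQM // mulmx_block !mulmx0 !mul0mx !addr0 !add0r.
- move=> i j ij /=; rewrite (complex_deg cP) // (complex_deg cQ) //.
  by rewrite dega ?block_mx0 // addn0 addn1.
- move=> g i j Gg /=; rewrite !mulmx_block !mulmx0 !mul0mx !addr0 !add0r.
  by rewrite (complex_equi cP) // (complex_equi cQ) // eqa.
- move=> i j l /=; rewrite !mulmx_block !mulmx0 !mul0mx !addr0 !add0r.
  by rewrite (complex_dd cP) (complex_dd cQ) addrC ada block_mx0.
Qed.

End Augmented.

(** * The Koszul sign rule *)
Section GradedTensor.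

Variable k : fieldType.
Implicit Types p q r : nat -> nat.

(** The composite of f of degree u - v with g: block (a, c) passes through
degree a + u - v, and is 0 when that degree would be negative. *)
Definition dcomp p q r (u v : nat) (f : gmap k p q) (g : gmap k q r) :
    gmap k p r :=
  fun a c => if (v <= a + u)%N then f a (a + u - v)%N *m g (a + u - v)%N c
             else 0.

(** The pullback of a form along a map of degree u - v. *)
Definition dpull p q (u v : nat) (f : gmap k p q) (c : gform k q) : gform k p :=
  fun a => if (v <= a + u)%N then f a (a + u - v)%N *m c (a + u - v)%N else 0.

Lemma tensmxDl (m n p q : nat) (A A' : 'M[k]_(m, n)) (B : 'M_(p, q)) :
  (A + A') *t B = A *t B + A' *t B.
Proof. by apply/matrixP=> i j; rewrite !mxE mulrDl. Qed.

Lemma tensmxDr (m n p q : nat) (A : 'M[k]_(m, n)) (B B' : 'M_(p, q)) :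
  A *t (B + B') = A *t B + A *t B'.
Proof. by apply/matrixP=> i j; rewrite !mxE mulrDr. Qed.

Lemma tensmxZl (m n p q : nat) x (A : 'M[k]_(m, n)) (B : 'M_(p, q)) :
  (x *: A) *t B = x *: (A *t B).
Proof. by apply/matrixP=> i j; rewrite !mxE mulrA. Qed.

Lemma tensmxZr (m n p q : nat) x (A : 'M[k]_(m, n)) (B : 'M_(p, q)) :
  A *t (x *: B) = x *: (A *t B).
Proof. by apply/matrixP=> i j; rewrite !mxE mulrCA. Qed.

Lemma tensmx_mulcv (m n p q : nat) (A : 'M[k]_(m, n)) (B : 'M_(p, q))
    (c : 'cV_n) (d : 'cV_q) :
  (A *t B) *m (c *t d : 'cV_(n * q)) = ((A *m c) *t (B *m d) : 'cV_(m * p)).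
Proof. exact: (tensmx_mul A B c d). Qed.

Lemma tensmx11 m n : (1%:M : 'M[k]_m) *t (1%:M : 'M[k]_n) = 1%:M.
Proof.
apply/matrixP=> i j; case: (mxtens_indexP i) => a b.
case: (mxtens_indexP j) => c d; rewrite tensmxE !mxE -natrM mulnb.
by rewrite (can_eq (@mxtens_indexK _ _)) xpair_eqE.
Qed.

Lemma mxblockZ m n (p_ : 'I_m -> nat) (q_ : 'I_n -> nat) x
    (B : forall i j, 'M[k]_(p_ i, q_ j)) :
  \mxblock_(i, j) (x *: B i j) = x *: \mxblock_(i, j) B i j.
Proof. by apply/matrixP=> s t; rewrite !mxE. Qed.

Lemma mxcolZ m n (p_ : 'I_m -> nat) x (B : forall i, 'M[k]_(p_ i, n)) :
  \mxcol_i (x *: B i) = x *: \mxcol_i B i.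
Proof. by apply/matrixP=> s t; rewrite !mxE. Qed.

Lemma mul_mxdiag n (p_ : 'I_n -> nat) (A B : forall i, 'M[k]_(p_ i)) :
  \mxdiag_i A i *m \mxdiag_i B i = \mxdiag_i (A i *m B i).
Proof.
rewrite {2 3}/mxdiag mul_mxdiag_mxblock; apply: eq_mxblock => i j.
case: eqP => [e|_]; last by rewrite mulmx0.
by case: j / e; rewrite !conform_mx_id.
Qed.

Section Bilinear.

Variables (p q p' q' : nat -> nat).
Implicit Types (f : gmap k p p') (g : gmap k q q').

Lemma eq_gtens f f' g g' n m :
  (forall a b, f a b = f' a b) -> (forall a b, g a b = g' a b) ->
  gtens f g n m = gtens f' g' n m.
Proof. by move=> ef eg; apply: eq_mxblock => a b; rewrite ef eg. Qed.

Lemma gtensDl f f' g n m :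
  gtens (fun a b => f a b + f' a b) g n m = gtens f g n m + gtens f' g n m.
Proof.
rewrite /gtens -mxblockD; apply: eq_mxblock => a b.
by rewrite tensmxDl scalerDr.
Qed.

Lemma gtensDr f g g' n m :
  gtens f (fun a b => g a b + g' a b) n m = gtens f g n m + gtens f g' n m.
Proof.
rewrite /gtens -mxblockD; apply: eq_mxblock => a b.
by rewrite tensmxDr scalerDr.
Qed.

Lemma gtensZl x f g n m :
  gtens (fun a b => x *: f a b) g n m = x *: gtens f g n m.
Proof.
rewrite /gtens -mxblockZ; apply: eq_mxblock => a b.
by rewrite tensmxZl !scalerA mulrC.
Qed.

Lemma gtensZr x f g n m :
  gtens f (fun a b => x *: g a b) n m = x *: gtens f g n m.
Proof.
rewrite /gtens -mxblockZ; apply: eq_mxblock => a b.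
by rewrite tensmxZr !scalerA mulrC.
Qed.

Lemma gtens0l g n m : gtens (fun a b => 0 : 'M_(p a, p' b)) g n m = 0.
Proof.
have := gtensZl 0 (fun a b => 0) g n m; rewrite scale0r => <-.
by apply: eq_gtens => // a b; rewrite scale0r.
Qed.

Lemma gtens0r f n m : gtens f (fun a b => 0 : 'M_(q a, q' b)) n m = 0.
Proof.
have := gtensZr 0 f (fun a b => 0) n m; rewrite scale0r => <-.
by apply: eq_gtens => // a b; rewrite scale0r.
Qed.

Lemma gtens_homd u v u' v' f g :
  homd u v f -> homd u' v' g -> homd (u + u') (v + v') (gtens f g).
Proof.
move=> hf hg n m ne; transitivity (\mxblock_(a < n.+1, b < m.+1)
  (0 : 'M[k]_(p a * q (n - a)%N, p' b * q' (m - b)%N))); last exact: mxblock0.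
apply: eq_mxblock => a b; have la := ltn_ord a; have lb := ltn_ord b.
have [e|e] := eqVneq (a + u)%N (b + v)%N; last by rewrite hf // tens0mx scaler0.
rewrite hg ?tensmx0 ?scaler0 //; apply: contra ne => /eqP; lia.
Qed.

End Bilinear.

Lemma odd_sign (a b : nat) : odd a = odd b -> (-1) ^+ a = (-1) ^+ b :> k.
Proof. by move=> e; rewrite -signr_odd e signr_odd. Qed.

(** The parity behind (f × g)(f' × g') = (-1)^(deg g * deg f') ff' × gg', for
blocks with left degrees a, b and right degrees x, y, z, where signs in the
definition of the tensor product depend on the degrees of the blocks. *)
Lemma odd_koszul a b u v w w' x y z :
  (a + u = b + v)%N -> (y + w = z + w')%N ->
  odd (a * (x + y) + b * (y + z)) = odd ((u + v) * (w + w') + a * (x + z)).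
Proof.
move/(congr1 odd)=> e1 /(congr1 odd) e2; move: e1 e2; rewrite !(oddD, oddM).
case: (odd a); case: (odd b); case: (odd u); case: (odd v) => //= _;
by case: (odd x); case: (odd y); case: (odd z); case: (odd w); case: (odd w').
Qed.

(** In left-to-right order the sign that appears is the product of the degree
of f and the degree of g'. *)
Lemma gtens_mul p q r p' q' r' u v u' v' w w'
    (f : gmap k p q) (f' : gmap k q r) (g : gmap k p' q') (g' : gmap k q' r')
    n m l :
  homd u v f -> homd u' v' g -> homd w w' g' ->
  (n + (u + u') = m + (v + v'))%N ->
  gtens f g n m *m gtens f' g' m l
    = (-1) ^+ ((u + v) * (w + w'))
      *: gtens (dcomp u v f f') (dcomp u' v' g g') n l.
Proof.
move=> hf hg hg' nm; rewrite /gtens mul_mxblock -mxblockZ.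
apply: eq_mxblock => a c; have la := ltn_ord a; have lc := ltn_ord c.
rewrite /dcomp; case: leqP => [ua|ua]; last first.
  rewrite tens0mx !scaler0 big1 // => b _.
  by rewrite hf ?tens0mx ?scaler0 ?mul0mx //; lia.
case: leqP => [ub|ub]; last first.
  rewrite tensmx0 !scaler0 big1 // => b _; have lb := ltn_ord b.
  by rewrite hg ?tensmx0 ?scaler0 ?mul0mx //; lia.
have lb : (a + u - v < m.+1)%N by lia.
rewrite (bigD1 (Ordinal lb)) //= big1 => [|b /eqP nb]; last first.
  rewrite hf ?tens0mx ?scaler0 ?mul0mx //; apply/eqP=> e; case: nb.
  by apply: val_inj => /=; lia.
have -> : (n - a + u' - v' = m - (a + u - v))%N by lia.
rewrite addr0 -scalemxAl -scalemxAr tensmx_mul !scalerA -!exprD.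
set b := (a + u - v)%N.
have [e|e] := eqVneq (m - b + w)%N (l - c + w')%N; last first.
  by rewrite hg' // mulmx0 tensmx0 !scaler0.
congr (_ *: _); apply: odd_sign.
have eb : (a + u)%N = (b + v)%N by rewrite /b; lia.
exact: odd_koszul.
Qed.

Lemma gtens_mul_ftens p q p' q' (u v u' v' w : nat)
    (f : gmap k p q) (g : gmap k p' q') (b : gform k q) (c : gform k q') n m :
  homd u v f -> homd u' v' g -> (forall i, i != w -> c i = 0) ->
  (n + (u + u') = m + (v + v'))%N ->
  gtens f g n m *m ftens b c m
    = (-1) ^+ ((u + v) * w) *: ftens (dpull u v f b) (dpull u' v' g c) n.
Proof.
move=> hf hg hc nm; rewrite /gtens /ftens mul_mxblock_mxrow -mxcolZ.
apply: eq_mxcol => a; have la := ltn_ord a.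
rewrite /dpull; case: leqP => [ua|ua]; last first.
  rewrite tens0mx !scaler0 big1 // => b' _.
  by rewrite hf ?tens0mx ?scaler0 ?mul0mx //; lia.
case: leqP => [ub|ub]; last first.
  rewrite tensmx0 !scaler0 big1 // => b' _; have lb := ltn_ord b'.
  by rewrite hg ?tensmx0 ?scaler0 ?mul0mx //; lia.
have lb : (a + u - v < m.+1)%N by lia.
rewrite (bigD1 (Ordinal lb)) //= big1 => [|b' /eqP nb]; last first.
  rewrite hf ?tens0mx ?scaler0 ?mul0mx //; apply/eqP=> e; case: nb.
  by apply: val_inj => /=; lia.
have -> : (n - a + u' - v' = m - (a + u - v))%N by lia.
rewrite addr0 -scalemxAl -scalemxAr tensmx_mulcv !scalerA -!exprD.
set b' := (a + u - v)%N.
have [e|e] := eqVneq (m - b')%N w; last first.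
  by rewrite hc // mulmx0 tensmx0 !scaler0.
congr (_ *: _); apply: odd_sign.
have eb : (a + u)%N = (b' + v)%N by rewrite /b'; lia.
rewrite -e; have := @odd_koszul a b' u v 0 (m - b') (n - a) (m - b') 0 eb.
by rewrite !addn0 add0n; apply.
Qed.

End GradedTensor.

Arguments gtens_mul {k p q r p' q' r' u v u' v' w w' f f' g g' n m l}.
Arguments gtens_mul_ftens {k p q p' q' u v u' v' w f g b c n m}.

Definition simpdeg :=
  (addn0, add0n, muln0, mul0n, muln1, mul1n, expr0, expr1, @scale1r).

(** * Composition of maps of small degree *)
Section DegreeComposition.

Variable k : fieldType.
Implicit Types p q r : nat -> nat.

Lemma gid1 p i : gid p i i = 1%:M :> 'M[k]_(p i).
Proof. by rewrite /gid eqxx pid_mx_1. Qed.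

Lemma gid_homd p : homd 0 0 (gid p : gmap k p p).
Proof. by move=> a b; rewrite !addn0 /gid => /negPf->. Qed.

Lemma dcomp_idl p q (g : gmap k p q) a c : dcomp 0 0 (gid p) g a c = g a c.
Proof. by rewrite /dcomp addn0 subn0 gid1 mul1mx. Qed.

Lemma dcomp_idr p q u v (f : gmap k p q) a c :
  homd u v f -> dcomp u v f (gid q) a c = f a c.
Proof.
move=> hf; rewrite /dcomp; case: leqP => [le|lt]; last by rewrite hf //; lia.
have [e|ne] := eqVneq (a + u)%N (c + v)%N.
  have -> : (a + u - v)%N = c by lia.
  by rewrite gid1 mulmx1.
by rewrite (@gid_homd q (a + u - v)%N c) ?mulmx0 ?hf //; lia.
Qed.

Lemma dcomp_homd p q r u v u' v' (f : gmap k p q) (g : gmap k q r) :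
  homd u' v' g -> homd (u + u') (v + v') (dcomp u v f g).
Proof.
by move=> hg a c ne; rewrite /dcomp; case: leqP => // le;
  rewrite hg ?mulmx0 //; lia.
Qed.

Lemma dcomp00 p q r (f : gmap k p q) (g : gmap k q r) a c :
  dcomp 0 0 f g a c = f a a *m g a c.
Proof. by rewrite /dcomp addn0 subn0. Qed.

Lemma dcomp10 p q r (f : gmap k p q) (g : gmap k q r) a c :
  dcomp 1 0 f g a c = f a a.+1 *m g a.+1 c.
Proof. by rewrite /dcomp subn0 addn1. Qed.

Lemma dcomp01 p q r (f : gmap k p q) (g : gmap k q r) a c :
  dcomp 0 1 f g a c = if (0 < a)%N then f a a.-1 *m g a.-1 c else 0.
Proof. by rewrite /dcomp addn0 subn1. Qed.

Lemma dpull00 p q (f : gmap k p q) (c : gform k q) a :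
  dpull 0 0 f c a = f a a *m c a.
Proof. by rewrite /dpull addn0 subn0. Qed.

Lemma dpull01 p q (f : gmap k p q) (c : gform k q) a :
  dpull 0 1 f c a = if (0 < a)%N then f a a.-1 *m c a.-1 else 0.
Proof. by rewrite /dpull addn0 subn1. Qed.

End DegreeComposition.

(** * Tensor products of complexes *)
Section TensorComplex.

Variables (k : fieldType) (gT : finGroupType) (G : {group gT}).
Implicit Types C D : gcomplex k gT.

(** Commutation with d up to the sign (-1)^degree, stated with composites that
are total in the degrees, so that it can be used inside [gtens]. *)
Definition gchain C D u v (f : gmap k C D) := forall a c,
  dcomp 0 1 (cdiff C) f a c = (-1) ^+ (u + v) *: dcomp u v f (cdiff D) a c.

Lemma diff_homd C : is_complex G C -> homd 0 1 (cdiff C).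
Proof. by move=> cC a b; rewrite addn0 addn1; exact: complex_deg cC _ _. Qed.

Lemma dcomp01_diff C D (f : gmap k C D) a c : is_complex G C ->
  dcomp 0 1 (cdiff C) f a c = cdiff C a a.-1 *m f a.-1 c.
Proof.
move=> cC; rewrite dcomp01; case: a => //=.
by rewrite (complex_deg cC) ?mul0mx.
Qed.

Lemma gid_gchain C : is_complex G C -> gchain 0 0 (gid C).
Proof.
move=> cC a c; rewrite dcomp_idl dcomp_idr ?expr0 ?scale1r //; exact: diff_homd.
Qed.

Lemma gtens_equi C D C' D' (f : gmap k C C') (g : gmap k D D') :
  equivariant G f -> equivariant G g ->
  equivariant G (gtens f g : gmap k (tens C D) (tens C' D')).
Proof.
move=> eqf eqg x n m Gx /=.
rewrite /gtens mul_mxdiag_mxblock mul_mxblock_mxdiag; apply: eq_mxblock => a b.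
by rewrite -scalemxAl -scalemxAr !tensmx_mul eqf ?eqg.
Qed.

Lemma gid_equi C : is_complex G C -> equivariant G (gid C).
Proof.
move=> cC g i j Gg; rewrite /gid; case: eqP => [<-|_].
  by rewrite pid_mx_1 mulmx1 mul1mx.
by rewrite mulmx0 mul0mx.
Qed.

Lemma diff_equi C : is_complex G C -> equivariant G (cdiff C).
Proof. by move=> cC g i j Gg; exact: complex_equi cC _ _ _ Gg. Qed.

Lemma tens_diff_homd C D : is_complex G C -> is_complex G D ->
  homd 0 1 (cdiff (tens C D)).
Proof.
move=> cC cD a b ne /=.
have h1 := gtens_homd (diff_homd cC) (@gid_homd k D).
have h2 := gtens_homd (@gid_homd k C) (diff_homd cD).
by rewrite h1 // h2 // addr0.
Qed.

(** The differential is gtens d 1 + gtens 1 d, and the Koszul rule moves f × g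
past each summand; with the sign (-1)^degree for each factor the two agree. *)
Lemma diff_gtens C D C' D' u v u' v' (f : gmap k C C') (g : gmap k D D') n m :
  is_complex G C -> is_complex G D -> is_complex G C' -> is_complex G D' ->
  homd u v f -> homd u' v' g -> gchain u v f -> gchain u' v' g ->
  (n + (u + u') = m + (v + v'))%N ->
  cdiff (tens C D) n.+1 n *m gtens f g n m
    = (-1) ^+ (u + v + (u' + v'))
      *: (gtens f g n.+1 m.+1 *m cdiff (tens C' D') m.+1 m).
Proof.
move=> cC cD cC' cD' hf hg chf chg nm /=.
rewrite mulmxDl mulmxDr.
rewrite (gtens_mul (diff_homd cC) (@gid_homd k D) hg); last by lia.
rewrite (gtens_mul (@gid_homd k C) (diff_homd cD) hg); last by lia.
rewrite (gtens_mul hf hg (@gid_homd k D')); last by lia.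
rewrite (gtens_mul hf hg (diff_homd cD')); last by lia.
rewrite (eq_gtens _ _ chf (dcomp_idl g)) (eq_gtens _ _ (dcomp_idl f) chg).
rewrite gtensZl gtensZr.
have idr1 a b := dcomp_idr a b hf; have idr2 a b := dcomp_idr a b hg.
rewrite [X in _ = _ *: (_ *: X + _)](eq_gtens _ _ (fun a b => erefl _) idr2).
rewrite [X in _ = _ *: (_ + _ *: X)](eq_gtens _ _ idr1 (fun a b => erefl _)).
rewrite scalerDr !scalerA -!exprD; congr (_ *: _ + _ *: _); apply: odd_sign.
  rewrite !(oddD, oddM) /=.
  by case: (odd u); case: (odd v); case: (odd u'); case: (odd v').
rewrite !(oddD, oddM) /=.
by case: (odd u); case: (odd v); case: (odd u'); case: (odd v').
Qed.

Lemma tens_complex C D : is_complex G C -> is_complex G D ->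
  is_complex G (tens C D).
Proof.
move=> cC cD; have degT := tens_diff_homd cC cD.
split.
- move=> n; split=> [|x y Gx Gy] /=.
    transitivity (\mxdiag_(i < n.+1) (1%:M : 'M[k]_(C i * D (n - i)%N))).
      apply: eq_mxdiag => a.
      by rewrite (complex_repr cC a).1 (complex_repr cD _).1 tensmx11.
    exact: mxdiagZ.
  rewrite mul_mxdiag; apply: eq_mxdiag => a.
  by rewrite (complex_repr cC a).2 // (complex_repr cD _).2 // tensmx_mul.
- by move=> i j ne; apply: degT; rewrite addn0 addn1.
- move=> g i j Gg; rewrite mulmxDr mulmxDl; congr (_ + _).
    by apply: (gtens_equi (D := D)) => //; [exact: diff_equi|exact: gid_equi].
  by apply: (gtens_equi (C := C)) => //; [exact: gid_equi|exact: diff_equi].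
move=> i j l.
have [ij|/degT->] := eqVneq (i + 0)%N (j + 1)%N; last by rewrite mul0mx.
have [jl|/degT->] := eqVneq (j + 0)%N (l + 1)%N; last by rewrite mulmx0.
rewrite /= mulmxDl !mulmxDr.
have dC := diff_homd cC; have dD := diff_homd cD.
have iC := @gid_homd k C; have iD := @gid_homd k D.
rewrite (gtens_mul dC iD iD); last by lia.
rewrite (gtens_mul dC iD dD); last by lia.
rewrite (gtens_mul iC dD iD); last by lia.
rewrite (gtens_mul iC dD dD); last by lia.
have z1 a b : dcomp 0 1 (cdiff C) (cdiff C) a b = 0.
  by rewrite (dcomp01_diff _ _ _ cC) (complex_dd cC).
have z2 a b : dcomp 0 1 (cdiff D) (cdiff D) a b = 0.
  by rewrite (dcomp01_diff _ _ _ cD) (complex_dd cD).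
rewrite (eq_gtens _ _ z1 (dcomp_idl _)) (eq_gtens _ _ (dcomp_idl _) z2).
rewrite (eq_gtens _ _ (fun a b => dcomp_idr a b dC) (dcomp_idl _)).
rewrite (eq_gtens _ _ (dcomp_idl _) (fun a b => dcomp_idr a b dD)).
rewrite gtens0l gtens0r expr0 !scaler0 addr0 add0r.
by rewrite expr1 scale1r scaleN1r addNr.
Qed.

End TensorComplex.

(** * Exactness of tensor products *)
Section Contraction.

Variables (k : fieldType) (gT : finGroupType) (G : {group gT}).
Implicit Types C D : gcomplex k gT.

Lemma trivial_complex C : is_complex G C -> is_complex 1%G C.
Proof.
case=> rC degC eqC ddC; split=> // [i|g i j /set1gP->].
  have [r1 rM] := rC i; split=> // x y Gx Gy.
  by apply: rM; apply: (subsetP (sub1G G)).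
by rewrite eqC.
Qed.

Lemma trivial_augmented M C (e : gform k C) :
  augmented G M e -> augmented 1%G M e.
Proof.
case=> cC low conc inv onto ex0 ex; split=> //; first exact: trivial_complex.
by move=> g i /set1gP->; rewrite inv.
Qed.

(** Over the trivial group every module is projective, since a surjection of
vector spaces has a section. *)
Lemma trivial_projective C : is_complex G C -> degreewise_projective 1%G C.
Proof.
move=> cC i a b ra rb f h [ra1 _] [rb1 _] _ fullf _; exists (h *m pinvmx f).
split; last by rewrite mulmxKpV // submx_full.
by move=> g /set1gP->; rewrite ra1 mulmx1 (complex_repr cC i).1 mul1mx.
Qed.

(** After restriction to the trivial group the complex is projective, so the
identity is homotopic to any chain map with the same effect on homology, in
particular to the projection onto k through a section eta of e. *)
Lemma contraction M D (e : gform k D) : augmented G M e ->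
  exists (h : gmap k D D) (eta : forall c, 'rV[k]_(D c)),
    [/\ homd 1 0 h, forall c, c != M -> eta c = 0, eta M *m e M = 1%:M,
        forall a c, eta a *m cdiff D a c = 0
      & forall a c, gid D a c = dcomp 1 0 h (cdiff D) a c
                      + dcomp 0 1 (cdiff D) h a c + e a *m eta c].
Proof.
move=> aD; have cD := aug_complex aD.
have /row_fullP[eta0 eta0e] := aug_onto aD.
pose eta c : 'rV[k]_(D c) := if c == M then conform_mx 0 eta0 else 0.
have etaM : eta M = eta0 by rewrite /eta eqxx conform_mx_id.
have etaN c : c != M -> eta c = 0 by rewrite /eta => /negPf->.
have ehom : homd 0 0 (fun a c => e a *m eta c).
  move=> a c; rewrite !addn0; case: (eqVneq c M) => [->|/etaN->] ne.
    by rewrite (aug_conc aD) ?mul0mx.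
  by rewrite mulmx0.
have dh : homd 0 1 (cdiff D) := diff_homd cD.
have e_eta c : e c *m eta c *m e c = e c.
  have [->|ne] := eqVneq c M; first by rewrite etaM -mulmxA eta0e mulmx1.
  by rewrite (aug_conc aD) // mulmx0.
have etad c b : eta c *m cdiff D c b = 0.
  have [->|/etaN->] := eqVneq c M; last by rewrite mul0mx.
  have [eb|ne] := eqVneq M b.+1; last by rewrite dh ?mulmx0 // addn0 addn1.
  by apply: mx_cols0; apply: (aug_low aD); rewrite eb.
pose f : gmap k D D := fun a c => gid D a c - e a *m eta c.
have fhom : homd 0 0 f by move=> a c ne; rewrite /f ehom // gid_homd ?subr0.
have [|| h [hh _ hE]] := null_homotopy (f := f) (trivial_complex cD)
  (trivial_projective cD) (trivial_augmented aD).
- split=> [i j ne|g i j /set1gP->|i].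
  + by apply: fhom; rewrite !addn0 eq_sym.
  + by rewrite !(complex_repr cD _).1 mulmx1 mul1mx.
  rewrite /f !gid1 mulmxBr mulmxBl mulmx1 mul1mx mulmxA (aug_closed aD).
  by rewrite -mulmxA etad mul0mx mulmx0.
- by rewrite /f gid1 mulmxBl mul1mx e_eta subrr.
exists h, eta; split=> // [|a c]; first by rewrite etaM.
have [->|ne] := eqVneq a c.
  by rewrite dcomp10 (dcomp01_diff _ _ _ cD) -hE /f subrK.
have ne0 : (a + 0 != c + 0)%N by rewrite !addn0.
rewrite gid_homd // ehom // addr0.
rewrite (dcomp_homd (u := 1) (v := 0) h dh) //; last by lia.
by rewrite (dcomp_homd (u := 0) (v := 1) _ hh) ?addr0 //; lia.
Qed.

Section TensorForms.

Variables (p q : nat -> nat).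
Implicit Types (b : gform k p) (c : gform k q).

Lemma eq_ftens b b' c c' n :
  (forall i, b i = b' i) -> (forall i, c i = c' i) ->
  ftens b c n = ftens b' c' n.
Proof. by move=> eb ec; apply: eq_mxcol => a; rewrite eb ec. Qed.

Lemma ftensDl b b' c n :
  ftens (fun i => b i + b' i) c n = ftens b c n + ftens b' c n.
Proof.
by rewrite /ftens -mxcolD; apply: eq_mxcol => a; rewrite tensmxDl scalerDr.
Qed.

Lemma ftensDr b c c' n :
  ftens b (fun i => c i + c' i) n = ftens b c n + ftens b c' n.
Proof.
by rewrite /ftens -mxcolD; apply: eq_mxcol => a; rewrite tensmxDr scalerDr.
Qed.

Lemma ftensZl x b c n : ftens (fun i => x *: b i) c n = x *: ftens b c n.
Proof.
rewrite /ftens -mxcolZ; apply: eq_mxcol => a.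
by rewrite tensmxZl !scalerA mulrC.
Qed.

Lemma ftensZr x b c n : ftens b (fun i => x *: c i) n = x *: ftens b c n.
Proof.
rewrite /ftens -mxcolZ; apply: eq_mxcol => a.
by rewrite tensmxZr !scalerA mulrC.
Qed.

Lemma ftens0l c n : ftens (fun i => 0 : 'cV_(p i)) c n = 0.
Proof.
have := ftensZl 0 (fun i => 0) c n; rewrite scale0r => <-.
by apply: eq_ftens => // i; rewrite scale0r.
Qed.

Lemma ftens0r b n : ftens b (fun i => 0 : 'cV_(q i)) n = 0.
Proof.
have := ftensZr 0 b (fun i => 0) n; rewrite scale0r => <-.
by apply: eq_ftens => // i; rewrite scale0r.
Qed.

Lemma ftens_conc M N b c n :
  (forall i, i != M -> b i = 0) -> (forall i, i != N -> c i = 0) ->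
  n != (M + N)%N -> ftens b c n = 0.
Proof.
move=> hb hc ne; transitivity (\mxcol_(a < n.+1)
  (0 : 'cV[k]_(p a * q (n - a)%N))); last exact: mxcol0.
apply: eq_mxcol => a; have la := ltn_ord a.
have [e|/hb->] := eqVneq (a : nat) M; last by rewrite tens0mx scaler0.
rewrite hc ?tensmx0 ?scaler0 //; apply: contra ne => /eqP; lia.
Qed.

End TensorForms.

Lemma ftens_equi C D (b : gform k C) (c : gform k D) :
  cochain G b -> cochain G c -> cochain G (ftens b c : gform k (tens C D)).
Proof.
move=> ib ic g n Gg /=; rewrite mul_mxdiag_mxcol; apply: eq_mxcol => a.
by rewrite -scalemxAr tensmx_mulcv ib // ic.
Qed.

Lemma tens_low C D M N :
  (forall i, (i < M)%N -> C i = 0%N) -> (forall i, (i < N)%N -> D i = 0%N) ->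
  forall i, (i < M + N)%N -> tens C D i = 0%N.
Proof.
move=> lC lD i li; rewrite /= /tdim big1 // => a _.
have la := ltn_ord a; have [/lC->//|ge] := ltnP a M.
by rewrite lD ?muln0 //; lia.
Qed.

Definition rtens (p q : nat -> nat) (b : forall i, 'rV[k]_(p i))
    (c : forall i, 'rV[k]_(q i)) n : 'rV[k]_(tdim p q n) :=
  \mxrow_(a < n.+1) ((-1) ^+ (a * (n - a)) *: (b a *t c (n - a)%N
    : 'rV[k]_(p a * q (n - a)%N))).

Lemma tensmx_mulcr (p q p' q' : nat) (c : 'cV[k]_p) (d : 'cV_q) (r : 'rV_p')
    (s : 'rV_q') :
  (c *t d : 'cV_(p * q)) *m (r *t s : 'rV_(p' * q')) = (c *m r) *t (d *m s).
Proof. exact: (tensmx_mul c d r s). Qed.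

Lemma tensmx_mulrc (p q : nat) (r : 'rV[k]_p) (s : 'rV_q) (c : 'cV_p)
    (d : 'cV_q) :
  (r *t s : 'rV_(p * q)) *m (c *t d : 'cV_(p * q))
    = ((r *m c) *t (s *m d) : 'M_1).
Proof. exact: (tensmx_mul r s c d). Qed.

Lemma gtens00 (p q p' q' : nat -> nat) (f : gmap k p p') (g : gmap k q q') :
  f 0%N 0%N = 0 \/ g 0%N 0%N = 0 -> gtens f g 0%N 0%N = 0.
Proof.
move=> fg; transitivity (\mxblock_(a < 1, b < 1)
  (0 : 'M[k]_(p a * q (0 - a)%N, p' b * q' (0 - b)%N))); last exact: mxblock0.
apply: eq_mxblock => a b; rewrite !ord1.
by case: fg => ->; rewrite ?tens0mx ?tensmx0 scaler0.
Qed.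

Lemma diff_ftens (w : nat) C D (b : gform k C) (c : gform k D) n :
  is_complex G C -> is_complex G D -> (forall i, i != w -> c i = 0) ->
  cdiff (tens C D) n.+1 n *m ftens b c n
    = (-1) ^+ w *: ftens (dpull 0 1 (cdiff C) b) c n.+1
      + ftens b (dpull 0 1 (cdiff D) c) n.+1.
Proof.
move=> cC cD hc; have dC := diff_homd cC; have dD := diff_homd cD.
have iC := @gid_homd k C; have iD := @gid_homd k D.
rewrite /= mulmxDl (gtens_mul_ftens dC iD hc); last by lia.
rewrite (gtens_mul_ftens iC dD hc); last by lia.
rewrite mul0n mul1n expr0 scale1r; congr (_ *: _ + _); apply: eq_ftens => // i;
by rewrite dpull00 gid1 mul1mx.
Qed.

Lemma diff_ftens0 (N : nat) C D (e : gform k C) (e' : gform k D) n :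
  is_complex G C -> is_complex G D -> concentrated N e' ->
  (forall i, cdiff C i.+1 i *m e i = 0) ->
  (forall i, cdiff D i.+1 i *m e' i = 0) ->
  cdiff (tens C D) n.+1 n *m ftens e e' n = 0.
Proof.
move=> cC cD hc de de'; rewrite (diff_ftens _ _ cC cD hc).
have z1 i : dpull 0 1 (cdiff C) e i = 0 by rewrite dpull01; case: i => /=.
have z2 i : dpull 0 1 (cdiff D) e' i = 0 by rewrite dpull01; case: i => /=.
rewrite (eq_ftens _ z1 (fun i => erefl)) (eq_ftens _ (fun i => erefl) z2).
by rewrite ftens0l ftens0r scaler0 addr0.
Qed.

Lemma submx_of_homotopy (m n p q : nat) (K : 'M[k]_(m, n)) (A : 'M_(n, p))
    (d1 : 'M_(p, n)) (d0 : 'M_(n, q)) (X : 'M_(q, n)) (E : 'M_n) :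
  1%:M = A *m d1 + d0 *m X + E -> K *m d0 = 0 -> K *m E = 0 -> (K <= d1)%MS.
Proof.
move=> e Kd KE; rewrite -[K]mulmx1 e !mulmxDr KE addr0 !mulmxA Kd mul0mx addr0.
exact: submxMl.
Qed.

Lemma gtens_gid (p q : nat -> nat) n :
  gtens (gid p) (gid q) n n = 1%:M :> 'M[k]_(tdim p q n).
Proof.
transitivity (\mxdiag_(i < n.+1) (1%:M : 'M[k]_(p i * q (n - i)%N)));
  last exact: mxdiagZ.
apply: eq_mxblock => a b; case: eqP => [<-|ne]; last first.
  rewrite /gid; case: eqP => [/val_inj //|_]; by rewrite tens0mx scaler0.
rewrite conform_mx_id !gid1 tensmx11 addnn -mul2n mulnCA exprM sqrrN !expr1n.
by rewrite scale1r.
Qed.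

(** If h and h' contract C and D onto k and pr is the projection of C onto k,
then h × 1 + pr × h' contracts C ⊗ D onto k.  The contraction is only k-linear,
but exactness does not see the action of G. *)
Lemma tens_augmented M N C D (e : gform k C) (e' : gform k D) :
  augmented G M e -> augmented G N e' ->
  augmented G (M + N) (ftens e e' : gform k (tens C D)).
Proof.
move=> aC aD; have cC := aug_complex aC; have cD := aug_complex aD.
have cT := tens_complex cC cD.
have [h [eta [hh etaN etae etad hE]]] := contraction aC.
have [h' [eta' [hh' etaN' etae' etad' hE']]] := contraction aD.
have dC := diff_homd cC; have dD := diff_homd cD.
have iC := @gid_homd k C; have iD := @gid_homd k D.
have low := tens_low (aug_low aC) (aug_low aD).
have conc := ftens_conc (aug_conc aC) (aug_conc aD).
pose pr : gmap k C C := fun a c => e a *m eta c.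
pose pr' : gmap k D D := fun a c => e' a *m eta' c.
have prh : homd 0 0 pr.
  move=> a c; rewrite !addn0 /pr; case: (eqVneq c M) => [->|/etaN->] ne.
    by rewrite (aug_conc aC) ?mul0mx.
  by rewrite mulmx0.
have prh' : homd 0 0 pr'.
  move=> a c; rewrite !addn0 /pr'; case: (eqVneq c N) => [->|/etaN'->] ne.
    by rewrite (aug_conc aD) ?mul0mx.
  by rewrite mulmx0.
have prd a c : dcomp 0 0 pr (cdiff C) a c = 0.
  by rewrite dcomp00 -mulmxA etad mulmx0.
have dpr a c : dcomp 0 1 (cdiff C) pr a c = 0.
  rewrite (dcomp01_diff _ _ _ cC) mulmxA; case: a => [|a] /=.
    by rewrite (complex_deg cC) ?mul0mx.
  by rewrite (aug_closed aC) mul0mx.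
pose H n := gtens h (gid D) n n.+1 + gtens pr h' n n.+1.
have Hd n : H n *m cdiff (tens C D) n.+1 n
    = gtens (dcomp 1 0 h (cdiff C)) (gid D) n n - gtens h (cdiff D) n n
      + gtens pr (dcomp 1 0 h' (cdiff D)) n n.
  rewrite /H /= mulmxDl !mulmxDr.
  rewrite (gtens_mul hh iD iD); last by lia.
  rewrite (gtens_mul hh iD dD); last by lia.
  rewrite (gtens_mul prh hh' iD); last by lia.
  rewrite (gtens_mul prh hh' dD); last by lia.
  rewrite (eq_gtens _ _ (fun a b => erefl) (dcomp_idl _)).
  rewrite (eq_gtens _ _ (fun a b => dcomp_idr a b hh) (dcomp_idl _)).
  rewrite (eq_gtens _ _ prd (fun a b => erefl)) gtens0l.
  rewrite (eq_gtens _ _ (fun a b => dcomp_idr a b prh) (fun a b => erefl)).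
  by rewrite !simpdeg scaleN1r ?scaler0 add0r.
have dH n : exists X, cdiff (tens C D) n n.-1 *m X
    = gtens (dcomp 0 1 (cdiff C) h) (gid D) n n + gtens h (cdiff D) n n
      + gtens pr (dcomp 0 1 (cdiff D) h') n n.
  case: n => [|n].
    exists 0; rewrite mulmx0 gtens00; last by left; rewrite dcomp01.
    rewrite gtens00; last by right; rewrite (complex_deg cD).
    by rewrite gtens00 ?addr0 //; right; rewrite dcomp01.
  exists (H n).
  rewrite /H /= mulmxDl !mulmxDr.
  rewrite (gtens_mul dC iD iD); last by lia.
  rewrite (gtens_mul dC iD hh'); last by lia.
  rewrite (gtens_mul iC dD iD); last by lia.
  rewrite (gtens_mul iC dD hh'); last by lia.
  rewrite (eq_gtens _ _ (fun a b => erefl) (dcomp_idl _)).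
  rewrite (eq_gtens _ _ dpr (fun a b => erefl)) gtens0l scaler0 addr0.
  rewrite (eq_gtens _ _ (dcomp_idl _) (fun a b => dcomp_idr a b dD)).
  rewrite (eq_gtens _ _ (dcomp_idl _) (fun a b => erefl)).
  by rewrite !simpdeg ?scaler0 ?add0r ?addr0 ?addrA.
have HE n : exists X, 1%:M = H n *m cdiff (tens C D) n.+1 n
            + cdiff (tens C D) n n.-1 *m X + gtens pr pr' n n.
  have [X dX] := dH n; exists X; rewrite -gtens_gid.
  rewrite (eq_gtens _ _ hE (fun a b => erefl)) !gtensDl.
  have -> : gtens (fun a b => e a *m eta b) (gid D) n n
    = gtens pr (dcomp 1 0 h' (cdiff D)) n n
      + gtens pr (dcomp 0 1 (cdiff D) h') n n + gtens pr pr' n n.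
    by rewrite -!gtensDr; apply: eq_gtens.
  rewrite Hd dX !addrA; congr (_ + _ + _).
  rewrite -!addrA; congr (_ + _); rewrite [RHS]addrCA [X in _ = _ + X]addrA.
  rewrite [X in _ = _ + (X + _)]addrC !addrA subrK addrC //.
have prpr n : gtens pr pr' n n = ftens e e' n *m rtens eta eta' n.
  rewrite /ftens /rtens mul_mxcol_mxrow; apply: eq_mxblock => a b.
  rewrite -scalemxAl -scalemxAr tensmx_mulcr scalerA /pr.
  have [ea|ne] := eqVneq (a : nat) M; last first.
    by rewrite (aug_conc aC) // mul0mx tens0mx !scaler0.
  have [eb|ne] := eqVneq (b : nat) M; last first.
    by rewrite (etaN _ ne) mulmx0 tens0mx !scaler0.
  have -> : b = a by apply: val_inj; rewrite /= ea eb.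
  by rewrite -exprD mulnDr.
have onto : rtens eta eta' (M + N) *m ftens e e' (M + N)%N = 1%:M.
  have lM : (M < (M + N).+1)%N by lia.
  rewrite /rtens mul_mxrow_mxcol (bigD1 (Ordinal lM)) //= big1 => [|a ne].
    rewrite addr0 -scalemxAl -scalemxAr tensmx_mulrc scalerA -exprD addnn.
    rewrite addKn etae etae' -mul2n mulnC exprM sqrr_sign scale1r.
    exact: (tensmx11 k 1 1).
  by rewrite etaN ?tens0mx ?scaler0 ?mul0mx.
split=> //.
- exact: (ftens_equi (aug_inv aC) (aug_inv aD)).
- by apply/row_fullP; exists (rtens eta eta' (M + N)).
- apply/andP; split.
    apply/sub_kermxP; apply: (diff_ftens0 _ cC cD (aug_conc aD)).
      exact: aug_closed aC.
    exact: aug_closed aD.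
  have [X HX] := HE (M + N)%N; apply: submx_of_homotopy HX _ _.
    have d0 n : n = (M + N)%N -> cdiff (tens C D) n n.-1 = 0.
      case: n => [|n] en; first by rewrite (complex_deg cT).
      by apply: mx_cols0; apply: low; rewrite -en.
    by rewrite d0 ?mulmx0.
  by rewrite prpr mulmxA mulmx_ker mul0mx.
move=> i; apply/andP; split; first by apply/sub_kermxP; rewrite (complex_dd cT).
have [X HX] := HE (i + (M + N))%N.+1; apply: submx_of_homotopy HX _ _.
  exact: mulmx_ker.
by rewrite prpr conc ?mul0mx ?mulmx0 //; lia.
Qed.

End Contraction.

(** * The signed exchange of tensor factors *)
Section Swap.

Variable k : fieldType.

Lemma swap_mxE (a b : nat) (i : 'I_a) (j : 'I_b) (s : 'I_b) (t : 'I_a) :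
  swap_mx k a b b a (mxtens_index (i, j)) (mxtens_index (s, t))
    = ((i == t) && (j == s))%:R.
Proof. by rewrite mxE !mxtens_indexK. Qed.

Lemma tensmx_swap (a b a' b' : nat) (A : 'M[k]_(a, a')) (B : 'M[k]_(b, b')) :
  (A *t B) *m swap_mx k a' b' b' a' = swap_mx k a b b a *m (B *t A).
Proof.
apply/matrixP=> u v; case: (mxtens_indexP u) => i j.
case: (mxtens_indexP v) => s t; rewrite !mxE.
rewrite (bigD1 (mxtens_index (t, s))) //= big1 => [|w].
  rewrite [in RHS](bigD1 (mxtens_index (j, i))) //= big1 => [|w].
    rewrite tensmxE swap_mxE !eqxx !addr0 mulr1 tensmxE mxE !mxtens_indexK.
    by rewrite !eqxx mul1r mulrC.
  case: (mxtens_indexP w) => x y; rewrite (can_eq (@mxtens_indexK _ _)) => ne.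
  rewrite swap_mxE [i == y]eq_sym [j == x]eq_sym andbC -xpair_eqE (negPf ne).
  by rewrite mul0r.
case: (mxtens_indexP w) => x y; rewrite (can_eq (@mxtens_indexK _ _)) => ne.
by rewrite swap_mxE -xpair_eqE (negPf ne) mulr0.
Qed.

Lemma swap_mxK (a b : nat) :
  swap_mx k a b b a *m swap_mx k b a a b = 1%:M.
Proof.
apply/matrixP=> u v; case: (mxtens_indexP u) => i j.
case: (mxtens_indexP v) => s t; rewrite !mxE.
rewrite (bigD1 (mxtens_index (j, i))) //= big1 => [|w].
  rewrite !swap_mxE !eqxx mul1r addr0 (can_eq (@mxtens_indexK _ _)) xpair_eqE.
  by rewrite andbC.
case: (mxtens_indexP w) => x y; rewrite (can_eq (@mxtens_indexK _ _)) => ne.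
rewrite swap_mxE [i == y]eq_sym [j == x]eq_sym andbC -xpair_eqE (negPf ne).
by rewrite mul0r.
Qed.

Lemma swap_mx_cv (a b : nat) (c : 'cV[k]_a) (d : 'cV[k]_b) :
  swap_mx k a b b a *m (d *t c : 'cV_(b * a)) = (c *t d : 'cV_(a * b)).
Proof.
transitivity ((c *t d : 'cV_(a * b)) *m swap_mx k 1 1 1 1).
  exact: (esym (tensmx_swap c d)).
suff -> : swap_mx k 1 1 1 1 = 1%:M by rewrite mulmx1.
by apply/matrixP=> i j; rewrite !mxE !ord1.
Qed.

Definition swap (p q : nat -> nat) : gmap k (tdim p q) (tdim q p) :=
  fun n m => \mxblock_(a < n.+1, b < m.+1)
    (if (m == n) && (a + b == n)%N
     then (-1) ^+ (a * b) *: swap_mx k (p a) (q (n - a)%N) (q b) (p (m - b)%N)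
     else 0).

Lemma gswapE p n m : gswap p n m = swap p p n m.
Proof. by []. Qed.

(** Row a of the exchange has its only nonzero block in column n - a. *)
Lemma swap_mul (p q : nat -> nat) (r : nat) n
    (F : forall b, 'M[k]_(q b * p (n - b)%N, r)) (a : 'I_n.+1) :
  \sum_(b < n.+1) (if (n == n) && (a + b == n)%N
     then (-1) ^+ (a * b) *: swap_mx k (p a) (q (n - a)%N) (q b) (p (n - b)%N)
     else 0) *m F b
  = (-1) ^+ (a * (n - a))
      *: (swap_mx k (p a) (q (n - a)%N) (q (n - a)%N) (p (n - (n - a))%N)
          *m F (n - a)%N).
Proof.
have la := ltn_ord a; have lb : (n - a < n.+1)%N by lia.
rewrite (bigD1 (Ordinal lb)) //= big1 => [|b /eqP ne].
  by rewrite eqxx subnKC // eqxx addr0 -scalemxAl.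
case: ifP => [/andP[_ /eqP e]|]; last by rewrite mul0mx.
by case: ne; apply: val_inj => /=; lia.
Qed.

(** Exchanging the factors of f × g costs (-1)^(deg f * deg g). *)
Lemma gtens_swap (p q p' q' : nat -> nat) u v u' v' (f : gmap k p p')
    (g : gmap k q q') n m :
  homd u v f -> homd u' v' g -> (n + (u + u') = m + (v + v'))%N ->
  gtens f g n m *m swap p' q' m m
    = (-1) ^+ ((u + v) * (u' + v')) *: (swap p q n n *m gtens g f n m).
Proof.
move=> hf hg nm; rewrite /gtens /swap !mul_mxblock -mxblockZ.
apply: eq_mxblock => a c; have la := ltn_ord a; have lc := ltn_ord c.
rewrite (swap_mul (fun b => (-1) ^+ (b * (n - b + (m - c)))
   *: (g b c *t f (n - b)%N (m - c)%N))).
have lb : (m - c < m.+1)%N by lia.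
rewrite (bigD1 (Ordinal lb)) //= big1 => [|b /eqP ne]; last first.
  case: ifP => [/andP[_ /eqP e]|]; last by rewrite mulmx0.
  by case: ne; apply: val_inj => /=; lia.
rewrite addr0 eqxx subnK // eqxx /= -!scalemxAl -!scalemxAr.
have -> : (n - (n - a) = a)%N by lia.
have -> : (m - (m - c) = c)%N by lia.
rewrite tensmx_swap !scalerA -!exprD.
have [e|e] := eqVneq (a + u)%N (m - c + v)%N; last first.
  by rewrite (hf _ _ e) tensmx0 !mulmx0 !scaler0.
have [e'|e'] := eqVneq (n - a + u')%N (c + v')%N; last first.
  by rewrite (hg _ _ e') tens0mx !mulmx0 !scaler0.
congr (_ *: _); apply: odd_sign.
move/(congr1 odd): e; move/(congr1 odd): e'; rewrite !(oddD, oddM).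
case: (odd a); case: (odd (n - a)); case: (odd u); case: (odd u') => //=;
case: (odd v); case: (odd v') => //=; case: (odd (m - c)); case: (odd c) => //.
Qed.

Lemma swap_ftens (p q : nat -> nat) (M N : nat) (b : gform k q) (c : gform k p)
    n :
  (forall i, i != M -> b i = 0) -> (forall i, i != N -> c i = 0) ->
  swap p q n n *m ftens b c n = (-1) ^+ (M * N) *: ftens c b n.
Proof.
move=> hb hc; rewrite /swap /ftens mul_mxblock_mxrow -mxcolZ.
apply: eq_mxcol => a; have la := ltn_ord a.
rewrite (swap_mul (fun b' => (-1) ^+ (b' * (n - b'))
   *: (b b' *t c (n - b')%N : 'cV_(q b' * p (n - b')%N)))).
have -> : (n - (n - a) = a)%N by lia.
rewrite -scalemxAr swap_mx_cv !scalerA -!exprD.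
have [ea|/hc->] := eqVneq (a : nat) N; last by rewrite tens0mx !scaler0.
have [eb|/hb->] := eqVneq (n - a)%N M; last by rewrite tensmx0 !scaler0.
congr (_ *: _); apply: odd_sign; rewrite eb ea !(oddD, oddM).
by case: (odd M); case: (odd N).
Qed.

(** The inverse is again the exchange because both carry the same sign. *)
Lemma swapK (p q : nat -> nat) n : swap p q n n *m swap q p n n = 1%:M.
Proof.
rewrite /swap mul_mxblock -(@gtens_gid k p q); apply: eq_mxblock => a c.
have la := ltn_ord a; have lc := ltn_ord c.
rewrite (swap_mul (fun b => (if (n == n) && (b + c == n)%N
     then (-1) ^+ (b * c) *: swap_mx k (q b) (p (n - b)%N) (p c) (q (n - c)%N)
     else 0))).
have -> : (n - (n - a) = a)%N by lia.
rewrite eqxx /=; case: eqP => [e|ne].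
  have -> : (c : nat) = a by lia.
  rewrite -scalemxAr swap_mxK !gid1 tensmx11 scalerA -exprD; congr (_ *: _).
  by apply: odd_sign; rewrite !(oddD, oddM); case: (odd a); case: (odd (n - a)).
by rewrite mulmx0 (@gid_homd k p a c) ?tens0mx ?scaler0 //; lia.
Qed.

End Swap.
Arguments swap {k} p q.

(** * The exchange as a map of complexes *)
Section SwapComplex.

Variables (k : fieldType) (gT : finGroupType) (G : {group gT}).
Implicit Types C D : gcomplex k gT.

Lemma swap_equi C D g n : g \in G ->
  cact (tens C D) n g *m swap C D n n = swap C D n n *m cact (tens D C) n g.
Proof.
move=> Gg; rewrite /= /swap mul_mxdiag_mxblock mul_mxblock_mxdiag.
apply: eq_mxblock => a b; have la := ltn_ord a; have lb := ltn_ord b.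
rewrite eqxx /=; case: eqP => [e|_]; last by rewrite mulmx0 mul0mx.
have -> : (b : nat) = (n - a)%N by lia.
have -> : (n - (n - a) = a)%N by lia.
by rewrite -scalemxAr -scalemxAl tensmx_swap.
Qed.

Lemma swap_chain C D n : is_complex G C -> is_complex G D ->
  cdiff (tens C D) n.+1 n *m swap C D n n
    = swap C D n.+1 n.+1 *m cdiff (tens D C) n.+1 n.
Proof.
move=> cC cD; have dC := diff_homd cC; have dD := diff_homd cD.
have iC := @gid_homd k C; have iD := @gid_homd k D.
rewrite /= mulmxDl mulmxDr (gtens_swap dC iD); last by lia.
rewrite (gtens_swap iC dD); last by lia.
by rewrite !simpdeg addrC.
Qed.

End SwapComplex.

(** * Cochains up to coboundaries *)
Section ExactCochains.

Variables (k : fieldType) (gT : finGroupType) (G : {group gT}).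
Implicit Types C D P : gcomplex k gT.

Lemma invariantD C i (b c : 'cV[k]_(C i)) :
  invariant G b -> invariant G c -> invariant G (b + c).
Proof. by move=> ib ic g Gg; rewrite mulmxDr ib ?ic. Qed.

Lemma invariantZ C i x (c : 'cV[k]_(C i)) :
  invariant G c -> invariant G (x *: c).
Proof. by move=> ic g Gg; rewrite -scalemxAr ic. Qed.

Lemma invariantN C i (c : 'cV[k]_(C i)) : invariant G c -> invariant G (- c).
Proof. by move=> ic; rewrite -scaleN1r; exact: invariantZ. Qed.

Lemma invariant0 C i : invariant G (0 : 'cV[k]_(C i)).
Proof. by move=> g _; rewrite mulmx0. Qed.

Lemma invariant_equi C D (f : gmap k C D) i j (c : 'cV[k]_(D j)) :
  equivariant G f -> invariant G c -> invariant G (f i j *m c).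
Proof. by move=> eqf ic g Gg; rewrite mulmxA eqf // -mulmxA ic. Qed.

Lemma exact_cochainI C i (b : 'cV[k]_(C i)) (c : 'cV[k]_(C i.+1)) :
  invariant G b -> c = cdiff C i.+1 i *m b -> exact_cochain G c.
Proof. by move=> ib ->; exists b. Qed.

Lemma exact_cochainD C i (b c : 'cV[k]_(C i)) :
  exact_cochain G b -> exact_cochain G c -> exact_cochain G (b + c).
Proof.
case=> b' ib -> [c' ic ->]; exists (b' + c'); first exact: invariantD.
by rewrite mulmxDr.
Qed.

Lemma exact_cochainZ C i x (c : 'cV[k]_(C i)) :
  exact_cochain G c -> exact_cochain G (x *: c).
Proof.
case=> c' ic ->; exists (x *: c'); first exact: invariantZ.
by rewrite scalemxAr.
Qed.

Lemma exact_cochainN C i (c : 'cV[k]_(C i)) :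
  exact_cochain G c -> exact_cochain G (- c).
Proof. by move=> ec; rewrite -scaleN1r; exact: exact_cochainZ. Qed.

Lemma exact_cochainB C i (b c : 'cV[k]_(C i)) :
  exact_cochain G b -> exact_cochain G c -> exact_cochain G (b - c).
Proof. by move=> eb ec; apply: exact_cochainD => //; exact: exact_cochainN. Qed.

Lemma exact_cochain0 C i : exact_cochain G (0 : 'cV[k]_(C i)).
Proof. by exists 0; rewrite ?mulmx0 //; exact: invariant0. Qed.

Lemma exact_cochain_sum C i (I : finType) (P : pred I) (c : I -> 'cV[k]_(C i)) :
  (forall b, P b -> exact_cochain G (c b)) ->
  exact_cochain G (\sum_(b | P b) c b).
Proof.
move=> ec; elim/big_rec: _ => [|b x Pb ex]; first exact: exact_cochain0.
by apply: exact_cochainD => //; exact: ec.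
Qed.

(** A form supported in one degree, built from its value there. *)
Definition single C n (c : 'cV[k]_(C n)) : gform k C :=
  fun i => if i == n then conform_mx 0 c else 0.

Lemma single_at C n (c : 'cV[k]_(C n)) : single c n = c.
Proof. by rewrite /single eqxx conform_mx_id. Qed.

Lemma single_conc C n (c : 'cV[k]_(C n)) : concentrated n (single c).
Proof. by move=> i /negPf ne; rewrite /single ne. Qed.

Lemma single_cocycle C n (c : 'cV[k]_(C n)) : is_complex G C ->
  invariant G c -> cdiff C n.+1 n *m c = 0 -> cocycle G (single c).
Proof.
move=> cC ic dc; split=> [g i Gg|i].
  have [->|ne] := eqVneq i n; first by rewrite single_at ic.
  by rewrite single_conc ?mulmx0.
have [->|ne] := eqVneq i n; first by rewrite single_at dc.
by rewrite single_conc ?mulmx0.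
Qed.

Lemma ftens_cocycle N C D (b : gform k C) (c : gform k D) :
  is_complex G C -> is_complex G D -> concentrated N c ->
  cocycle G b -> cocycle G c ->
  cocycle G (ftens b c : gform k (tens C D)).
Proof.
move=> cC cD cc [ib db] [ic dc]; split; first exact: ftens_equi.
by move=> i; apply: (diff_ftens0 _ cC cD cc db dc).
Qed.

Lemma aug_cocycle M C (e : gform k C) : augmented G M e -> cocycle G e.
Proof. by move=> aC; split; [exact: aug_inv aC|exact: (aug_closed aC)]. Qed.

End ExactCochains.

(** * The augmentation is a unit for the cup product *)
Section Counit.

Variables (k : fieldType) (gT : finGroupType) (G : {group gT}).
Implicit Types C D P : gcomplex k gT.

(** The tensor product of A with the form w, as a map to the target of A; a
Kronecker product would have target dimension n * 1. *)
Definition tensv (m n p : nat) (A : 'M[k]_(m, n)) (w : 'cV[k]_p) :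
    'M[k]_(m * p, n) :=
  \matrix_(u, v) (A (mxtens_unindex u).1 v * w (mxtens_unindex u).2 0).

Lemma tensv0l m n p (w : 'cV[k]_p) : tensv (0 : 'M_(m, n)) w = 0.
Proof. by apply/matrixP=> i j; rewrite !mxE mul0r. Qed.

Lemma tensv0r m n p (A : 'M[k]_(m, n)) : tensv A (0 : 'cV_p) = 0.
Proof. by apply/matrixP=> i j; rewrite !mxE mulr0. Qed.

Lemma tensmx_mul_tensv (m m' n p p' : nat) (X : 'M[k]_(m, m'))
    (Y : 'M[k]_(p, p')) (A : 'M[k]_(m', n)) (w : 'cV[k]_p') :
  (X *t Y) *m tensv A w = tensv (X *m A) (Y *m w).
Proof.
apply/matrixP=> u v; case: (mxtens_indexP u) => i j.
rewrite !mxE !mxtens_indexK mulr_sum; apply: eq_bigr => t _.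
by rewrite !mxE !mxtens_indexK mulrCA !mulrA [A _ _ * _]mulrC.
Qed.

Lemma tensv_mul (m n p r : nat) (A : 'M[k]_(m, n)) (w : 'cV[k]_p)
    (B : 'M[k]_(n, r)) :
  tensv A w *m B = tensv (A *m B) w.
Proof.
apply/matrixP=> u v; rewrite !mxE mulr_suml; apply: eq_bigr => t _.
by rewrite !mxE mulrAC.
Qed.

Lemma tensv_cv (m p : nat) (c : 'cV[k]_m) (w : 'cV[k]_p) :
  tensv c w = (c *t w : 'cV_(m * p)).
Proof. by apply/matrixP=> u v; rewrite !mxE !ord1. Qed.

(** The map 1 × eps from C ⊗ P to C. *)
Definition counit C P (eps : gform k P) : gmap k (tens C P) C :=
  fun n m => \mxcol_(a < n.+1) tensv (gid C a m) (eps (n - a)%N).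

Variables (P : gcomplex k gT) (eps : gform k P).
Hypothesis augP : augmented G 0 eps.
Let cP := aug_complex augP.

Lemma counit_equi C : is_complex G C -> equivariant G (counit C eps).
Proof.
move=> cC g n m Gg; rewrite /= /counit mul_mxdiag_mxcol mxcol_mul.
apply: eq_mxcol => a; rewrite tensmx_mul_tensv tensv_mul (gid_equi cC) //.
by rewrite (aug_inv augP).
Qed.

Lemma counit_chain C n : is_complex G C ->
  cdiff (tens C P) n.+1 n *m counit C eps n n
    = counit C eps n.+1 n.+1 *m cdiff C n.+1 n.
Proof.
move=> cC; rewrite /= mulmxDl /counit !mul_mxblock_mxrow mxcol_mul -mxcolD.
apply: eq_mxcol => a; have la := ltn_ord a.
rewrite -big_split /= (bigD1 (@ord_max n)) //= big1 => [|b ne]; last first.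
  rewrite -!scalemxAl !tensmx_mul_tensv (@gid_homd k C b n); last first.
    by rewrite !addn0; apply: contra ne => /eqP e; apply/eqP/val_inj.
  by rewrite !mulmx0 !tensv0l !scaler0 addr0.
rewrite addr0 -!scalemxAl !tensmx_mul_tensv tensv_mul subnn.
have -> : cdiff P (n.+1 - a)%N 0%N *m eps 0%N = 0.
  have [->|ne] := eqVneq (n.+1 - a)%N 1%N; first exact: (aug_closed augP).
  by rewrite (complex_deg cP) ?mul0mx.
rewrite tensv0r scaler0 addr0 gid1 mulmx1.
have [e|ne] := eqVneq (n.+1 - a)%N 0%N; last first.
  by rewrite (gid_homd _) ?mul0mx ?tensv0r ?scaler0 ?(aug_conc augP) ?tensv0r //;
    lia.
rewrite e gid1 mul1mx muln0 expr0 scale1r; congr (tensv _ _).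
have -> : (a : nat) = n.+1 by lia.
by rewrite gid1 mul1mx.
Qed.

Lemma counit_form C (c : gform k C) n :
  counit C eps n n *m c n = ftens c eps n.
Proof.
rewrite /counit mxcol_mul; apply: eq_mxcol => a; have la := ltn_ord a.
rewrite tensv_mul; have [e|ne] := eqVneq (n - a)%N 0%N; last first.
  by rewrite (aug_conc augP) // tensv0r tensmx0 scaler0.
have ea : (a : nat) = n by lia.
have -> : gid C a n *m c n = c a by rewrite ea gid1 mul1mx.
by rewrite tensv_cv e muln0 expr0 scale1r.
Qed.

(** The composite of a diagonal C -> C ⊗ P with 1 × eps covers the identity
of k, so it differs from the identity of C by a null-homotopic map. *)
Lemma cup_unit M C (e : gform k C) (D : gmap k C (tens C P)) (c : gform k C) i :
  degreewise_projective G C -> augmented G M e ->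
  covers G D e (ftens e eps) -> cocycle G c ->
  exact_cochain G (D (i + M)%N (i + M)%N *m ftens c eps (i + M)%N
                   - c (i + M)%N).
Proof.
move=> pC aC [[hD eqD chD] De] [ic dc]; have cC := aug_complex aC.
pose f : gmap k C C := fun i j => D i i *m counit C eps i j - gid C i j.
have <- : f (i + M)%N (i + M)%N *m c (i + M)%N
  = D (i + M)%N (i + M)%N *m ftens c eps (i + M)%N - c (i + M)%N.
  by rewrite /f mulmxBl gid1 mul1mx -mulmxA counit_form.
apply: (exact_pullback (s := 1) (j := M) _ cC pC aC).
- by rewrite mulr1.
- move=> g a b Gg; rewrite /f mulmxBr mulmxBl mulmxA eqD // -mulmxA.
  by rewrite (counit_equi cC) // mulmxA (gid_equi cC).
- move=> i'; rewrite scale1r /f mulmxBr mulmxBl !gid1 mulmx1 mul1mx mulmxA chD.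
  by rewrite -!mulmxA counit_chain.
- rewrite /f mulmxBl gid1 mul1mx -mulmxA counit_form.
  have := De M; rewrite /pullback add0n => ->; rewrite subrr.
  exact: exact_cochain0.
- by move=> g Gg; exact: ic.
- exact: dc.
Qed.

End Counit.

(** * The extension with kernel Q ⊗ Q *)
Section Extension.

Variables (k : fieldType) (gT : finGroupType) (G : {group gT}).
Variables (P Q : gcomplex k gT) (a : gmap k P Q) (N : nat) (e : gform k Q).
Hypotheses (cP : is_complex G P) (augQ : augmented G N e).
Hypotheses (ha : homd 0 1 a) (eqa : equivariant G a).
Hypothesis da : forall i j l,
  cdiff P i j *m a j l + a i j *m cdiff Q j l = 0.

Let cQ := aug_complex augQ.
Let hdP := diff_homd cP.
Let hdQ := diff_homd cQ.
Let iP := @gid_homd k P.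
Let iQ := @gid_homd k Q.
Let cE : is_complex G (ext a) := ext_complex cP cQ ha eqa da.
Let hdE := diff_homd cE.
Let iE := @gid_homd k (ext a).

Lemma dcomp01_pred (p q r : nat -> nat) (f : gmap k p q) (g : gmap k q r) x y :
  homd 0 1 f -> dcomp 0 1 f g x y = f x x.-1 *m g x.-1 y.
Proof. by rewrite dcomp01 => hf; case: x => //=; rewrite hf ?mul0mx. Qed.

Lemma alpha_gchain : gchain 0 1 a.
Proof.
move=> x y; rewrite add0n expr1 scaleN1r (dcomp01_diff _ _ _ cP).
by rewrite dcomp01_pred //; apply/eqP; rewrite -addr_eq0 da.
Qed.

(** The inclusions of the two summands of the extension; only that of Q
commutes with the differentials unless α is 0. *)
Definition ext_inQ : gmap k Q (ext a) := fun i j => row_mx (gid Q i j) 0.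
Definition ext_inP : gmap k P (ext a) := fun i j => row_mx 0 (gid P i j).

Lemma ext_sub_homd : homd 0 0 (ext_sub a).
Proof. by move=> i j ne; rewrite /ext_sub iQ ?col_mx0. Qed.

Lemma ext_quo_homd : homd 0 0 (ext_quo a).
Proof. by move=> i j ne; rewrite /ext_quo iP ?col_mx0. Qed.

Lemma ext_inQ_homd : homd 0 0 ext_inQ.
Proof. by move=> i j ne; rewrite /ext_inQ iQ ?row_mx0. Qed.

Lemma ext_inP_homd : homd 0 0 ext_inP.
Proof. by move=> i j ne; rewrite /ext_inP iP ?row_mx0. Qed.

Let hsub := ext_sub_homd.
Let hquo := ext_quo_homd.
Let hinQ := ext_inQ_homd.
Let hinP := ext_inP_homd.

Lemma ext_sub_equi : equivariant G (ext_sub a).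
Proof.
move=> g i j Gg; rewrite /= mul_block_col mul_col_mx !mul0mx !mulmx0 !addr0.
by rewrite (gid_equi cQ).
Qed.

Lemma ext_inQ_equi : equivariant G ext_inQ.
Proof.
move=> g i j Gg; rewrite /= mul_row_block mul_mx_row !mul0mx !mulmx0 !addr0.
by rewrite (gid_equi cQ).
Qed.

Lemma ext_inP_equi : equivariant G ext_inP.
Proof.
move=> g i j Gg; rewrite /= mul_row_block mul_mx_row !mul0mx !mulmx0 !add0r.
by rewrite (gid_equi cP).
Qed.

Lemma diff_ext_sub x y : dcomp 0 1 (cdiff (ext a)) (ext_sub a) x y
  = dcomp 0 0 (ext_sub a) (cdiff Q) x y + dcomp 0 0 (ext_quo a) a x y.
Proof.
rewrite (dcomp01_diff _ _ _ cE) !dcomp00 /= mul_block_col !mulmx0 !addr0.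
rewrite !mul_col_mx !gid1 !mul1mx !mul0mx add_col_mx addr0 add0r.
by rewrite -(dcomp01_pred _ _ _ hdQ) -(dcomp01_pred _ _ _ ha) !dcomp_idr.
Qed.

Lemma diff_ext_inQ x y :
  dcomp 0 0 ext_inQ (cdiff (ext a)) x y = dcomp 0 1 (cdiff Q) ext_inQ x y.
Proof.
rewrite dcomp00 (dcomp01_diff _ _ _ cQ) /= mul_row_block !mul0mx !addr0.
rewrite mul_mx_row mulmx0 gid1 mul1mx mulmx0.
by rewrite -(dcomp01_pred _ _ _ hdQ) dcomp_idr.
Qed.

Lemma diff_ext_inP x y :
  dcomp 0 0 ext_inP (cdiff (ext a)) x y
    = dcomp 0 1 (cdiff P) ext_inP x y + dcomp 0 1 a ext_inQ x y.
Proof.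
rewrite dcomp00 (dcomp01_pred _ _ _ ha) (dcomp01_diff _ _ _ cP) /=.
rewrite mul_row_block !mul0mx !add0r !mul_mx_row !mulmx0 !gid1 !mul1mx.
rewrite add_row_mx addr0 add0r.
by rewrite -(dcomp01_pred _ _ _ hdP) -(dcomp01_pred _ _ _ ha) !dcomp_idr.
Qed.

Lemma ext_inQ_gchain : gchain 0 0 ext_inQ.
Proof. by move=> x y; rewrite diff_ext_inQ expr0 scale1r. Qed.

Lemma inQ_sub x y : dcomp 0 0 ext_inQ (ext_sub a) x y = gid Q x y.
Proof. by rewrite dcomp00 mul_row_col !mulmx0 addr0 gid1 mul1mx. Qed.

Lemma inQ_quo x y : dcomp 0 0 ext_inQ (ext_quo a) x y = 0.
Proof. by rewrite dcomp00 mul_row_col !mulmx0 mul0mx addr0. Qed.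

Lemma inP_sub x y : dcomp 0 0 ext_inP (ext_sub a) x y = 0.
Proof. by rewrite dcomp00 mul_row_col !mulmx0 mul0mx addr0. Qed.

Lemma inP_quo x y : dcomp 0 0 ext_inP (ext_quo a) x y = gid P x y.
Proof. by rewrite dcomp00 mul_row_col mul0mx add0r gid1 mul1mx. Qed.

(** The connecting map of 0 -> Q ⊗ Q -> P(ζ) ⊗ P(ζ) -> P(ζ ⊕ ζ) -> 0: on
Q ⊗ P it is 1 × α, on P ⊗ Q it is α × 1, and on P ⊗ P it is 0, as one
application of d moves only one of two factors from P to Q. *)
Definition ext_kappa : gmap k (ext2 a) (tens Q Q) := fun i j =>
  col_mx (col_mx (gtens (gid Q) a i j) (gtens a (gid Q) i j)) 0.

(** The graded section of π that comes from P(ζ) being Q ⊕ P as a graded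
module.  By [sec_diff] its failure to be a chain map is measured by κ. *)
Definition ext_sec : gmap k (ext2 a) (tens (ext a) (ext a)) := fun i j =>
  col_mx (col_mx (gtens ext_inQ ext_inP i j) (gtens ext_inP ext_inQ i j))
         (gtens ext_inP ext_inP i j).

Let T := tens (ext a) (ext a).
Let sub2 : gmap k T (tens Q Q) := gtens (ext_sub a) (ext_sub a).
Let inQ2 : gmap k (tens Q Q) T := gtens ext_inQ ext_inQ.

Lemma diff_sub2 i : cdiff T i.+1 i *m sub2 i i
  = sub2 i.+1 i.+1 *m cdiff (tens Q Q) i.+1 i
    + ext_pi a i.+1 i.+1 *m ext_kappa i.+1 i.
Proof.
rewrite /sub2 /= !mulmxDl !mulmxDr.
rewrite (gtens_mul hdE iE hsub); last by lia.
rewrite (gtens_mul iE hdE hsub); last by lia.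
rewrite (gtens_mul hsub hsub iQ); last by lia.
rewrite (gtens_mul hsub hsub hdQ); last by lia.
rewrite /ext_pi /ext_kappa mul_row_col mulmx0 addr0 mul_row_col.
rewrite (gtens_mul hsub hquo ha); last by lia.
rewrite (gtens_mul hquo hsub iQ); last by lia.
rewrite (eq_gtens _ _ diff_ext_sub (dcomp_idl _)).
rewrite (eq_gtens _ _ (dcomp_idl _) diff_ext_sub).
rewrite gtensDl gtensDr !simpdeg.
rewrite [in RHS](eq_gtens _ _ (fun x y => erefl) (fun x y => dcomp_idr x y hsub)).
rewrite [X in _ = _ + X + _](eq_gtens _ _ (fun x y => dcomp_idr x y hsub)
  (fun x y => erefl)).
rewrite [X in _ = _ + (X + _)](eq_gtens _ _ (fun x y => dcomp_idr x y hsub)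
  (fun x y => erefl)).
rewrite [X in _ = _ + (_ + X)](eq_gtens _ _ (fun x y => erefl)
  (fun x y => dcomp_idr x y hsub)).
by rewrite addrACA [X in _ = _ + X]addrC.
Qed.

Lemma gtens_mul0 (p q r p' q' r' : nat -> nat) w w' (f : gmap k p q)
    (f' : gmap k q r) (g : gmap k p' q') (g' : gmap k q' r') n l :
  homd 0 0 f -> homd 0 0 g -> homd w w' g' ->
  gtens f g n n *m gtens f' g' n l
    = gtens (dcomp 0 0 f f') (dcomp 0 0 g g') n l.
Proof.
by move=> hf hg hg'; rewrite (gtens_mul hf hg hg') ?simpdeg //; lia.
Qed.

Lemma sec_pi i : ext_sec i i *m ext_pi a i i = 1%:M.
Proof.
rewrite /ext_sec /ext_pi !mul_col_row !mul_mx_row mul_col_mx.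
rewrite !(gtens_mul0 _ _ _ hinQ hinP hquo) !(gtens_mul0 _ _ _ hinQ hinP hsub).
rewrite !(gtens_mul0 _ _ _ hinP hinQ hquo) !(gtens_mul0 _ _ _ hinP hinQ hsub).
rewrite !(gtens_mul0 _ _ _ hinP hinP hquo) !(gtens_mul0 _ _ _ hinP hinP hsub).
rewrite (eq_gtens _ _ inQ_sub inP_quo) (eq_gtens _ _ inP_quo inQ_sub).
rewrite (eq_gtens _ _ inP_quo inP_quo) !gtens_gid.
rewrite !(eq_gtens _ _ inQ_quo (fun x y => erefl _)) !gtens0l.
rewrite !(eq_gtens _ _ inP_sub (fun x y => erefl _)) !gtens0l.
rewrite (eq_gtens _ _ (fun x y => erefl _) inP_sub) gtens0r.
rewrite (eq_gtens _ _ (fun x y => erefl _) inQ_quo) gtens0r.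
by rewrite row_mx0 col_mx0 -!scalar_mx_block.
Qed.

Lemma inQ2_pi i : inQ2 i i *m ext_pi a i i = 0.
Proof.
rewrite /inQ2 /ext_pi !mul_mx_row.
rewrite !(gtens_mul0 _ _ _ hinQ hinQ hquo) !(gtens_mul0 _ _ _ hinQ hinQ hsub).
rewrite !(eq_gtens _ _ inQ_quo (fun x y => erefl _)) !gtens0l.
by rewrite (eq_gtens _ _ (fun x y => erefl _) inQ_quo) gtens0r !row_mx0.
Qed.

Lemma sec_diff i : ext_sec i.+1 i.+1 *m cdiff T i.+1 i
  = cdiff (ext2 a) i.+1 i *m ext_sec i i + ext_kappa i.+1 i *m inQ2 i i.
Proof.
have rQ x y := dcomp_idr x y hinQ; have rP x y := dcomp_idr x y hinP.
have same (U V : nat -> nat) (f : gmap k U V) x y : f x y = f x y by [].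
rewrite /ext_sec /ext_kappa /inQ2 /= !mul_block_col !mul_col_mx !mul0mx.
rewrite !addr0 !add0r mul_row_col !add_col_mx addr0.
rewrite !mulmxDl !mulmxDr.
rewrite (gtens_mul hinQ hinP iE) ?(gtens_mul hinQ hinP hdE); try by lia.
rewrite (gtens_mul hinP hinQ iE) ?(gtens_mul hinP hinQ hdE); try by lia.
rewrite (gtens_mul hinP hinP iE) ?(gtens_mul hinP hinP hdE); try by lia.
rewrite (gtens_mul hdQ iP hinP) ?(gtens_mul iQ hdP hinP); try by lia.
rewrite (gtens_mul hdP iQ hinQ) ?(gtens_mul iP hdQ hinQ); try by lia.
rewrite (gtens_mul hdP iP hinP) ?(gtens_mul iP hdP hinP); try by lia.
rewrite (gtens_mul iQ ha hinQ) ?(gtens_mul ha iQ hinQ); try by lia.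
rewrite (gtens_mul iP ha hinQ) ?(gtens_mul ha iP hinP); try by lia.
rewrite !simpdeg.
apply: (congr2 col_mx); first apply: (congr2 col_mx).
- rewrite (eq_gtens _ _ diff_ext_inQ rP) (eq_gtens _ _ rQ diff_ext_inP) gtensDr.
  rewrite (eq_gtens _ _ (same _ _ _) (dcomp_idl _)).
  rewrite [in RHS](eq_gtens _ _ (dcomp_idl _) (same _ _ (dcomp 0 1 (cdiff P) _))).
  by rewrite [in RHS](eq_gtens _ _ (dcomp_idl _) (same _ _ (dcomp 0 1 a _))) addrA.
- rewrite (eq_gtens _ _ diff_ext_inP rQ) (eq_gtens _ _ rP diff_ext_inQ) gtensDl.
  rewrite (eq_gtens _ _ (same _ _ (dcomp 0 1 (cdiff P) _)) (dcomp_idl _)).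
  rewrite [in RHS](eq_gtens _ _ (same _ _ (dcomp 0 1 a _)) (dcomp_idl _)).
  by rewrite [in RHS](eq_gtens _ _ (dcomp_idl _) (same _ _ _)) addrAC.
rewrite (eq_gtens _ _ diff_ext_inP rP) (eq_gtens _ _ rP diff_ext_inP).
rewrite gtensDl gtensDr.
rewrite [in RHS](eq_gtens _ _ (same _ _ (dcomp 0 1 (cdiff P) _)) (dcomp_idl _)).
rewrite [in RHS](eq_gtens _ _ (same _ _ (dcomp 0 1 a _)) (dcomp_idl _)).
rewrite [in RHS](eq_gtens _ _ (dcomp_idl _) (same _ _ (dcomp 0 1 (cdiff P) _))).
rewrite [in RHS](eq_gtens _ _ (dcomp_idl _) (same _ _ (dcomp 0 1 a _))).
by rewrite addrACA addrC.
Qed.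

Lemma kappa_diff i : cdiff (ext2 a) i.+2 i.+1 *m ext_kappa i.+1 i
  = - (ext_kappa i.+2 i.+1 *m cdiff (tens Q Q) i.+1 i).
Proof.
have ca := alpha_gchain; have cid C := @gid_gchain k gT G C.
pose dQP := cdiff (tens Q P) i.+2 i.+1.
pose dPQ := cdiff (tens P Q) i.+2 i.+1.
apply: (etrans (mul_block_col (block_mx dQP 0 0 dPQ) 0
  (row_mx (gtens a (gid P) i.+2 i.+1) (gtens (gid P) a i.+2 i.+1))
  (cdiff (tens P P) i.+2 i.+1)
  (col_mx (gtens (gid Q) a i.+1 i) (gtens a (gid Q) i.+1 i)) 0)).
rewrite !mulmx0 !addr0 mul_block_col mul_row_col !mul0mx add0r addr0.
rewrite (diff_gtens (n := i.+1) (m := i) cQ cP cQ cQ iQ ha (cid _ cQ) ca);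
  last by lia.
rewrite (diff_gtens (n := i.+1) (m := i) cP cQ cQ cQ ha iQ ca (cid _ cQ));
  last by lia.
rewrite !simpdeg !scaleN1r /ext_kappa !mul_col_mx mul0mx.
rewrite !opp_col_mx oppr0; congr (col_mx _ _).
rewrite (gtens_mul ha iP ha) ?(gtens_mul iP ha iQ); try by lia.
rewrite (eq_gtens _ _ (fun x y => dcomp_idr x y ha) (dcomp_idl _)).
rewrite (eq_gtens _ _ (dcomp_idl _) (fun x y => dcomp_idr x y ha)).
by rewrite !simpdeg scaleN1r addNr.
Qed.

End Extension.

(** * Lifting as the vanishing of one class *)
Section Criterion.

Variables (k : fieldType) (gT : finGroupType) (G : {group gT}).
Variables (P Q : gcomplex k gT) (a : gmap k P Q) (N : nat) (e : gform k Q).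
Hypotheses (cP : is_complex G P) (pP : degreewise_projective G P).
Hypotheses (pQ : degreewise_projective G Q) (augQ : augmented G N e).
Hypotheses (ha : homd 0 1 a) (eqa : equivariant G a).
Hypothesis da : forall i j l,
  cdiff P i j *m a j l + a i j *m cdiff Q j l = 0.

Let cQ := aug_complex augQ.
Let cE : is_complex G (ext a) := ext_complex cP cQ ha eqa da.
Let T := tens (ext a) (ext a).

Variable psi : gmap k (ext a) (ext2 a).
Hypothesis psi_chain : chain_map G psi.

Definition lifts := exists psit : gmap k (ext a) (tens (ext a) (ext a)),
  chain_map G psit /\ forall i, psit i i *m ext_pi a i i = psi i i.

Definition obstruction : 'cV[k]_(ext a (N + N).+1) :=
  psi (N + N).+1 (N + N).+1 *m
    (ext_kappa a (N + N).+1 (N + N) *m ftens e e (N + N)).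

Let sub2 : gmap k T (tens Q Q) := gtens (ext_sub a) (ext_sub a).
Let inQ2 : gmap k (tens Q Q) T := gtens (ext_inQ a) (ext_inQ a).

Let augQQ : augmented G (N + N) (ftens e e : gform k (tens Q Q)) :=
  tens_augmented augQ augQ.

(** Composing a lift with the projection of P(ζ) ⊗ P(ζ) to Q ⊗ Q and then
with e × e gives a cochain.  By [diff_sub2] the projection commutes with d up
to κ π, so the coboundary of this cochain is the obstruction. *)
Lemma obstruction_exact_of_lift : lifts -> exact_cochain G obstruction.
Proof.
case=> psit [[_ eqt cht] lift].
apply: (exact_cochainI (b := psit (N + N)%N (N + N)%N *m (sub2 (N + N)%N (N + N)%N
          *m ftens e e (N + N)%N))).
  apply: (invariant_equi (D := T)) => //.
  apply: (invariant_equi (C := T) (D := tens Q Q)).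
    by apply: gtens_equi; exact: (ext_sub_equi a augQ).
  by move=> g Gg; exact: (aug_inv augQQ).
have := diff_sub2 cP augQ ha eqa da (N + N).
rewrite -/T -/sub2 => dsub.
rewrite mulmxA cht -!mulmxA [X in _ = _ *m X]mulmxA dsub mulmxDl.
rewrite -mulmxA (aug_closed augQQ) mulmx0 add0r -mulmxA mulmxA.
by rewrite lift.
Qed.

Lemma kappa_equi : equivariant G (ext_kappa a).
Proof.
move=> g i j Gg.
have /(_ g i j Gg) eq1 := gtens_equi (gid_equi cQ) eqa.
have /(_ g i j Gg) eq2 := gtens_equi eqa (gid_equi cQ).
apply: (etrans (mul_block_col (block_mx (cact (tens Q P) i g) 0 0
  (cact (tens P Q) i g)) 0 0 (cact (tens P P) i g)
  (col_mx (gtens (gid Q) a i j) (gtens a (gid Q) i j)) 0)).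
rewrite !mulmx0 mul0mx !addr0 mul_block_col !mul0mx add0r addr0 eq1 eq2.
by rewrite /ext_kappa !mul_col_mx mul0mx.
Qed.

Lemma sec_equi : equivariant G (ext_sec a).
Proof.
move=> g i j Gg.
have eqQ := ext_inQ_equi a augQ; have eqP := ext_inP_equi a cP.
have /(_ g i j Gg) eq1 := gtens_equi eqQ eqP.
have /(_ g i j Gg) eq2 := gtens_equi eqP eqQ.
have /(_ g i j Gg) eq3 := gtens_equi eqP eqP.
apply: (etrans (mul_block_col (block_mx (cact (tens Q P) i g) 0 0
  (cact (tens P Q) i g)) 0 0 (cact (tens P P) i g)
  (col_mx (gtens (ext_inQ a) (ext_inP a) i j)
          (gtens (ext_inP a) (ext_inQ a) i j))
  (gtens (ext_inP a) (ext_inP a) i j))).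
rewrite !mul0mx add0r addr0 mul_block_col !mul0mx add0r addr0 eq1 eq2 eq3.
by rewrite /ext_sec !mul_col_mx.
Qed.

(** If the obstruction is a coboundary, then κ ψ is null-homotopic, and the
null-homotopy corrects the graded lift of ψ through [ext_sec] to a chain map;
the correction lies in Q ⊗ Q, so π does not see it. *)
Lemma lift_of_obstruction_exact : exact_cochain G obstruction -> lifts.
Proof.
have [hpsi eqpsi chpsi] := psi_chain.
pose f : gmap k (ext a) (tens Q Q) := fun i j => psi i i *m ext_kappa a i j.
have eqf : equivariant G f.
  move=> g i j Gg; rewrite /f mulmxA eqpsi // -!mulmxA; congr (_ *m _).
  exact: kappa_equi.
have eqinQ2 : equivariant G inQ2.
  by apply: gtens_equi; exact: ext_inQ_equi augQ.
have pE : degreewise_projective G (ext a) by exact: ext_projective.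
move=> obs.
have [|i||H [hH eqH HE]] := @homotopy_of_exact k gT G (ext a) (tens Q Q)
  (N + N).+1 (N + N) (ftens e e) (- 1) f _ cE pE augQQ eqf.
- by rewrite mulrNN mulr1.
- rewrite addnS scaleN1r /f mulmxA chpsi -!mulmxA -mulmxN; congr (_ *m _).
  exact: (kappa_diff cP augQ ha da).
- by rewrite /f -mulmxA.
have HE' i : f i.+1 i = H i.+1 i.+1 *m cdiff (tens Q Q) i.+1 i
                        - cdiff (ext a) i.+1 i *m H i i.
  have [le|lt] := leqP (N + N) i; last first.
    by apply: mx_cols0; exact: (aug_low augQQ).
  by have := HE (i - (N + N))%N; rewrite addnS subnK // scaleN1r.
have hH0 i j : i != j -> H i j = 0.
  by move=> ne; apply: hH; rewrite eqn_add2r.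
pose psit : gmap k (ext a) T := fun i j => if i == j then
  psi i j *m ext_sec a j j - H i j *m inQ2 j j else 0.
exists psit; split; last first.
  move=> i; rewrite /psit eqxx mulmxBl -!mulmxA sec_pi // /inQ2 inQ2_pi //.
  by rewrite mulmx1 mulmx0 subr0.
split.
- by move=> i j ne; rewrite /psit eq_sym (negPf ne).
- move=> g i j Gg; rewrite /psit; case: eqP => [<-|_]; last first.
    by rewrite mulmx0 mul0mx.
  rewrite mulmxBr mulmxBl !mulmxA eqpsi // eqH // -!mulmxA eqinQ2 //.
  by rewrite sec_equi.
move=> i; rewrite /psit !eqxx mulmxBr mulmxBl.
have sd := sec_diff cP augQ ha eqa da i.
have id : inQ2 i.+1 i.+1 *m cdiff T i.+1 i = cdiff (tens Q Q) i.+1 i *m inQ2 i i.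
  have ch := ext_inQ_gchain a augQ.
  have hin := @ext_inQ_homd _ _ P Q a.
  by rewrite /inQ2 (diff_gtens cQ cQ cE cE hin hin ch ch) ?simpdeg.
rewrite -!mulmxA id sd mulmxDr mulmxA chpsi -mulmxA.
have -> : psi i.+1 i.+1 *m (ext_kappa a i.+1 i *m inQ2 i i)
  = f i.+1 i *m inQ2 i i by rewrite mulmxA.
by rewrite HE' mulmxBl -!mulmxA addrA [RHS]addrAC addrK.
Qed.

Lemma lifts_iff : lifts <-> exact_cochain G obstruction.
Proof.
split; [exact: obstruction_exact_of_lift|exact: lift_of_obstruction_exact].
Qed.

End Criterion.

(** * Chain maps with the natural sign *)
Section LiftChain.

Variables (k : fieldType) (gT : finGroupType) (G : {group gT}).
Implicit Types C D : gcomplex k gT.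

(** Passage from the indexing of [homotopy_extension], which starts at the
lowest degree of D, to [gchain]. *)
Lemma lift_gchain C D (j M : nat) (f : gmap k C D) :
  is_complex G C -> is_complex G D -> (forall i, (i < M)%N -> D i = 0%N) ->
  homd M j f ->
  (forall i, cdiff C (i + j)%N.+1 (i + j)%N *m f (i + j)%N (i + M)%N
     = (-1) ^+ (M + j)
       *: (f (i + j)%N.+1 (i + M)%N.+1 *m cdiff D (i + M)%N.+1 (i + M)%N)) ->
  gchain M j f.
Proof.
move=> cC cD low hf chf x y; rewrite (dcomp01_diff _ _ _ cC) /dcomp.
have [ltyM|leMy] := ltnP y M; first by apply: mx_cols0; exact: low.
have [e|ne] := eqVneq (x + M)%N (y + j).+1; last first.
  have -> : cdiff C x x.-1 *m f x.-1 y = 0.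
    case: x ne => [|x] ne; first by rewrite (complex_deg cC) ?mul0mx.
    by rewrite hf ?mulmx0 //=; rewrite addSn eqSS in ne.
  case: ifP => [le|_]; last by rewrite scaler0.
  by rewrite (complex_deg cD) ?mulmx0 ?scaler0 //; lia.
have [i ey] : exists i, y = (i + M)%N by exists (y - M)%N; rewrite subnK.
have ex : x = (i + j)%N.+1 by lia.
rewrite ey ex chf ifT; last by lia.
by have -> : ((i + j).+1 + M - j = (i + M).+1)%N by lia.
Qed.

End LiftChain.

(** * The cup-one square *)
Section CupOneSquare.

Variables (k : fieldType) (gT : finGroupType) (G : {group gT}).
Variables (P : gcomplex k gT) (eps : gform k P) (N : nat).
Hypotheses (augP : augmented G 0 eps) (pP : degreewise_projective G P).
Variables (Delta Y0 : gmap k P (tens P P)).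
Hypothesis chDelta : chain_map G Delta.
Hypothesis eqY0 : equivariant G Y0.
Hypothesis Y0E : forall i, Delta i i - Delta i i *m swap P P i i
  = Y0 i i.+1 *m cdiff (tens P P) i.+1 i + cdiff P i i.-1 *m Y0 i.-1 i.
Hypothesis sgn : (-1) ^+ N.+1 = 1 :> k.

Let cP := aug_complex augP.
Let augPP : augmented G 0 (ftens eps eps : gform k (tens P P)).
Proof. by have := tens_augmented augP augP; rewrite addn0. Qed.

Lemma sign_multiple m : (-1) ^+ (N.+1 * m) = 1 :> k.
Proof. by rewrite exprM sgn expr1n. Qed.

(** The equation d Y0 + Y0 d = (1 - T) Δ and (1 + T)(1 - T) = 0 show that
(1 + T) Y0 anticommutes with d.  It has degree 1, so it is null-homotopic and
kills every class. *)
Lemma cup_one_sym w i (b c : gform k P) : cocycle G b -> cocycle G c ->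
  concentrated w c ->
  exact_cochain G (Y0 i i.+1 *m (ftens b c i.+1
                     + swap P P i.+1 i.+1 *m ftens b c i.+1)).
Proof.
move=> cb cc hc; have [iF dF] := ftens_cocycle cP cP hc cb cc.
pose f : gmap k P (tens P P) := fun i j => Y0 i j *m (1%:M + swap P P j j).
have -> : Y0 i i.+1 *m (ftens b c i.+1 + swap P P i.+1 i.+1 *m ftens b c i.+1)
  = f i i.+1 *m ftens b c i.+1 by rewrite /f -mulmxA mulmxDl mul1mx.
have fd j : f j j.+1 *m cdiff (tens P P) j.+1 j
    = - (cdiff P j j.-1 *m (Y0 j.-1 j *m (1%:M + swap P P j j))).
  have -> : f j j.+1 *m cdiff (tens P P) j.+1 j
    = (Y0 j j.+1 *m cdiff (tens P P) j.+1 j) *m (1%:M + swap P P j j).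
    rewrite /f -!mulmxA; congr (_ *m _); rewrite mulmxDl mul1mx.
    rewrite -(swap_chain j cP cP) -[X in X + _]mulmx1.
    exact: (esym (mulmxDr _ _ _)).
  have -> : Y0 j j.+1 *m cdiff (tens P P) j.+1 j
    = Delta j j *m (1%:M - swap P P j j) - cdiff P j j.-1 *m Y0 j.-1 j.
    by rewrite mulmxBr mulmx1 Y0E addrK.
  rewrite mulmxBl -mulmxA mulmxDr mulmx1 [(_ - _) *m swap _ _ _ _]mulmxBl.
  by rewrite mul1mx swapK addrA subrK subrr mulmx0 sub0r mulmxA.
apply: (exact_pullback1 (s := - 1) _ cP pP augPP).
- by rewrite mulrNN mulr1.
- move=> g x y Gg; rewrite /f mulmxA eqY0 // -!mulmxA; congr (_ *m _).
  by rewrite mulmxDr mulmxDl mulmx1 mul1mx (swap_equi P P y Gg).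
- by move=> j; rewrite fd scaleN1r opprK.
- by rewrite fd (complex_deg cP) // mul0mx oppr0.
- by move=> g Gg; exact: iF.
exact: dF.
Qed.

(** The product b ∪_1 b for b of degree N + 1; over the prime field of
characteristic 2 it represents Sq^N b. *)
Definition cup_one_sq (b : gform k P) : 'cV[k]_(P (N + N).+1) :=
  Y0 (N + N)%N.+1 (N + N)%N.+2 *m ftens b b (N + N)%N.+2.

Lemma eq_cup_one_sq b c : (forall i, b i = c i) -> cup_one_sq b = cup_one_sq c.
Proof. by move=> e; rewrite /cup_one_sq (eq_ftens _ e e). Qed.

(** The cross terms b × c + c × b form (b × c)(1 + T). *)
Lemma cup_one_sqD b c : cocycle G b -> cocycle G c ->
  concentrated N.+1 b -> concentrated N.+1 c ->
  exact_cochain G (cup_one_sq (fun i => b i + c i)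
                   - (cup_one_sq b + cup_one_sq c)).
Proof.
move=> cb cc hb hc.
have := cup_one_sym (N + N)%N.+1 cb cc hc.
rewrite (swap_ftens _ hb hc) sign_multiple scale1r; congr (exact_cochain _ _).
rewrite /cup_one_sq ftensDl !ftensDr !mulmxDr.
move: (Y0 _ _ *m ftens b b _) (Y0 _ _ *m ftens b c _) (Y0 _ _ *m ftens c b _)
  (Y0 _ _ *m ftens c c _) => x y z t.
by apply/matrixP=> i j; rewrite !mxE; ring.
Qed.

Lemma cup_one_sqZ x b : cup_one_sq (fun i => x *: b i) = x ^+ 2 *: cup_one_sq b.
Proof.
by rewrite /cup_one_sq ftensZl ftensZr scalerA -expr2 -scalemxAr.
Qed.

Lemma coboundary_cocycle (w : gform k P) : cochain G w ->
  cocycle G (dpull 0 1 (cdiff P) w).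
Proof.
move=> iw; split=> [g i Gg|i]; rewrite dpull01; case: i => [|i] /=.
- by rewrite mulmx0.
- by rewrite mulmxA (complex_equi cP) // -mulmxA iw.
- by rewrite mulmx0.
by rewrite mulmxA (complex_dd cP) mul0mx.
Qed.

Lemma coboundary_conc (w : gform k P) :
  concentrated N w -> concentrated N.+1 (dpull 0 1 (cdiff P) w).
Proof. by move=> hw [|i] ne; rewrite dpull01 //= hw ?mulmx0. Qed.

(** For v = dw, v × v is the coboundary of w × v.  Moving d across Y0 leaves
(1 - T)(w × v), which is w × v - v × w, the coboundary of w × w. *)
Lemma cup_one_sq_coboundary (w : gform k P) : cochain G w -> concentrated N w ->
  exact_cochain G (cup_one_sq (dpull 0 1 (cdiff P) w)).
Proof.
move=> iw hw; set v := dpull 0 1 (cdiff P) w.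
have hv : concentrated N.+1 v := coboundary_conc hw.
have [iv dv] := coboundary_cocycle iw; rewrite -/v in iv dv.
have [_ eqD chD] := chDelta.
have sgnN : (-1) ^+ N = -1 :> k.
  by move: sgn; rewrite exprS mulN1r => /eqP; rewrite eqr_oppLR => /eqP.
have vv : ftens v v (N + N)%N.+2
    = cdiff (tens P P) (N + N)%N.+2 (N + N)%N.+1 *m ftens w v (N + N)%N.+1.
  rewrite (diff_ftens _ _ cP cP hv) sgn scale1r -/v.
  have z i : dpull 0 1 (cdiff P) v i = 0.
    by rewrite dpull01; case: i => [|i] //=; rewrite dv.
  by rewrite (eq_ftens _ (fun i => erefl (w i)) z) ftens0r addr0.
have wv : ftens w v (N + N)%N.+1 - ftens v w (N + N)%N.+1
    = cdiff (tens P P) (N + N)%N.+1 (N + N)%N *m ftens w w (N + N)%N.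
  by rewrite (diff_ftens _ _ cP cP hw) sgnN scaleN1r addrC.
have iF := ftens_equi iw iv; have iF' := ftens_equi iw iw.
rewrite /cup_one_sq vv mulmxA.
have -> : Y0 (N + N)%N.+1 (N + N)%N.+2
    *m cdiff (tens P P) (N + N)%N.+2 (N + N)%N.+1
  = Delta (N + N)%N.+1 (N + N)%N.+1 *m (1%:M - swap P P (N + N)%N.+1 (N + N)%N.+1)
    - cdiff P (N + N)%N.+1 (N + N)%N *m Y0 (N + N)%N (N + N)%N.+1.
  by rewrite mulmxBr mulmx1 Y0E addrK.
rewrite mulmxBl -!mulmxA; apply: exact_cochainB.
  rewrite mulmxBl mul1mx (swap_ftens _ hw hv) mulnC sign_multiple scale1r wv.
  rewrite mulmxA -chD.
  apply: (exact_cochainI (b := Delta (N + N)%N (N + N)%N *m ftens w w (N + N)%N)).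
    by apply: invariant_equi => // g Gg; exact: iF'.
  by rewrite mulmxA.
apply: (exact_cochainI (b := Y0 (N + N)%N (N + N)%N.+1 *m ftens w v (N + N)%N.+1)).
  by apply: invariant_equi => // g Gg; exact: iF.
by [].
Qed.

Lemma cup_one_sq_sum (I : Type) (r : seq I) (x : I -> k) (v : I -> gform k P) :
  (forall b, cocycle G (v b) /\ concentrated N.+1 (v b)) ->
  exact_cochain G (cup_one_sq (fun i => \sum_(b <- r) x b *: v b i)
                   - \sum_(b <- r) x b ^+ 2 *: cup_one_sq (v b)).
Proof.
move=> hv.
have cc (s : seq I) : cocycle G (fun i => \sum_(b <- s) x b *: v b i)
    /\ concentrated N.+1 (fun i => \sum_(b <- s) x b *: v b i).
  split; last first.
    by move=> i ne; rewrite big1 // => b _; rewrite (hv b).2 ?scaler0.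
  split=> [g i Gg|i]; rewrite mulmx_sumr.
    by apply: eq_bigr => b _; rewrite -scalemxAr (hv b).1.1.
  by rewrite big1 // => b _; rewrite -scalemxAr (hv b).1.2 scaler0.
elim: r => [|b r IH].
  rewrite big_nil subr0.
  have -> : cup_one_sq (fun i => \sum_(b <- [::]) x b *: v b i)
    = (0 : k) ^+ 2 *: cup_one_sq (fun i => 0).
    by rewrite -cup_one_sqZ; apply: eq_cup_one_sq => i; rewrite big_nil scaler0.
  by rewrite expr2 mul0r scale0r; exact: exact_cochain0.
have [cr hr] := cc r; have [cb hb] := cc [:: b].
have e i : \sum_(c <- b :: r) x c *: v c i
    = \sum_(c <- [:: b]) x c *: v c i + \sum_(c <- r) x c *: v c i.
  by rewrite !big_cons big_nil addr0.
have e1 i : \sum_(c <- [:: b]) x c *: v c i = x b *: v b i.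
  by rewrite big_cons big_nil addr0.
rewrite (eq_cup_one_sq e) big_cons -cup_one_sqZ -(eq_cup_one_sq e1).
have := exact_cochainD (cup_one_sqD cb cr hb hr) IH.
congr (exact_cochain _ _).
move: (cup_one_sq _) (cup_one_sq _) (cup_one_sq _) (\sum_(j <- r) _) => X Y Z t.
by apply/matrixP=> i j; rewrite !mxE; ring.
Qed.

End CupOneSquare.

(** * From the obstruction to the cup-one square *)
Section Reduction.

Variables (k : fieldType) (gT : finGroupType) (G : {group gT}).
Variables (P Q : gcomplex k gT) (a : gmap k P Q) (N : nat).
Variables (eps : gform k P) (e : gform k Q).
Hypotheses (augP : augmented G 0 eps) (pP : degreewise_projective G P).
Hypotheses (augQ : augmented G N e) (pQ : degreewise_projective G Q).
Hypotheses (ha : homd 0 1 a) (eqa : equivariant G a).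
Hypothesis da : forall i j l,
  cdiff P i j *m a j l + a i j *m cdiff Q j l = 0.
Variables (Delta : gmap k P (tens P P)) (Delta1 : gmap k Q (tens Q P)).
Variable (Delta2 : gmap k Q (tens P Q)).
Hypothesis covD : covers G Delta eps (ftens eps eps).
Hypothesis covD1 : covers G Delta1 e (ftens e eps).
Hypothesis covD2 : covers G Delta2 e (ftens eps e).
Variable psi : gmap k (ext a) (ext2 a).
Hypothesis psi_chain : chain_map G psi.
Hypothesis psi_ext : extends_diagonals Delta Delta1 Delta2 psi.

Let cP := aug_complex augP.
Let cQ := aug_complex augQ.
Let iP := @gid_homd k P.
Let iQ := @gid_homd k Q.

(** The representative e α of ζ; any other one differs from it by a
coboundary. *)
Definition zeta : gform k P := dpull 0 1 a e.

Lemma zetaE i : zeta i = a i i.-1 *m e i.-1.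
Proof. by rewrite /zeta dpull01; case: i => //=; rewrite ha ?mul0mx. Qed.

Lemma zeta_conc : concentrated N.+1 zeta.
Proof.
case=> [|i] ne; rewrite zetaE; first by rewrite ha ?mul0mx.
by rewrite /= (aug_conc augQ) ?mulmx0.
Qed.

Lemma zeta_cocycle : cocycle G zeta.
Proof.
split=> [g i Gg|i]; rewrite zetaE.
  by rewrite mulmxA eqa // -mulmxA (aug_inv augQ).
rewrite mulmxA /=; have /eqP := da i.+1 i i.-1; rewrite addr_eq0 => /eqP->.
case: i => [|i]; first by rewrite (complex_deg cQ) ?mulmx0 ?oppr0 ?mul0mx.
by rewrite mulNmx -mulmxA (aug_closed augQ) mulmx0 oppr0.
Qed.

(** The two components of ψ that the diagonals do not determine. *)
Definition psi_QP : gmap k P (tens Q P) := fun i j =>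
  lsubmx (dlsubmx (psi i j : 'M_(Q i + P i,
    (tens Q P j + tens P Q j) + tens P P j))).
Definition psi_PQ : gmap k P (tens P Q) := fun i j =>
  rsubmx (dlsubmx (psi i j : 'M_(Q i + P i,
    (tens Q P j + tens P Q j) + tens P P j))).

Lemma psi_block i : psi i i = block_mx (row_mx (Delta1 i i) (Delta2 i i)) 0
  (row_mx (psi_QP i i) (psi_PQ i i)) (Delta i i).
Proof.
have [e1 e2 e3] := psi_ext i.
by rewrite /psi_QP /psi_PQ hsubmxK -e1 -e2 -e3 submxK.
Qed.

(** That ψ is a chain map means that ψ_QP is a homotopy between Δ1 α and
(α × 1) Δ, and ψ_PQ one between Δ2 α and (1 × α) Δ. *)
Lemma psi_diff i :
  cdiff P i.+1 i *m psi_QP i i = psi_QP i.+1 i.+1 *m cdiff (tens Q P) i.+1 i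
    + Delta i.+1 i.+1 *m gtens a (gid P) i.+1 i - a i.+1 i *m Delta1 i i
  /\ cdiff P i.+1 i *m psi_PQ i i = psi_PQ i.+1 i.+1 *m cdiff (tens P Q) i.+1 i
    + Delta i.+1 i.+1 *m gtens (gid P) a i.+1 i - a i.+1 i *m Delta2 i i.
Proof.
have [_ _ ch] := psi_chain; have := ch i; rewrite !psi_block.
pose dQP := cdiff (tens Q P) i.+1 i; pose dPQ := cdiff (tens P Q) i.+1 i.
pose A := gtens a (gid P) i.+1 i; pose B := gtens (gid P) a i.+1 i.
move=> E.
have {}E : block_mx (cdiff Q i.+1 i) 0 (a i.+1 i) (cdiff P i.+1 i)
    *m block_mx (row_mx (Delta1 i i) (Delta2 i i)) 0
         (row_mx (psi_QP i i) (psi_PQ i i)) (Delta i i)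
  = block_mx (row_mx (Delta1 i.+1 i.+1) (Delta2 i.+1 i.+1)) 0
     (row_mx (psi_QP i.+1 i.+1) (psi_PQ i.+1 i.+1)) (Delta i.+1 i.+1)
    *m block_mx (block_mx dQP 0 0 dPQ) 0 (row_mx A B) (cdiff (tens P P) i.+1 i).
  exact: E.
move: E; rewrite !mulmx_block => /eq_block_mx[_ _ E _].
move: E; rewrite mul_row_block !mul_mx_row !mulmx0 addr0 add0r !add_row_mx.
by move=> /eq_row_mx[<- <-]; rewrite ![_ + _ - _]addrC !addKr.
Qed.

Lemma psi_components_equi : equivariant G psi_QP /\ equivariant G psi_PQ.
Proof.
have [_ eqp _] := psi_chain.
suff H g i j : g \in G ->
    cact P i g *m psi_QP i j = psi_QP i j *m cact (tens Q P) j g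
    /\ cact P i g *m psi_PQ i j = psi_PQ i j *m cact (tens P Q) j g.
  by split=> g i j Gg; have [] := H g i j Gg.
move=> Gg; have := eqp g i j Gg; rewrite /psi_QP /psi_PQ.
move: (psi i j : 'M_(Q i + P i, (tens Q P j + tens P Q j) + tens P P j)) => X E.
have {}E : block_mx (cact Q i g) 0 0 (cact P i g) *m X
  = X *m block_mx (block_mx (cact (tens Q P) j g) 0 0 (cact (tens P Q) j g)) 0 0
             (cact (tens P P) j g) by exact: E.
rewrite -[X]submxK -[dlsubmx X]hsubmxK in E.
move: E; rewrite !mulmx_block => /eq_block_mx[_ _ E _].
move: E; rewrite mul_row_block !mul_mx_row !mulmx0 !mul0mx !addr0 !add0r.
by move=> /eq_row_mx[].
Qed.

Lemma swap_defect_identity (m n : nat)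
    (u s p w s2 q y1 y2 m1 m2 : 'M[k]_(m, n)) :
  y1 + y2 = p - q -> m2 + m1 = s - s2 ->
  (u + s - p) - (w + s2 - q) + y2 - m1 = u - w - y1 - - m2.
Proof.
move=> h1 h2; have -> : y2 = p - q - y1 by rewrite -h1 addrC addKr.
have -> : m1 = s - s2 - m2 by rewrite -h2 addrC addKr.
by apply/matrixP=> i j; rewrite !mxE; ring.
Qed.

(* Homotopies that exchange the two factors of the diagonals.  The orders of
   Y and of its boundary are those of Δ1 - T Δ2 and of Δ - T Δ. *)
Variables (Y : gmap k Q (tens Q P)) (Y0 : gmap k P (tens P P)).
Hypothesis eqY : equivariant G Y.
Hypothesis YE : forall i, Delta1 i i - Delta2 i i *m swap P Q i i
  = Y i i.+1 *m cdiff (tens Q P) i.+1 i + cdiff Q i i.-1 *m Y i.-1 i.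
Hypothesis eqY0 : equivariant G Y0.
Hypothesis Y0E : forall i, Delta i i - Delta i i *m swap P P i i
  = Y0 i i.+1 *m cdiff (tens P P) i.+1 i + cdiff P i i.-1 *m Y0 i.-1 i.

(** The homotopies ψ_QP and T ψ_PQ both connect a diagonal of Q after α with Δ
followed by α on one factor, and Y α and (α × 1) Y0 join their ends, so that
the four homotopies form a closed square, which is a chain map. *)
Definition swap_defect : gmap k P (tens Q P) := fun i j =>
  psi_QP i j - psi_PQ i j *m swap P Q j j - a i i.-1 *m Y i.-1 j
  - Y0 i i.+1 *m gtens a (gid P) i.+1 j.

Lemma swap_defect_chain i :
  cdiff P i.+1 i *m swap_defect i i
    = swap_defect i.+1 i.+1 *m cdiff (tens Q P) i.+1 i.
Proof.
have [h1 h2] := psi_diff i.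
have hB : gtens (gid P) a i.+1 i *m swap P Q i i
    = swap P P i.+1 i.+1 *m gtens a (gid P) i.+1 i.
  by rewrite (gtens_swap iP ha) ?simpdeg //; lia.
have hA : gtens a (gid P) i.+2 i.+1 *m cdiff (tens Q P) i.+1 i
    = - (cdiff (tens P P) i.+2 i.+1 *m gtens a (gid P) i.+1 i).
  have ca := alpha_gchain cP ha da.
  rewrite (diff_gtens cP cP cQ cP ha iP ca (gid_gchain cP)); last by lia.
  by rewrite !simpdeg scaleN1r opprK.
rewrite /swap_defect /= !mulmxBr !mulmxBl -!mulmxA hA mulmxN.
rewrite -(swap_chain _ cP cQ) mulmxA h1.
rewrite [X in _ - X - _ - _ = _]mulmxA h2.
have /eqP := da i.+1 i i.-1; rewrite addr_eq0 => /eqP da'.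
rewrite [X in _ - _ - X - _ = _]mulmxA da' mulNmx opprK.
rewrite !mulmxBl mulmxDl -!mulmxA (swap_chain _ cP cQ) hB.
apply: swap_defect_identity.
  by rewrite -mulmxBr YE; exact: (esym (mulmxDr _ _ _)).
rewrite [in LHS]mulmxA [X in _ + X]mulmxA.
rewrite -(mulmxDl (Y0 i.+1 i.+2 *m _)).
by move: (Y0E i.+1) => /= <-; rewrite mulmxBl mulmxA.
Qed.

Lemma swap_defect_equi : equivariant G swap_defect.
Proof.
have [eq1 eq2] := psi_components_equi => g i j Gg.
have eqA := gtens_equi eqa (gid_equi cP).
rewrite /swap_defect !mulmxBr !mulmxBl eq1 //; congr (_ - _ - _ - _).
- by rewrite mulmxA eq2 // -!mulmxA (swap_equi P Q j Gg).
- by rewrite mulmxA eqa // -!mulmxA eqY.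
by rewrite mulmxA eqY0 // -!mulmxA eqA.
Qed.

(** This is the homotopy ψ_PQ between (1 × α) Δ and Δ2 α, evaluated on
xi × e. *)
Lemma cup_zeta_exact (xi : gform k P) i : cocycle G xi ->
  exact_cochain G (Delta i.+1 i.+1 *m ftens xi zeta i.+1
                   - a i.+1 i *m (Delta2 i i *m ftens xi e i)).
Proof.
move=> cxi; have [_ h2] := psi_diff i.
have [_ eq2] := psi_components_equi.
have [iF dF] := ftens_cocycle cP cQ (aug_conc augQ) cxi (aug_cocycle augQ).
apply: (exact_cochainI (b := psi_PQ i i *m ftens xi e i)).
  apply: (invariant_equi (C := P) (D := tens P Q)) => //.
  by move=> g Gg; exact: iF.
rewrite [in RHS]mulmxA h2 mulmxBl mulmxDl -!mulmxA dF mulmx0 add0r.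
rewrite (gtens_mul_ftens iP ha (aug_conc augQ)); last by lia.
rewrite !simpdeg; congr (_ *m _ - _); apply: eq_ftens => // y.
by rewrite dpull00 gid1 mul1mx.
Qed.

Let augQP : augmented G N (ftens e eps : gform k (tens Q P)).
Proof. by have := tens_augmented augQ augP; rewrite addn0. Qed.

Let closed_e_zeta : cocycle G (ftens e zeta : gform k (tens Q P)) :=
  ftens_cocycle cQ cP zeta_conc (aug_cocycle augQ) zeta_cocycle.

(** A chain map from P to Q ⊗ P is determined up to homotopy by the class of
degree N that it induces, so [swap_defect] is homotopic to (x × 1) Δ for a chain
map x that lifts a representative xi of that class; F then pulls back to the
cup product of xi and ζ. *)
Lemma swap_defect_cup : exists xi : gform k P,
  [/\ cocycle G xi, concentrated N xi
    & exact_cochain G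
        (swap_defect (N + N)%N.+1 (N + N)%N.+1 *m ftens e zeta (N + N)%N.+1
        - Delta (N + N)%N.+1 (N + N)%N.+1 *m ftens xi zeta (N + N)%N.+1)].
Proof.
have [[_ eqD chD] _] := covD.
pose c : 'cV_(P N) := swap_defect N N *m ftens e eps N.
have ic : invariant G c.
  apply: (invariant_equi (C := P) (D := tens Q P)); first exact: swap_defect_equi.
  by move=> g Gg; exact: (aug_inv augQP).
have dc : cdiff P N.+1 N *m c = 0.
  by rewrite mulmxA swap_defect_chain -mulmxA (aug_closed augQP) mulmx0.
have ss : (-1) ^+ (N + N) * (-1) ^+ (N + N) = 1 :> k.
  by rewrite -expr2 sqrr_sign.
have [xt [hx eqx xe chx]] := lift_cocycle ss cP pP augQ ic dc.
have gx := lift_gchain cP cQ (aug_low augQ) hx chx.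
pose xi := single c.
have cxi : cocycle G xi by exact: single_cocycle cP ic dc.
have dxi i : dpull N N xt e i = xi i.
  rewrite /dpull leq_addl addnK; have [->|ne] := eqVneq i N.
    by rewrite xe /xi single_at.
  by rewrite (aug_conc augQ) // mulmx0 /xi single_conc.
exists xi; split; [exact: cxi|exact: single_conc|].
have cupE (b : gform k P) w i : (forall i, i != w -> b i = 0) ->
    gtens xt (gid P) i i *m ftens e b i = ftens xi b i.
  move=> hb; rewrite (gtens_mul_ftens hx iP hb); last by lia.
  rewrite -signr_odd oddM addnn odd_double expr0 scale1r.
  by apply: eq_ftens => // y; rewrite dpull00 gid1 mul1mx.
pose f : gmap k P (tens Q P) := fun i j =>
  swap_defect i j - Delta i i *m gtens xt (gid P) i j.
rewrite -(cupE _ _ _ zeta_conc) mulmxA -mulmxBl.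
have one : 1 * 1 = 1 :> k by rewrite mulr1.
apply: (exact_pullback (f := f) (j := N) (i := N.+1) one cP pP augQP).
- move=> g i j Gg; rewrite /f mulmxBr mulmxBl swap_defect_equi //; congr (_ - _).
  by rewrite mulmxA eqD // -!mulmxA (gtens_equi eqx (gid_equi cP)).
- move=> i; rewrite scale1r /f mulmxBr mulmxBl swap_defect_chain; congr (_ - _).
  rewrite mulmxA chD -!mulmxA; congr (_ *m _).
  rewrite (diff_gtens cP cP cQ cP hx iP gx (gid_gchain cP)) //.
  by rewrite !simpdeg -signr_odd addnn odd_double scale1r.
- rewrite /f mulmxBl -mulmxA (cupE _ _ _ (aug_conc augP)) -[X in X - _]/c.
  have := cup_unit augP N pP augP covD cxi; rewrite addn0 /xi single_at.
  by move/exact_cochainN; rewrite opprB.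
- by move=> g Gg; exact: closed_e_zeta.1.
exact: closed_e_zeta.2.
Qed.

Lemma alpha_exact i (c : 'cV[k]_(Q i)) :
  exact_cochain G c -> exact_cochain G (a i.+1 i *m c).
Proof.
case=> b ib ->; apply: (exact_cochainI (b := - (a i i.-1 *m b))).
  by apply: invariantN; exact: invariant_equi.
rewrite mulmxN !mulmxA; have /eqP := da i.+1 i i.-1.
by rewrite addr_eq0 => /eqP->; rewrite mulNmx opprK.
Qed.

(** Let σ : P -> Q, of degree N, lift the augmentation of P.  Pulling back
along σ shifts a class xiQ of degree 2N on Q to a class xi of degree N on P.
Up to sign (1 × σ) Δ1 α and (σ × α) Δ are chain maps from P to Q ⊗ Q of the
same degree that induce the same class in the lowest degree, by
[cup_zeta_exact]; evaluating both on xiQ × e gives the claim. *)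
Lemma pullback_cup (xiQ : gform k Q) : cocycle G xiQ ->
  concentrated (N + N) xiQ -> exists xi : gform k P,
  [/\ cocycle G xi, concentrated N xi
    & exact_cochain G (a (N + N)%N.+1 (N + N)%N *m xiQ (N + N)%N
        - Delta (N + N)%N.+1 (N + N)%N.+1 *m ftens xi zeta (N + N)%N.+1)].
Proof.
move=> cxiQ hxiQ; have [[_ eqD chD] _] := covD.
have [[_ eqD1 chD1] De1] := covD1; have [_ De2] := covD2.
have ss : (-1) ^+ (N + 0) * (-1) ^+ (N + 0) = 1 :> k.
  by rewrite -expr2 sqrr_sign.
have [sg [hs eqs se chs]] := lift_cocycle (c := eps 0%N) ss cP pP augQ
  (fun g Gg => aug_inv augP 0%N Gg) (aug_closed augP 0).
have gs := lift_gchain cP cQ (aug_low augQ) hs chs.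
have ds i : dpull N 0 sg e i = eps i.
  rewrite /dpull subn0; case: i => [|i]; first exact: se.
  rewrite (aug_conc augQ) ?(aug_conc augP) ?mulmx0 //.
  by rewrite -[X in _ != X]add0n eqn_add2r.
pose xi := dpull N 0 sg xiQ.
have xiE i : xi i = sg i (i + N)%N *m xiQ (i + N)%N by rewrite /xi /dpull subn0.
have cxi : cocycle G xi.
  split=> [g i Gg|i]; rewrite xiE; first by rewrite mulmxA eqs // -mulmxA cxiQ.1.
  have := chs i; rewrite !addn0 => chi.
  by rewrite mulmxA chi -scalemxAl -mulmxA cxiQ.2 mulmx0 scaler0.
have hxi : concentrated N xi.
  by move=> i ne; rewrite xiE hxiQ ?mulmx0 // eqn_add2r.
exists xi; split=> //.
pose G1 : gmap k P (tens Q Q) := fun i j =>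
  a i i.-1 *m (Delta1 i.-1 i.-1 *m gtens (gid Q) sg i.-1 j).
pose G2 : gmap k P (tens Q Q) := fun i j => Delta i i *m gtens sg a i j.
pose F : gmap k P (tens Q Q) := fun i j => G1 i j - (-1) ^+ N *: G2 i j.
have FE (b : gform k Q) i m : (i + N = m)%N ->
    F i.+1 m *m ftens b e m = a i.+1 i *m (Delta1 i i *m ftens b eps i)
     - Delta i.+1 i.+1 *m ftens (dpull N 0 sg b) zeta i.+1.
  move=> im; rewrite /F mulmxBl -scalemxAl /G1 /G2 -!mulmxA.
  rewrite (gtens_mul_ftens iQ hs (aug_conc augQ)); last by lia.
  rewrite (gtens_mul_ftens hs ha (aug_conc augQ)); last by lia.
  rewrite !simpdeg -scalemxAr scalerA -exprD -mulnS -signr_odd oddM andbN expr0.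
  rewrite scale1r /= (@eq_ftens _ _ _ _ b _ eps) // => y.
  by rewrite dpull00 gid1 mul1mx.
have augQQ := tens_augmented augQ augQ.
have [iF dF] := ftens_cocycle cQ cQ (aug_conc augQ) cxiQ (aug_cocycle augQ).
have ss1 : (-1) ^+ N.+1 * (-1) ^+ N.+1 = 1 :> k by rewrite -expr2 sqrr_sign.
have := exact_pullback (f := F) (j := N.+1) (i := N) ss1 cP pP augQQ _ _ _
  (fun g Gg => iF g (N + (N + N))%N Gg) (dF _).
rewrite addnS (FE xiQ (N + N)%N); last by lia.
have unit1 := alpha_exact (cup_unit augP N pQ augQ covD1 cxiQ).
rewrite mulmxBr in unit1.
move=> H; have {}H := exact_cochainB (H _ _ _) unit1.
have -> : a (N + N).+1 (N + N)%N *m xiQ (N + N)%N -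
     Delta (N + N).+1 (N + N).+1 *m ftens xi zeta (N + N).+1
  = a (N + N).+1 (N + N)%N *m
       (Delta1 (N + N)%N (N + N)%N *m ftens xiQ eps (N + N)%N) -
       Delta (N + N).+1 (N + N).+1 *m ftens (dpull N 0 sg xiQ) zeta (N + N).+1 -
       (a (N + N).+1 (N + N)%N *m
        (Delta1 (N + N)%N (N + N)%N *m ftens xiQ eps (N + N)%N) -
        a (N + N).+1 (N + N)%N *m xiQ (N + N)%N).
  by apply/esym; rewrite opprB addrC subrKA.
apply: H.
- move=> g i j Gg; rewrite /F mulmxBr mulmxBl -scalemxAl -scalemxAr.
  rewrite /G1 /G2; congr (_ - _ *: _).
    rewrite !mulmxA eqa // -!mulmxA; congr (_ *m _).
    by rewrite mulmxA eqD1 // -!mulmxA (gtens_equi (gid_equi cQ) eqs).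
  by rewrite mulmxA eqD // -!mulmxA (gtens_equi eqs eqa).
- move=> i; rewrite addnS; set y := (i + (N + N))%N.
  rewrite /F mulmxBr mulmxBl -!scalemxAl -!scalemxAr scalerBr.
  congr (_ - _).
    rewrite /G1 /= !mulmxA.
    have /eqP := da (i + N).+2 (i + N).+1 (i + N)%N; rewrite addr_eq0 => /eqP->.
    rewrite !mulNmx -!mulmxA [X in - (_ *m X)]mulmxA chD1 -!mulmxA.
    rewrite (diff_gtens (m := y) cQ cP cQ cQ iQ hs (gid_gchain cQ) gs);
      last by rewrite /y; lia.
    by rewrite -!scalemxAr -scaleNr !simpdeg exprS mulN1r.
  rewrite /G2 scalerA mulrC -scalerA; congr (_ *: _).
  rewrite mulmxA chD -!mulmxA.
  rewrite (diff_gtens (m := y) cP cP cQ cQ hs ha gs (alpha_gchain cP ha da));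
    last by rewrite /y; lia.
  by rewrite -!scalemxAr !simpdeg addn1.
rewrite FE //.
have -> : Delta1 N N *m ftens e eps N = e N by have := De1 N.
rewrite (eq_ftens _ ds (fun i => erefl _)).
have := cup_zeta_exact N (aug_cocycle augP).
have -> : Delta2 N N *m ftens eps e N = e N by have := De2 N.
by move/exact_cochainN; rewrite opprB.
Qed.

Hypothesis sgn : (-1) ^+ N.+1 = 1 :> k.

Let F := ftens e zeta (N + N)%N.+1.
Let eta : 'cV[k]_(Q (N + N)) := Y (N + N)%N (N + N)%N.+1 *m F.

(** The component on Q is F (Δ1 - T Δ2), which Y turns into a boundary.  On P
the definition of [swap_defect] is solved for ψ_QP - T ψ_PQ, and
(α × 1) turns F = e × z into z × z. *)
Lemma obstruction_split : obstruction N e psi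
  = col_mx (cdiff Q (N + N)%N.+1 (N + N)%N *m eta)
      (swap_defect (N + N)%N.+1 (N + N)%N.+1 *m F
       + a (N + N)%N.+1 (N + N)%N *m eta + cup_one_sq N Y0 zeta).
Proof.
have sgnN : (-1) ^+ N = -1 :> k.
  by move: sgn; rewrite exprS mulN1r => /eqP; rewrite eqr_oppLR => /eqP.
have E1 : gtens (gid Q) a (N + N)%N.+1 (N + N)%N *m ftens e e (N + N)%N = F.
  rewrite (gtens_mul_ftens iQ ha (aug_conc augQ)); last by lia.
  by rewrite !simpdeg; apply: eq_ftens => // y; rewrite dpull00 gid1 mul1mx.
have E2 : gtens a (gid Q) (N + N)%N.+1 (N + N)%N *m ftens e e (N + N)%N
    = - (swap P Q (N + N)%N.+1 (N + N)%N.+1 *m F).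
  rewrite (gtens_mul_ftens ha iQ (aug_conc augQ)); last by lia.
  have s1 : (-1) ^+ (N * N.+1) = 1 :> k by rewrite -signr_odd oddM andbN.
  rewrite (swap_ftens _ (aug_conc augQ) zeta_conc) s1 !simpdeg sgnN scaleN1r.
  congr (- _).
  by apply: eq_ftens => // y; rewrite dpull00 gid1 mul1mx.
have dF : cdiff (tens Q P) (N + N)%N.+2 (N + N)%N.+1 *m F = 0.
  exact: closed_e_zeta.2.
rewrite /obstruction psi_block /ext_kappa !mul_col_mx mul0mx E1 E2.
rewrite !mul_row_col mul0mx !mulmx0 !addr0 !mulmxN.
apply: (congr2 col_mx).
  rewrite mulmxA -mulmxBl YE mulmxDl -mulmxA dF mulmx0 add0r.
  by rewrite /eta mulmxA.
rewrite /swap_defect !mulmxBl /cup_one_sq /eta -!mulmxA.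
have -> : gtens a (gid P) (N + N)%N.+2 (N + N)%N.+1 *m F
    = ftens zeta zeta (N + N)%N.+2.
  rewrite /F (gtens_mul_ftens ha iP zeta_conc); last by lia.
  rewrite !simpdeg sgn scale1r; apply: eq_ftens => // y.
  by rewrite dpull00 gid1 mul1mx.
by rewrite [RHS]addrAC !subrK.
Qed.

Lemma exact_cochain_ext i (wQ : 'cV_(Q i.+1)) (wP : 'cV_(P i.+1)) :
  @exact_cochain k gT G (ext a) i.+1 (col_mx wQ wP) <->
  exists bQ bP, [/\ invariant G bQ, invariant G bP,
    wQ = cdiff Q i.+1 i *m bQ & wP = a i.+1 i *m bQ + cdiff P i.+1 i *m bP].
Proof.
split=> [[b ib] | [bQ [bP [iQb iPb -> ->]]]].
  move: b ib; rewrite -[ext a i.+1.-1]/(Q i + P i)%N => b.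
  rewrite -[b]vsubmxK => ib E; exists (usubmx b), (dsubmx b).
  have {}E : col_mx wQ wP = block_mx (cdiff Q i.+1 i) 0 (a i.+1 i)
    (cdiff P i.+1 i) *m col_mx (usubmx b) (dsubmx b) by exact: E.
  move: E; rewrite mul_block_col mul0mx addr0 => /eq_col_mx[-> ->].
  have {}ib g : g \in G -> cact Q i g *m usubmx b = usubmx b
      /\ cact P i g *m dsubmx b = dsubmx b.
    move=> Gg; have E : block_mx (cact Q i g) 0 0 (cact P i g)
      *m col_mx (usubmx b) (dsubmx b) = col_mx (usubmx b) (dsubmx b).
      exact: ib Gg.
    by move: E; rewrite mul_block_col !mul0mx addr0 add0r => /eq_col_mx.
  by split=> // g Gg; have [] := ib g Gg.
exists (col_mx bQ bP : 'cV_(ext a i)).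
  move=> g Gg; apply: (etrans (mul_block_col (cact Q i g) 0 0 (cact P i g) bQ bP)).
  by rewrite !mul0mx addr0 add0r iQb // iPb.
apply: esym; apply: (etrans (mul_block_col (cdiff Q i.+1 i) 0 (a i.+1 i)
  (cdiff P i.+1 i) bQ bP)).
by rewrite mul0mx addr0.
Qed.

(** In a cochain (bQ, bP) that bounds the obstruction, bQ - eta is a cocycle of
degree 2N on Q.  By [pullback_cup] it contributes a multiple of ζ on P, and so
does [swap_defect]; conversely [cup_zeta_exact] produces bQ from a given
multiple. *)
Theorem lifts_iff_cup_one : lifts G psi <-> exists xi : gform k P,
  [/\ cocycle G xi, concentrated N xi
    & exact_cochain G (cup_one_sq N Y0 zeta
        - Delta (N + N)%N.+1 (N + N)%N.+1 *m ftens xi zeta (N + N)%N.+1)].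
Proof.
rewrite (lifts_iff cP pP pQ augQ ha eqa da psi_chain) obstruction_split.
rewrite exact_cochain_ext.
have [xi1 [cxi1 hxi1 ex1]] := swap_defect_cup; rewrite -/F in ex1.
have ieta : invariant G eta.
  apply: (invariant_equi (C := Q) (D := tens Q P)) => //.
  by move=> g Gg; exact: closed_e_zeta.1.
have ftensB (x y : gform k P) i :
    ftens (fun j => x j - y j) zeta i = ftens x zeta i - ftens y zeta i.
  rewrite ftensDl; congr (_ + _); rewrite -scaleN1r -ftensZl.
  by apply: eq_ftens => // j; rewrite scaleN1r.
have cocB (C : gcomplex k gT) (x y : gform k C) :
    cocycle G x -> cocycle G y -> cocycle G (fun j => x j - y j).
  move=> [ix dx] [iy dy]; split=> [g i Gg|i].
    by rewrite mulmxBr ix ?iy.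
  by rewrite mulmxBr dx dy subr0.
split.
  move=> [bQ [bP [ibQ ibP EQ EP]]].
  pose xiQ := single (bQ - eta).
  have cxiQ : cocycle G xiQ.
    apply: single_cocycle cQ _ _; last by rewrite mulmxBr EQ subrr.
    by apply: invariantD => //; exact: invariantN.
  have [xi2 [cxi2 hxi2 ex2]] := pullback_cup cxiQ (single_conc _).
  rewrite /xiQ single_at in ex2.
  exists (fun j => xi2 j - xi1 j); split; [exact: cocB| |].
    by move=> i ne; rewrite hxi1 // hxi2 // subr0.
  rewrite ftensB mulmxBr.
  have ex3 : exact_cochain G (cdiff P (N + N)%N.+1 (N + N)%N *m bP).
    by exists bP.
  have := exact_cochainD (exact_cochainB ex2 ex1) ex3.
  set X := swap_defect _ _ *m F in EP *; set A := Delta _ _ *m _.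
  set B := Delta _ _ *m ftens xi1 _ _.
  have -> : cdiff P (N + N)%N.+1 (N + N)%N *m bP
    = X + a (N + N)%N.+1 (N + N)%N *m eta + cup_one_sq N Y0 zeta
      - a (N + N)%N.+1 (N + N)%N *m bQ by rewrite EP addrC addKr.
  rewrite mulmxBr; congr (exact_cochain _ _).
  clear EP; move: X A B (a _ _ *m bQ) (a _ _ *m eta) (cup_one_sq _ _ _).
  move=> X A B u v w.
  by apply/matrixP=> i j; rewrite !mxE; ring.
move=> [xi [cxi hxi ex]].
pose xi' : gform k P := fun j => xi j - (- 1) *: xi1 j.
have cxi' : cocycle G xi'.
  apply: cocB => //; case: cxi1 => ix dx; split=> [g i Gg|i].
    by rewrite -scalemxAr ix.
  by rewrite -scalemxAr dx scaler0.
pose beta := Delta2 (N + N)%N (N + N)%N *m ftens xi' e (N + N)%N.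
have [iF dF] := ftens_cocycle cP cQ (aug_conc augQ) cxi' (aug_cocycle augQ).
have [[_ eqD2 chD2] _] := covD2.
have ibeta : invariant G beta.
  apply: (invariant_equi (C := Q) (D := tens P Q)) => //.
  by move=> g Gg; exact: iF.
have dbeta : cdiff Q (N + N)%N.+1 (N + N)%N *m beta = 0.
  by rewrite mulmxA chD2 -mulmxA dF mulmx0.
have ex2 := cup_zeta_exact (N + N)%N cxi'.
have [b ib Eb] := exact_cochainD (exact_cochainD ex ex1) ex2.
exists (eta + beta), b; split=> //; first exact: invariantD.
  by rewrite mulmxDr dbeta addr0.
have <- := Eb; rewrite mulmxDr -/beta.
have -> : ftens xi' zeta (N + N)%N.+1
    = ftens xi zeta (N + N)%N.+1 + ftens xi1 zeta (N + N)%N.+1.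
  rewrite ftensB ftensZl scaleN1r opprK //.
rewrite mulmxDr.
move: (swap_defect _ _ *m F) (Delta _ _ *m ftens xi _ _)
  (Delta _ _ *m ftens xi1 _ _)
  (a _ _ *m beta) (a _ _ *m eta) (cup_one_sq _ _ _) => X A B u v w.
by apply/matrixP=> i j; rewrite !mxE; ring.
Qed.

End Reduction.

(** * Extension of scalars *)
Section BaseChangeFacts.

Variables (F k : fieldType) (iota : {rmorphism F -> k}).
Variables (gT : finGroupType) (G : {group gT}).
Implicit Types C : gcomplex F gT.

Definition map_gmap (p q : nat -> nat) (f : gmap F p q) : gmap k p q :=
  fun i j => map_mx iota (f i j).

Lemma map_gtens (p q p' q' : nat -> nat) (f : gmap F p p') (g : gmap F q q')
    n m :
  map_mx iota (gtens f g n m) = gtens (map_gmap f) (map_gmap g) n m.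
Proof.
apply/matrixP=> i j; rewrite !mxE rmorphM rmorphXn rmorphN rmorph1 rmorphM.
by [].
Qed.

Lemma map_ftens (p q : nat -> nat) (b : gform F p) (c : gform F q) n :
  map_mx iota (ftens b c n)
    = ftens (fun i => map_mx iota (b i)) (fun i => map_mx iota (c i)) n.
Proof.
apply/matrixP=> i j; rewrite !mxE rmorphM rmorphXn rmorphN rmorph1 rmorphM.
by [].
Qed.

Lemma map_gid p i j : map_mx iota (gid p i j : 'M[F]_(p i, p j)) = gid p i j.
Proof. by rewrite /gid; case: eqP => _; rewrite ?map_pid_mx ?map_mx0. Qed.

Lemma map_swap p q n m :
  map_mx iota (swap p q n m) = swap p q n m :> 'M[k]_(tdim p q n, tdim q p m).
Proof.
apply/matrixP=> i j; rewrite !mxE; case: ifP => _; rewrite !mxE ?rmorph0 //.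
by rewrite rmorphM rmorphXn rmorphN rmorph1 rmorph_nat.
Qed.

Lemma map_tens_diff C n m :
  map_mx iota (cdiff (tens C C) n m)
    = cdiff (tens (base_change iota C) (base_change iota C)) n m.
Proof.
rewrite /= map_mxD !map_gtens; congr (_ + _); apply: eq_gtens => // i j;
exact: map_gid.
Qed.

Lemma map_tens_act C n g :
  map_mx iota (cact (tens C C) n g)
    = cact (tens (base_change iota C) (base_change iota C)) n g.
Proof.
transitivity (\mxblock_(a < n.+1, b < n.+1) map_mx iota (if a == b
  then conform_mx (0 : 'M[F]_(C a * C (n - a)%N, C b * C (n - b)%N))
         (cact C a g *t cact C (n - a)%N g) else 0)).
  by apply/matrixP=> i j; rewrite !mxE.
apply: eq_mxblock => a b; case: eqP => [e|_]; last by rewrite map_mx0.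
by case: b / e; rewrite !conform_mx_id map_mxT.
Qed.

Lemma base_change_complex C : is_complex G C -> is_complex G (base_change iota C).
Proof.
case=> rC degC eqC ddC; split=> [i|i j ne|g i j Gg|i j l] /=.
- have [r1 rM] := rC i; split=> [|x y Gx Gy]; first by rewrite r1 map_mx1.
  by rewrite rM // map_mxM.
- by rewrite degC // map_mx0.
- by rewrite -!map_mxM eqC.
by rewrite -map_mxM ddC map_mx0.
Qed.

Lemma base_change_augmented C (e : gform F C) :
  augmented G 0 e -> augmented G 0 (base_change_form iota e).
Proof.
case=> cC low conc inv onto ex0 ex; split=> //.
- exact: base_change_complex.
- by move=> i ne; rewrite /base_change_form conc ?map_mx0.
- by move=> g i Gg; rewrite /base_change_form /= -map_mxM inv.
- by rewrite /base_change_form row_full_map.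
- by rewrite /base_change_form /= -map_kermx !map_submx.
by move=> i; rewrite /= -map_kermx !map_submx.
Qed.

Lemma base_change_cocycle C (c : gform F C) : cocycle G c ->
  cocycle G (base_change_form iota c).
Proof.
case=> ic dc; split=> [g i Gg|i]; rewrite /base_change_form /= -map_mxM.
  by rewrite ic.
by rewrite dc map_mx0.
Qed.

End BaseChangeFacts.

(** * Naturality of the cup-one square *)
Section Comparison.

Variables (k : fieldType) (gT : finGroupType) (G : {group gT}).
Variables (P : gcomplex k gT) (eps : gform k P).
Hypotheses (augP : augmented G 0 eps) (pP : degreewise_projective G P).
Variables (Delta Y0 : gmap k P (tens P P)).
Hypothesis covD : covers G Delta eps (ftens eps eps).
Hypothesis eqY0 : equivariant G Y0.
Hypothesis Y0E : forall i, Delta i i - Delta i i *m swap P P i i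
  = Y0 i i.+1 *m cdiff (tens P P) i.+1 i + cdiff P i i.-1 *m Y0 i.-1 i.

Variables (P' : gcomplex k gT) (eps' : gform k P').
Hypothesis augP' : augmented G 0 eps'.
Variables (D0 D1 : gmap k P' (tens P' P')).
Hypothesis covD0 : covers G D0 eps' (ftens eps' eps').
Hypothesis eqD1 : equivariant G D1.
Hypothesis D1E : forall i, D0 i i - D0 i i *m swap P' P' i i
  = D1 i i.+1 *m cdiff (tens P' P') i.+1 i + cdiff P' i i.-1 *m D1 i.-1 i.
Variable theta : gmap k P P'.
Hypothesis covtheta : covers G theta eps eps'.

Let cP := aug_complex augP.
Let cP' := aug_complex augP'.
Let augPP : augmented G 0 (ftens eps' eps' : gform k (tens P' P')).
Proof. by have := tens_augmented augP' augP'; rewrite addn0. Qed.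

(** Let K be a homotopy from D0 θ to (θ × θ) Δ.  Then
(θ × θ) Y0 - D1 θ - (1 - T) K anticommutes with d and has degree 1, so it kills
classes; and 1 - T kills u × u because u has even degree or 2 = 0. *)
Lemma cup_one_natural (u : gform k P') (w : nat) i :
  cocycle G u -> concentrated w u -> (-1) ^+ w = 1 :> k ->
  let v : gform k P := fun i => theta i i *m u i in
  exact_cochain G (Y0 i i.+1 *m ftens v v i.+1
                   - theta i i *m (D1 i i.+1 *m ftens u u i.+1)).
Proof.
move=> cu hu sgn v.
have [[hD eqD chD] De] := covD; have [[hD0 eqD0 chD0] D0e] := covD0.
have [[ht eqt cht] te] := covtheta.
have homt : homd 0 0 theta by move=> a b; rewrite !addn0 eq_sym; exact: ht.
have gt : gchain 0 0 theta.
  apply: (lift_gchain (j := 0) (M := 0) cP cP' _ homt) => // j.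
  by rewrite !addn0 expr0 scale1r cht.
pose tt : gmap k (tens P P) (tens P' P') := gtens theta theta.
have eqtt : equivariant G tt by exact: gtens_equi.
have chtt j : cdiff (tens P P) j.+1 j *m tt j j
    = tt j.+1 j.+1 *m cdiff (tens P' P') j.+1 j.
  by rewrite /tt (diff_gtens cP cP cP' cP' homt homt gt gt) ?simpdeg.
have Ttt j : tt j j *m swap P' P' j j = swap P P j j *m tt j j.
  by rewrite /tt (gtens_swap homt homt) ?simpdeg.
have ttf (b : gform k P') j x : concentrated x b ->
    tt j j *m ftens b b j = ftens (fun y => theta y y *m b y)
                                  (fun y => theta y y *m b y) j.
  move=> hb; rewrite /tt (gtens_mul_ftens homt homt hb) // !simpdeg.
  by apply: eq_ftens => y; rewrite dpull00.
pose f : gmap k P (tens P' P') := fun a b =>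
  Delta a a *m tt a b - theta a a *m D0 a b.
have [||K [_ eqK KE]] := null_homotopy (f := f) cP pP augPP.
- split.
  + move=> a b ne; rewrite /f hD0 // /tt (gtens_homd homt homt) ?mulmx0 ?subr0 //.
    by rewrite eq_sym in ne; rewrite !addn0.
  + move=> g a b Gg; rewrite /f mulmxBr mulmxBl !mulmxA eqD // eqt // -!mulmxA.
    by rewrite eqtt // eqD0.
  + move=> a; rewrite /f mulmxBr mulmxBl !mulmxA chD cht -!mulmxA chtt chD0.
    by [].
- rewrite /f mulmxBl -!mulmxA (ttf _ _ _ (aug_conc augP')).
  have := D0e 0%N; rewrite /pullback => ->; have := te 0%N; rewrite /pullback => ->.
  rewrite (@eq_ftens _ _ _ _ eps _ eps) ?De; last 2 first.
  + by move=> y; have := te y.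
  + by move=> y; have := te y.
  by have := De 0%N; rewrite /pullback => ->; rewrite subrr.
pose T' j : 'M[k]_(tens P' P' j) := 1%:M - swap P' P' j j.
pose X : gmap k P (tens P' P') := fun a b =>
  Y0 a b *m tt b b - theta a a *m D1 a b - K a b *m T' b.
have Xd a : X a a.+1 *m cdiff (tens P' P') a.+1 a
    = - (cdiff P a a.-1 *m X a.-1 a).
  have Td : T' a.+1 *m cdiff (tens P' P') a.+1 a
      = cdiff (tens P' P') a.+1 a *m T' a.
    rewrite /T' mulmxBl mul1mx -(swap_chain a cP' cP') -[X in X - _]mulmx1.
    exact: (esym (mulmxBr _ _ _)).
  have Y0d : Y0 a a.+1 *m cdiff (tens P P) a.+1 a
      = Delta a a - Delta a a *m swap P P a a - cdiff P a a.-1 *m Y0 a.-1 a.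
    by rewrite Y0E addrK.
  have D1d : D1 a a.+1 *m cdiff (tens P' P') a.+1 a
      = D0 a a *m T' a - cdiff P' a a.-1 *m D1 a.-1 a.
    by rewrite /T' mulmxBr mulmx1 D1E addrK.
  have Kd : K a a.+1 *m cdiff (tens P' P') a.+1 a
      = f a a - cdiff P a a.-1 *m K a.-1 a by rewrite KE addrK.
  have td : theta a a *m cdiff P' a a.-1 = cdiff P a a.-1 *m theta a.-1 a.-1.
    case: a {Td Y0d D1d Kd} => [|a]; last by rewrite cht.
    by rewrite (complex_deg cP) // (complex_deg cP') // mulmx0 mul0mx.
  have DT : Delta a a *m swap P P a a *m tt a a
      = Delta a a *m tt a a *m swap P' P' a a by rewrite -!mulmxA Ttt.
  rewrite /X !mulmxBl -!mulmxA -chtt Td D1d.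
  rewrite [Y0 a a.+1 *m _]mulmxA Y0d [K a a.+1 *m _]mulmxA Kd.
  rewrite [theta a a *m (_ - _)]mulmxBr [theta a a *m (cdiff _ _ _ *m _)]mulmxA.
  rewrite td /f !mulmxBl DT /T' !mulmxBr !mulmx1 !mulmxA.
  move: (Delta a a *m tt a a) (theta a a *m D0 a a) => A B.
  move: (A *m _) (B *m _) (_ *m tt a a) (_ *m D1 _ _) (_ *m K _ _)
    (_ *m K _ _ *m _) => x y z t r s.
  by apply/matrixP=> b c; rewrite !mxE; ring.
have [iu du] := ftens_cocycle cP' cP' hu cu cu.
have -> : Y0 i i.+1 *m ftens v v i.+1
     - theta i i *m (D1 i i.+1 *m ftens u u i.+1) = X i i.+1 *m ftens u u i.+1.
  rewrite /X !mulmxBl -!mulmxA (ttf _ _ _ hu) /T' mulmxBl mul1mx.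
  rewrite (swap_ftens _ hu hu) exprM sgn expr1n scale1r subrr mulmx0 subr0.
  by [].
apply: (exact_pullback1 (s := - 1) _ cP pP augPP).
- by rewrite mulrNN mulr1.
- move=> g a b Gg; rewrite /X !mulmxBr !mulmxBl; congr (_ - _ - _).
  + by rewrite mulmxA eqY0 // -!mulmxA eqtt.
  + by rewrite mulmxA eqt // -!mulmxA eqD1.
  rewrite mulmxA eqK // -!mulmxA /T' mulmx1 mul1mx.
  rewrite -(swap_equi P' P' b Gg) [X in _ - X = _]mulmxA eqK //.
  by rewrite -[X in _ - X = _]mulmxA.
- by move=> j; rewrite Xd scaleN1r opprK.
- by rewrite Xd (complex_deg cP) // mul0mx oppr0.
- by move=> g Gg; exact: iu.
exact: du.
Qed.

End Comparison.

(** * Multiples of a class *)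
Section Multiples.

Variables (k : fieldType) (gT : finGroupType) (G : {group gT}).
Variables (P : gcomplex k gT) (N : nat) (Delta : gmap k P (tens P P)).
Hypothesis cP : is_complex G P.
Hypothesis chDelta : chain_map G Delta.

(** A bounding cochain may be cut down to the one degree that matters. *)
Lemma coboundary_dpull M (c : gform k P) : coboundary G c -> concentrated M.+1 c ->
  exists w : gform k P, [/\ cochain G w, concentrated M w
    & forall i, c i = dpull 0 1 (cdiff P) w i].
Proof.
case=> b ib cb hc; exists (single (b M)); split.
- move=> g i Gg; have [->|ne] := eqVneq i M; first by rewrite single_at ib.
  by rewrite single_conc ?mulmx0.
- exact: single_conc.
move=> i; rewrite dpull01; have [->|ne] := eqVneq i M.+1.
  by rewrite single_at cb.
rewrite hc //; case: i ne => // i ne.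
by rewrite single_conc ?mulmx0.
Qed.

Lemma coboundary_of_exact M (c : gform k P) : concentrated M.+1 c ->
  exact_cochain G (c M.+1) -> coboundary G c.
Proof.
move=> hc [b ib cb]; exists (single (b : 'cV_(P M))).
  move=> g i Gg; have [->|ne] := eqVneq i M; first by rewrite single_at ib.
  by rewrite single_conc ?mulmx0.
move=> i; have [->|ne] := eqVneq i M.+1; first by rewrite single_at.
rewrite hc //; case: i ne => [|i] ne; first by rewrite (complex_deg cP) ?mul0mx.
by rewrite single_conc ?mulmx0.
Qed.

Lemma exact_of_coboundary M (c : gform k P) : coboundary G c ->
  exact_cochain G (c M.+1).
Proof. by case=> b ib cb; exists (b M); [move=> g Gg; exact: ib|exact: cb]. Qed.

Lemma cup_dpull_exact (xi w : gform k P) i : cocycle G xi -> cochain G w ->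
  concentrated N w ->
  exact_cochain G (Delta i.+1 i.+1 *m ftens xi (dpull 0 1 (cdiff P) w) i.+1).
Proof.
move=> [ix dx] iw hw; have [_ eqD chD] := chDelta.
have iF := ftens_equi ix iw.
apply: (exact_cochainI (b := Delta i i *m ftens xi w i)).
  by apply: invariant_equi => // g Gg; exact: iF.
rewrite mulmxA chD -mulmxA (diff_ftens _ _ cP cP hw).
have z j : dpull 0 1 (cdiff P) xi j = 0.
  by rewrite dpull01; case: j => [|j] //=; rewrite dx.
by rewrite (eq_ftens _ z (fun j => erefl (w j))) ftens0l scaler0 add0r.
Qed.

(** Only the component of degree N of the factor contributes to a product with
a class of degree N + 1 in degree 2N + 1. *)
Lemma multiple_of_iff (c z : gform k P) : concentrated (N + N)%N.+1 c ->
  concentrated N.+1 z ->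
  multiple_of G Delta c z <-> exists xi : gform k P,
    [/\ cocycle G xi, concentrated N xi
      & exact_cochain G (c (N + N)%N.+1
          - Delta (N + N)%N.+1 (N + N)%N.+1 *m ftens xi z (N + N)%N.+1)].
Proof.
move=> hc hz; split.
  case=> x [[ix dx] _ /(exact_of_coboundary (N + N)) ex].
  exists (single (x N)); split.
  - by apply: single_cocycle => // g Gg; exact: ix.
  - exact: single_conc.
  move: ex; rewrite /cup /pullback; congr (exact_cochain _ (_ - _ *m _)).
  apply: eq_mxcol => b; have lb := ltn_ord b.
  have [->|ne] := eqVneq (b : nat) N; first by rewrite single_at.
  have -> : z ((N + N).+1 - b)%N = 0 by apply: hz; lia.
  by rewrite !tensmx0 !scaler0.
case=> xi [cxi hxi ex]; exists xi; split=> //.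
  by exists N.+1 => i lt; rewrite hxi //; lia.
have hcup : concentrated (N + N)%N.+1 (cup Delta xi z).
  by move=> i ne; rewrite /cup /pullback (ftens_conc hxi hz) ?mulmx0 //; lia.
apply: coboundary_of_exact ex; move=> i ne.
by rewrite hc // hcup // subr0.
Qed.

End Multiples.

(** * The two cases of the theorem *)
Section LiftingTheorem.

Variables (k : fieldType) (gT : finGroupType) (G : {group gT}).
Variables (P : gcomplex k gT) (eps : gform k P) (N : nat).
Hypothesis resP : resolution G eps.
Let Q := shift N P.
Let e : gform k Q := shift_form N eps.
Variable alpha : gmap k P (susp Q).
Hypothesis alpha_chain : chain_map G alpha.
Let a : gmap k P Q := desusp alpha.

Lemma desusp_homd : homd 0 1 a.
Proof.
move=> i j ne; have [h _ _] := alpha_chain.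
have ne' : j.+1 != (0 + i)%N by lia.
exact: (h i j.+1 ne').
Qed.

Lemma desusp_equi : equivariant G a.
Proof. by have [_ h _] := alpha_chain => g i j Gg; exact: (h g i j.+1 Gg). Qed.

Let augP : augmented G 0 eps := augmented_resolution resP.
Let pP : degreewise_projective G P := res_proj resP.

Let augpQ : augmented G N e /\ degreewise_projective G Q.
Proof. by have := shift_augmented N augP pP; rewrite addn0. Qed.

Let augQ := augpQ.1.
Let pQ := augpQ.2.
Let cP := aug_complex augP.
Let cQ := aug_complex augQ.

Lemma desusp_diff i j l : cdiff P i j *m a j l + a i j *m cdiff Q j l = 0.
Proof.
have [ej|ne] := eqVneq j l.+1; last first.
  rewrite (complex_deg cQ ne) mulmx0 addr0.
  by rewrite (desusp_homd (a := j) (b := l)) ?mulmx0 //; lia.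
have [ei|ne] := eqVneq i j.+1; last first.
  rewrite (complex_deg cP ne) mul0mx add0r.
  by rewrite (desusp_homd (a := i) (b := j)) ?mul0mx //; lia.
have [_ _ ch] := alpha_chain; have := ch j.
rewrite ei ej /= mulmxN => E.
by apply/eqP; rewrite addr_eq0; apply/eqP.
Qed.

Variables (z : gform k P) (Delta : gmap k P (tens P P)).
Variables (Delta1 : gmap k Q (tens Q P)) (Delta2 : gmap k Q (tens P Q)).
Hypothesis hz : concentrated N.+1 z.
Hypothesis alpha_z : cohomologous G (pullback 0 alpha (susp_form e)) z.
Hypothesis covD : covers G Delta eps (ftens eps eps).
Hypothesis covD1 : covers G Delta1 e (ftens e eps).
Hypothesis covD2 : covers G Delta2 e (ftens eps e).
Variable psi : gmap k (ext a) (ext2 a).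
Hypothesis psi_chain : chain_map G psi.
Hypothesis psi_ext : extends_diagonals Delta Delta1 Delta2 psi.
Hypothesis sgn : (-1) ^+ N.+1 = 1 :> k.

Let ha := desusp_homd.
Let eqa := desusp_equi.
Let da := desusp_diff.
Let hzeta : concentrated N.+1 (zeta a e) := zeta_conc augQ ha.
Let czeta : cocycle G (zeta a e) := zeta_cocycle augQ ha eqa da.

Let augQP : augmented G N (ftens e eps : gform k (tens Q P)).
Proof. by have := tens_augmented augQ augP; rewrite addn0. Qed.

Let augPP : augmented G 0 (ftens eps eps : gform k (tens P P)).
Proof. by have := tens_augmented augP augP; rewrite addn0. Qed.

(** Both Δ1 and T Δ2 cover the same map k -> k ⊗ k; the sign of T on the
lowest degree is 1 because one factor has degree 0. *)
Lemma swap_homotopy_Q : exists2 Y : gmap k Q (tens Q P), equivariant G Y &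
  forall i, Delta1 i i - Delta2 i i *m swap P Q i i
  = Y i i.+1 *m cdiff (tens Q P) i.+1 i + cdiff Q i i.-1 *m Y i.-1 i.
Proof.
have [[h1 eq1 ch1] c1] := covD1; have [[h2 eq2 ch2] c2] := covD2.
pose f : gmap k Q (tens Q P) := fun i j =>
  Delta1 i j - Delta2 i j *m swap P Q j j.
have [||Y [_ eqY YE]] := null_homotopy (f := f) cQ pQ augQP; last by exists Y.
  split.
  - by move=> i j ne; rewrite /f h1 // h2 // mul0mx subr0.
  - move=> g i j Gg; rewrite /f mulmxBr mulmxBl eq1 // mulmxA eq2 // -!mulmxA.
    by rewrite (swap_equi P Q j Gg).
  move=> i; rewrite /f mulmxBr mulmxBl ch1 mulmxA ch2 -!mulmxA.
  by rewrite (swap_chain i cP cQ).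
rewrite /f mulmxBl -mulmxA.
rewrite (swap_ftens _ (aug_conc augQ) (aug_conc augP)) muln0 expr0 scale1r.
have := c1 N; rewrite /pullback => ->; have := c2 N; rewrite /pullback => ->.
by rewrite subrr.
Qed.

Lemma swap_homotopy_P : exists2 Y : gmap k P (tens P P), equivariant G Y &
  forall i, Delta i i - Delta i i *m swap P P i i
  = Y i i.+1 *m cdiff (tens P P) i.+1 i + cdiff P i i.-1 *m Y i.-1 i.
Proof.
have [[h1 eq1 ch1] c1] := covD.
pose f : gmap k P (tens P P) := fun i j =>
  Delta i j - Delta i j *m swap P P j j.
have [||Y [_ eqY YE]] := null_homotopy (f := f) cP pP augPP; last by exists Y.
  split.
  - by move=> i j ne; rewrite /f h1 // mul0mx subr0.
  - move=> g i j Gg; rewrite /f mulmxBr mulmxBl eq1 // mulmxA eq1 // -!mulmxA.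
    by rewrite (swap_equi P P j Gg).
  move=> i; rewrite /f mulmxBr mulmxBl ch1 mulmxA ch1 -!mulmxA.
  by rewrite (swap_chain i cP cP).
rewrite /f mulmxBl -mulmxA.
rewrite (swap_ftens _ (aug_conc augP) (aug_conc augP)) muln0 expr0 scale1r.
by rewrite subrr.
Qed.

Lemma lifts_iff_cup_one_sq (Y0 : gmap k P (tens P P)) : equivariant G Y0 ->
  (forall i, Delta i i - Delta i i *m swap P P i i
  = Y0 i i.+1 *m cdiff (tens P P) i.+1 i + cdiff P i i.-1 *m Y0 i.-1 i) ->
  lifts G psi <-> exists xi : gform k P,
  [/\ cocycle G xi, concentrated N xi
    & exact_cochain G (cup_one_sq N Y0 (zeta a e)
        - Delta (N + N)%N.+1 (N + N)%N.+1 *m ftens xi (zeta a e) (N + N)%N.+1)].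
Proof.
move=> eqY0 Y0E; have [Y eqY YE] := swap_homotopy_Q.
exact: (lifts_iff_cup_one augP pP augQ pQ ha eqa da covD covD1 covD2 psi_chain
  psi_ext eqY YE eqY0 Y0E sgn).
Qed.

(** By [cup_one_sym] twice the cup-one square of ζ is a coboundary, so it is
the zero multiple of ζ. *)
Theorem lifts_of_two_neq0 : (2%:R != 0 :> k) -> lifts G psi.
Proof.
move=> k2; have [Y0 eqY0 Y0E] := swap_homotopy_P.
apply/(lifts_iff_cup_one_sq eqY0 Y0E); exists (fun i => 0); split.
- by split=> [g i _|i]; rewrite mulmx0.
- by [].
rewrite ftens0l mulmx0 subr0.
have := cup_one_sym augP pP eqY0 Y0E (N + N)%N.+1 czeta czeta hzeta.
rewrite (swap_ftens _ hzeta hzeta) exprM sgn expr1n scale1r.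
rewrite -mulr2n -scaler_nat -scalemxAr.
move/(exact_cochainZ (2%:R)^-1); rewrite scalerA mulVf // scale1r.
by [].
Qed.

Lemma zeta_cohomologous : exists w : gform k P, [/\ cochain G w,
  concentrated N w & forall i, zeta a e i = z i + dpull 0 1 (cdiff P) w i].
Proof.
have hc : concentrated N.+1 (fun i => pullback 0 alpha (susp_form e) i - z i).
  move=> i ne; rewrite hz // subr0; case: i ne => [|i] ne.
    by rewrite /pullback mulmx0.
  have := hzeta ne; rewrite (zetaE e ha) => <-; exact: erefl.
have [w [iw hw wE]] := coboundary_dpull alpha_z hc; exists w; split=> // i.
rewrite -wE addrC subrK (zetaE e ha); case: i => [|i]; last exact: erefl.
by rewrite /pullback mulmx0 ha ?mul0mx.
Qed.

Section CharacteristicTwo.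

Hypothesis char2 : 2%N \in [pchar k].
Variables (F : fieldType) (iota : {rmorphism F -> k}).
Variables (P0 : gcomplex F gT) (eps0 : gform F P0).
Hypothesis resP0 : resolution G eps0.
Variables (D0 D1 : gmap F P0 (tens P0 P0)).
Hypothesis covD0 : covers G D0 eps0 (ftens eps0 eps0).
Hypothesis eqD1 : equivariant G D1.
Hypothesis D1E : forall i, D1 i i.+1 *m cdiff (tens P0 P0) i.+1 i
    + cdiff P0 i i.-1 *m D1 i.-1 i = D0 i i + D0 i i *m gswap P0 i i.
Variable theta : gmap k P (base_change iota P0).
Hypothesis covtheta : covers G theta eps (base_change_form iota eps0).
Variables (I : finType) (u : I -> gform F P0) (lambda : I -> k).
Hypothesis hu : forall b, cocycle G (u b) /\ concentrated N.+1 (u b).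
Hypothesis zeta_u : cohomologous G z
  (fun i => \sum_b lambda b *: extend_form theta (u b) i).
Variable S : gform k P.
Hypothesis SE : forall i, S i = \sum_b lambda b ^+ 2 *:
  (theta i i *m map_mx iota (D1 i i.+1 *m ftens (u b) (u b) i.+1)).

Let P' := base_change iota P0.
Let eps' : gform k P' := base_change_form iota eps0.
Let D0' : gmap k P' (tens P' P') := map_gmap iota D0.
Let D1' : gmap k P' (tens P' P') := map_gmap iota D1.

Lemma base_change_equi (f : gmap F P0 (tens P0 P0)) : equivariant G f ->
  equivariant G (map_gmap iota f : gmap k P' (tens P' P')).
Proof.
by move=> eqf g i j Gg; rewrite -map_tens_act /map_gmap /= -!map_mxM eqf.
Qed.

Lemma base_change_covers : covers G D0' eps' (ftens eps' eps').
Proof.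
have [[h eq ch] c] := covD0; split.
  split; [|exact: base_change_equi|].
    by move=> i j ne; rewrite /D0' /map_gmap h // map_mx0.
  by move=> i; rewrite -map_tens_diff /D0' /map_gmap /= -!map_mxM ch.
move=> i; have := c i; rewrite /pullback => ci.
by rewrite /eps' /base_change_form -ci map_mxM map_ftens.
Qed.

(** Over the prime field the cup-one relation has no sign; in characteristic 2
it is the relation with the sign. *)
Lemma base_change_cup_one i : D0' i i - D0' i i *m swap P' P' i i
  = D1' i i.+1 *m cdiff (tens P' P') i.+1 i + cdiff P' i i.-1 *m D1' i.-1 i.
Proof.
have opp2 (m n : nat) (A : 'M[k]_(m, n)) : - A = A.
  by apply/matrixP=> x y; rewrite !mxE oppr_pchar2.
rewrite opp2 -map_tens_diff /D1' /map_gmap /= -!map_mxM -map_mxD D1E.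
by rewrite map_mxD map_mxM gswapE map_swap.
Qed.

Lemma steenrod_conc : concentrated (N + N)%N.+1 S.
Proof.
move=> i ne; rewrite SE big1 // => b _.
rewrite (ftens_conc (hu b).2 (hu b).2); last by lia.
by rewrite mulmx0 map_mx0 mulmx0 scaler0.
Qed.

Lemma extend_formE b i :
  extend_form theta (u b) i = theta i i *m map_mx iota (u b i).
Proof. by []. Qed.

Lemma extend_form_cocycle b : cocycle G (extend_form theta (u b))
  /\ concentrated N.+1 (extend_form theta (u b)).
Proof.
have [[_ eqt cht] _] := covtheta; have [cu hub] := hu b.
have [iu du] := base_change_cocycle iota cu.
split; last by move=> i ne; rewrite extend_formE hub // map_mx0 mulmx0.
split=> [g i Gg|i]; rewrite extend_formE mulmxA.
  by rewrite eqt // -mulmxA (iu g i Gg).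
by rewrite cht -mulmxA (du i) mulmx0.
Qed.

(** Up to a coboundary zeta is the combination of the extended classes u, and
the cup-one square kills the coboundary, is additive and semilinear; on each u
it agrees with the Steenrod square computed in P0. *)
Lemma cup_one_sq_steenrod (Y0 : gmap k P (tens P P)) : equivariant G Y0 ->
  (forall i, Delta i i - Delta i i *m swap P P i i
  = Y0 i i.+1 *m cdiff (tens P P) i.+1 i + cdiff P i i.-1 *m Y0 i.-1 i) ->
  exact_cochain G (cup_one_sq N Y0 (zeta a e) - S (N + N)%N.+1).
Proof.
move=> eqY0 Y0E; pose v b := extend_form theta (u b).
have cv := extend_form_cocycle.
pose vs : gform k P := fun i => \sum_b lambda b *: v b i.
have cvs : cocycle G vs.
  split=> [g i Gg|i]; rewrite mulmx_sumr.
    by apply: eq_bigr => b _; rewrite -scalemxAr (cv b).1.1.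
  by rewrite big1 // => b _; rewrite -scalemxAr (cv b).1.2 scaler0.
have hvs : concentrated N.+1 vs.
  by move=> i ne; rewrite /vs big1 // => b _; rewrite /v (cv b).2 ?scaler0.
have [w1 [iw1 hw1 w1E]] := zeta_cohomologous.
have [|w2 [iw2 hw2 w2E]] := coboundary_dpull (M := N) zeta_u.
  by move=> i ne; rewrite hz // -/(vs i) hvs // subr0.
pose w i := w1 i + w2 i.
have iw : cochain G w by move=> g i Gg; rewrite mulmxDr iw1 // iw2.
have hw : concentrated N w by move=> i ne; rewrite /w hw1 // hw2 // addr0.
have zE i : zeta a e i = vs i + dpull 0 1 (cdiff P) w i.
  rewrite w1E; have := w2E i => /eqP; rewrite subr_eq => /eqP->.
  rewrite !dpull01 /w; case: (0 < i)%N; last by rewrite !addr0 add0r.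
  rewrite mulmxDr -[\sum_b _]/(vs i).
  move: (_ *m w1 _) (_ *m w2 _) (vs i) => A B C.
  by apply/matrixP=> x y; rewrite !mxE; ring.
have cD := cup_one_sqD (N := N) augP pP eqY0 Y0E sgn cvs
  (coboundary_cocycle augP iw) hvs (coboundary_conc hw).
have cW := cup_one_sq_coboundary augP covD.1 eqY0 Y0E sgn iw hw.
have cS := cup_one_sq_sum (N := N) augP pP eqY0 Y0E sgn (index_enum I) lambda cv.
have cT : exact_cochain G (\sum_b lambda b ^+ 2 *: cup_one_sq N Y0 (v b)
                           - S (N + N)%N.+1).
  rewrite SE -sumrB; apply: exact_cochain_sum => b _.
  rewrite -scalerBr; apply: exact_cochainZ.
  have [iu du] := hu b.
  have := cup_one_natural augP pP covD eqY0 Y0E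
    (base_change_augmented iota (augmented_resolution resP0))
    base_change_covers (base_change_equi eqD1) base_change_cup_one covtheta
    (N + N)%N.+1 (base_change_cocycle iota iu)
    (w := N.+1) _ sgn.
  move=> H; rewrite map_mxM map_ftens; apply: H.
  by move=> i ne; rewrite /base_change_form du // map_mx0.
rewrite (eq_cup_one_sq N Y0 zE).
have := exact_cochainD (exact_cochainD (exact_cochainD cD cW) cS) cT.
rewrite -/vs.
move: (cup_one_sq N Y0 vs) (cup_one_sq _ _ (dpull _ _ _ _))
  (cup_one_sq _ _ (fun i => vs i + _)) (\sum_b _) (S _) => A B C E X.
by congr (exact_cochain _ _); apply/matrixP=> x y; rewrite !mxE; ring.
Qed.

(** Replacing the cup-one square by the Steenrod square, and e α by the given
representative of ζ, changes both sides of the equation by coboundaries. *)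
Theorem lifts_iff_multiple : lifts G psi <-> multiple_of G Delta S z.
Proof.
have [Y0 eqY0 Y0E] := swap_homotopy_P.
rewrite (lifts_iff_cup_one_sq eqY0 Y0E).
rewrite (multiple_of_iff Delta cP steenrod_conc hz).
have SY := cup_one_sq_steenrod eqY0 Y0E.
have [w [iw hw wE]] := zeta_cohomologous.
have cupE (xi : gform k P) : cocycle G xi -> exact_cochain G
    (Delta (N + N)%N.+1 (N + N)%N.+1 *m ftens xi (zeta a e) (N + N)%N.+1
     - Delta (N + N)%N.+1 (N + N)%N.+1 *m ftens xi z (N + N)%N.+1).
  move=> cxi; rewrite (eq_ftens _ (fun i => erefl (xi i)) wE) ftensDr mulmxDr.
  rewrite addrC addKr; exact: (cup_dpull_exact cP covD.1 (N + N)%N cxi iw hw).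
split=> [[xi [cxi hxi ex]] | [xi [cxi hxi ex]]]; exists xi; split=> //.
  have := exact_cochainD (exact_cochainB ex SY) (cupE _ cxi).
  congr (exact_cochain _ _).
  move: (cup_one_sq _ _ _) (S _) (_ *m ftens xi (zeta a e) _) (_ *m ftens xi z _).
  by move=> A B C E; apply/matrixP=> i j; rewrite !mxE; ring.
have := exact_cochainB (exact_cochainD ex SY) (cupE _ cxi).
congr (exact_cochain _ _).
move: (cup_one_sq _ _ _) (S _) (_ *m ftens xi (zeta a e) _) (_ *m ftens xi z _).
by move=> A B C E; apply/matrixP=> i j; rewrite !mxE; ring.
Qed.

End CharacteristicTwo.

End LiftingTheorem.

Theorem theorem1p3 (gT : finGroupType) (G : {group gT})
    (k : fieldType) (p : nat) (charkp : p \in [pchar k])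
    (n : nat) (n_gt0 : (0 < n)%N)
    (* the projective resolution P of k, and Q *)
    (P : gcomplex k gT) (eps : gform k P) (resP : resolution G eps) :
  let Q := shift n.-1 P in
  let epsQ : gform k Q := shift_form n.-1 eps in
  forall
    (* the class zeta *)
    (zeta : gform k P) (zeta_cocycle : cocycle G zeta)
    (zeta_deg : concentrated n zeta) (zeta_neq0 : ~ coboundary G zeta)
    (* the chain map alpha : P -> ΣQ representing zeta *)
    (alpha : gmap k P (susp Q)) (alpha_chain : chain_map G alpha)
    (alpha_zeta : cohomologous G (pullback 0 alpha (susp_form epsQ)) zeta)
    (Delta : gmap k P (tens P P)) (Delta1 : gmap k Q (tens Q P))
    (Delta2 : gmap k Q (tens P Q))
    (Delta_covers : covers G Delta eps (ftens eps eps))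
    (Delta1_covers : covers G Delta1 epsQ (ftens epsQ eps))
    (Delta2_covers : covers G Delta2 epsQ (ftens eps epsQ)),
  let a : gmap k P Q := desusp alpha in
  forall
    (psi : gmap k (ext a) (ext2 a)) (psi_chain : chain_map G psi)
    (psi_ext : extends_diagonals Delta Delta1 Delta2 psi),
  let psi_lifts :=
    exists psit : gmap k (ext a) (tens (ext a) (ext a)),
      chain_map G psit /\
      forall i, psit i i *m ext_pi a i i = psi i i in
  ((2 < p)%N -> ~~ odd n -> psi_lifts)
  /\
  (p = 2%N ->
   forall (iota : {rmorphism 'F_2 -> k})
     (* a resolution over 'F_2 with a cup-i system, and its comparison with P *)
     (P0 : gcomplex 'F_2 gT) (eps0 : gform 'F_2 P0) (resP0 : resolution G eps0)
     (D : nat -> gmap 'F_2 P0 (tens P0 P0)) (cupD : cup_i_system G eps0 D)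
     (theta : gmap k P (base_change iota P0))
     (theta_covers : covers G theta eps (base_change_form iota eps0))
     (* a basis u of H^n(G, k) lying in H^n(G, 'F_2) *)
     (N : nat) (u : 'I_N -> gform 'F_2 P0)
     (u_cocycle : forall b, cocycle G (u b) /\ concentrated n (u b))
     (u_basis : cohomology_basis G n (fun b => extend_form theta (u b)))
     (lambda : 'I_N -> k)
     (zeta_u : cohomologous G zeta
        (fun i => \sum_b lambda b *: extend_form theta (u b) i)),
   (psi_lifts <->
    multiple_of G Delta
      (fun i => \sum_b lambda b ^+ 2 *:
                  extend_form theta (steenrod_sq D n n.-1 (u b)) i)
      zeta)).
Proof.
case: n n_gt0 => // N _ Q epsQ z cz hz _ alpha ch_alpha alpha_z Delta Delta1
  Delta2 covD covD1 covD2 a psi ch_psi psi_ext psi_lifts.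
split=> [p_gt2 n_even|p2 iota P0 eps0 resP0 D cupD theta covtheta M u hu _ lambda
  zeta_u].
  apply: (lifts_of_two_neq0 (N := N) resP ch_alpha covD covD1 covD2 ch_psi
    psi_ext).
    by rewrite -signr_odd (negPf n_even).
  rewrite -(dvdn_pcharf charkp); apply/negP=> /(dvdn_leq (isT : 0 < 2)%N).
  by rewrite leqNgt p_gt2.
have char2 : 2%N \in [pchar k] by rewrite -p2.
have sgn : (-1) ^+ N.+1 = 1 :> k by rewrite oppr_pchar2 // expr1n.
have [covD0 hD DE] := cupD.
refine (lifts_iff_multiple (N := N) resP ch_alpha hz alpha_z covD covD1 covD2
  ch_psi psi_ext sgn char2 resP0 covD0 (hD 1%N).2 (fun i => DE 0%N i i)
  covtheta hu zeta_u _).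
move=> i; apply: eq_bigr => b _; congr (_ *: _).
rewrite /extend_form /pullback /base_change_form /steenrod_sq leqnSn.
by have -> : (N.+1 - N)%N = 1%N by rewrite subSnn.
Qed.
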